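(* Let $R=k[x_1,\ldots,x_d]$ be a standard graded polynomial ring over an infinite field $k$, with $d\geq 3$, and let $n\geq d+1$. Let $\phi=\begin{bmatrix}\Phi_1\\ \Phi_2\end{bmatrix}$ be an $n\times(n-1)$ matrix over $R$, where $\Phi_1$ is a $d\times(n-1)$ matrix with homogeneous entries of degree $\epsilon_1\geq 1$ and $\Phi_2$ is an $(n-d)\times(n-1)$ matrix with homogeneous entries of degree $\epsilon_2=1$. Assume that $I:=I_{n-1}(\phi)$ has codimension two, and let $J\subset I$ be the ideal generated by the $d$ maximal minors of $\phi$ that fix the submatrix $\Phi_2$ (i.e., those obtained by omitting a row of $\Phi_1$). Assume that the following equivalent conditions hold: $J^{\rm sat}=I$; $\operatorname{ht} I_{n-d}(\Phi_2)=d$; the Buchsbaum–Rim complex of $\Phi_2$ is a graded minimal free resolution of $I/J$. Then: (a) $J$ satisfies $G_\infty$ if and only if $I$ satisfies $G_d$. (b) If $\epsilon_1=\epsilon_2=1$ then $J$ is a reduction of $I$. (c) If $d=3$ then $J$ is of linear type if and only if $I$ satisfies $G_3$.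
   Context: $I_t(\cdot)$ denotes the ideal generated by the $t\times t$ minors. $J^{\rm sat}=\bigcup_{l\geq 1}J:(x_1,\ldots,x_d)^l$. An ideal $I$ in a Noetherian ring satisfies $G_s$ ($s\geq 2$) if for every prime $P\supset I$ with $\operatorname{ht}P\leq s-1$ the minimal number of generators of $I_P$ is at most $\operatorname{ht}P$; it satisfies $G_\infty$ if it satisfies $G_s$ for every $s$. $J$ is a reduction of $I$ if $J\subset I$ and $I^{l+1}=JI^l$ for some $l\geq 0$. $J$ is of linear type if the natural surjection from the symmetric algebra of $J$ to the Rees algebra of $J$ is an isomorphism. *)

(* Defs.v *)
From HB Require Import structures.
From mathcomp Require Import all_boot all_order all_algebra fraction.
From mathcomp Require Import boolp classical_sets cardinality.
From mathcomp Require Import finmap monalg mpoly.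

Set Implicit Arguments.
Unset Strict Implicit.
Unset Printing Implicit Defensive.

Import GRing.Theory.
Local Open Scope classical_set_scope.
Local Open Scope ring_scope.

Section Ideals.
Variable A : comNzRingType.
Implicit Types (X I J P : set A) (s h t : nat).

Definition is_ideal I : Prop :=
  [/\ I 0, forall a b, I a -> I b -> I (a + b) & forall r a, I a -> I (r * a)].

Definition ideal_gen X : set A :=
  [set a | exists m (c g : 'I_m -> A),
      (forall i, X (g i)) /\ a = \sum_(i < m) c i * g i].

Definition ideal_mul I J : set A :=
  ideal_gen [set a | exists x y, [/\ I x, J y & a = x * y]].

Definition ideal_exp I l : set A := iter l (ideal_mul I) setT.

Definition ideal_colon J I : set A := [set a | forall b, I b -> J (a * b)].

Definition is_prime P : Prop :=
  [/\ is_ideal P, ~ P 1 & forall a b, P (a * b) -> P a \/ P b].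

Definition prime_chain P h (Q : nat -> set A) : Prop :=
  [/\ forall i, (i <= h)%N -> is_prime (Q i),
      forall i, (i < h)%N -> Q i `<` Q i.+1
    & Q h = P].

Definition prime_height P h : Prop :=
  (exists Q, prime_chain P h Q) /\
  (forall h' Q, prime_chain P h' Q -> (h' <= h)%N).

(* The unit ideal has no height in this sense (conventionally +oo). *)
Definition ideal_height I h : Prop :=
  (exists P, [/\ is_prime P, I `<=` P & prime_height P h]) /\
  (forall P h', is_prime P -> I `<=` P -> prime_height P h' -> (h <= h')%N).

Definition is_reduction J I : Prop :=
  J `<=` I /\
  exists l, ideal_exp I l.+1 = ideal_mul J (ideal_exp I l).

(* The t x t minors, one for each choice of t rows and t columns. *)
Definition increasing t p (f : 'I_t -> 'I_p) : Prop :=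
  forall i j : 'I_t, (i < j)%N -> (f i < f j)%N.

Definition minors_ideal p q t (M : 'M[A]_(p, q)) : set A :=
  ideal_gen [set a | exists (f : 'I_t -> 'I_p) (g : 'I_t -> 'I_q),
      [/\ increasing f, increasing g & a = \det (mxsub f g M)]].

(* Sym(J) is the polynomial ring A[T_a | a in J] modulo the ideal generated by
   sym_relations J, and the Rees algebra A[Jt] is the image of rees_map J in
   A[t]; so the natural surjection Sym(J) -> A[Jt] induced by T_a |-> a t is an
   isomorphism iff the kernel of rees_map J is that ideal. *)
Definition symvar J : choiceType := {a : A | `[< J a >]}.

Definition symfree J : comNzRingType := {malg A[{cmonom (symvar J)}]}.

Definition symT J (a : symvar J) : {malg A[{cmonom (symvar J)}]} :=
  mkmalgU (ucm a) 1.

Definition rees_map J (F : symfree J) : {poly A} :=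
  \sum_(m <- monalg.msupp F)
    (monalg.mcoeff m F)%:P * \prod_(a <- finsupp m) (val a *: 'X) ^+ m a.

End Ideals.

Definition sym_relations (A : comNzRingType) (J : set A) : set (symfree J) :=
  [set F | (exists a b c : symvar J,
              val c = val a + val b /\ F = symT c - symT a - symT b) \/
           (exists (r : A) (a c : symvar J),
              val c = r * val a /\ F = symT c - r *: symT a)].

Arguments sym_relations {A} J.

Definition linear_type (A : comNzRingType) (J : set A) : Prop :=
  forall F : symfree J, rees_map F = 0 <-> ideal_gen (sym_relations J) F.

Section Localization.
Variable A : idomainType.
Implicit Types (I P : set A).

(* Inside the fraction field of A; loc_ideal P setT is the local ring A_P and
   loc_ideal P I is the extended ideal I_P. *)
Definition loc_ideal P I : set {fraction A} :=
  [set x | exists a s, [/\ I a, ~ P s & x = tofrac a / tofrac s]].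

Definition loc_generated P I m : Prop :=
  exists u : 'I_m -> {fraction A},
    (forall i, loc_ideal P I (u i)) /\
    (forall x, loc_ideal P I x ->
       exists c : 'I_m -> {fraction A},
         (forall i, loc_ideal P setT (c i)) /\ x = \sum_(i < m) c i * u i).

Definition loc_mu_le P I h : Prop :=
  exists m, (m <= h)%N /\ loc_generated P I m.

Definition satisfies_G (s : nat) I : Prop :=
  forall P h, is_prime P -> I `<=` P -> prime_height P h -> (h <= s.-1)%N ->
    loc_mu_le P I h.

Definition satisfies_Ginf I : Prop :=
  forall s, (2 <= s)%N -> satisfies_G s I.

End Localization.

Section Graded.
Variables (k : fieldType) (d : nat).
Local Notation R := {mpoly k[d]}.

Definition irrelevant : set R :=
  ideal_gen [set a : R | exists i : 'I_d, a = 'X_i].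

Definition saturation (J : set R) : set R :=
  [set a | exists l, (1 <= l)%N /\ ideal_colon J (ideal_exp irrelevant l) a].

Definition mat_apply (B C : finType) (M : B -> C -> R) (x : {ffun C -> R}) :
    {ffun B -> R} := [ffun b => \sum_(c : C) M b c * x c].

(* A complex of free modules with finite bases B i and differentials given by
   the matrices D i : R^(B i.+1) -> R^(B i); the basis element b of B i is put
   in degree deg i b, and the augmentation R^(B 0) -> K / L sends b to u b. *)
Definition graded_minimal_free_resolution (K L : set R) (B : nat -> finType)
    (D : forall i, B i -> B i.+1 -> R) : Prop :=
  exists (deg : forall i, B i -> nat) (u : B 0%N -> R),
  [/\ (forall b, K (u b) /\ u b \is (deg 0%N b).-homog),
      (forall a, K a -> exists c : {ffun B 0%N -> R},
          L (a - \sum_(b : B 0%N) c b * u b)),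
      (forall c : {ffun B 0%N -> R},
          L (\sum_(b : B 0%N) c b * u b) <-> exists y, c = mat_apply (@D 0%N) y)
    & (forall i (x : {ffun B i.+1 -> R}),
          mat_apply (@D i) x = 0 <-> exists y, x = mat_apply (@D i.+1) y)] /\
  [/\ (forall i b b', D i b b' <> 0 ->
          exists e, deg i.+1 b' = (deg i b + e)%N /\ D i b b' \is e.-homog)
    & (forall i b b', irrelevant (D i b b'))].

End Graded.

(* The Buchsbaum-Rim complex of M : F = A^f -> G = A^g is
     ... -> D_1(G^* ) (x) /\^(g+2) F -> /\^(g+1) F -> F -> G,
   D_i being divided powers. The term D_i(G^* ) (x) /\^(g+1+i) F sits in position
   i + 2, with basis the pairs (m, S): m a multi-index of weight i, standing for
   the divided power monomial, and S a set of g+1+i columns. *)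
Section BuchsbaumRim.
Variables (A : comNzRingType) (g f : nat) (M : 'M[A]_(g, f)).

Definition br_basis (i : nat) : finType :=
  match i with
  | 0 => 'I_g
  | 1 => 'I_f
  | i.+2 => {p : 'X_{1..g < i.+1} * {set 'I_f} |
               (mdeg p.1 == i) && (#|p.2| == g + 1 + i)%N}
  end.

Definition br_sign (s : 'I_f) (S : {set 'I_f}) : A :=
  (-1) ^+ #|[set t in S | (t < s)%N]|.

(* e_S |-> \sum_(s in S) +/- (minor of M on the columns S \ s) e_s *)
Definition br_splice (s : 'I_f) (S : {set 'I_f}) : A :=
  if s \in S then
    br_sign s S *
      \det (\matrix_(i < g, j < g) M i (nth s (enum (S :\ s)) j))
  else 0.

(* m (x) e_S |-> \sum_(j, s in S) +/- M j s (m - U_j) (x) e_(S \ s) *)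
Definition br_koszul (m' : 'X_{1..g}) (S' : {set 'I_f})
    (m : 'X_{1..g}) (S : {set 'I_f}) : A :=
  \sum_(j < g) \sum_(s in S | (m == (m' + U_(j))%MM) && (S' == S :\ s))
     br_sign s S * M j s.

Definition br_diff (i : nat) : br_basis i -> br_basis i.+1 -> A :=
  match i return br_basis i -> br_basis i.+1 -> A with
  | 0 => fun a b => M a b
  | 1 => fun a b => br_splice a (val b).2
  | i.+2 => fun a b =>
      br_koszul (val a).1 (val a).2 (val b).1 (val b).2
  end.

End BuchsbaumRim.

Section FixedMinors.
Variables (A : comNzRingType) (d p q : nat).

(* The ideal of the maximal minors of [M1; M2] (with q columns) obtained by
   omitting one row of M1; it is only used when d + p = q + 1. *)
Definition fixed_minors_ideal (M1 : 'M[A]_(d, q)) (M2 : 'M[A]_(p, q)) : set A :=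
  ideal_gen [set a | exists (i : 'I_d) (f : 'I_q -> 'I_(d + p)),
      [/\ increasing f, forall l, f l != lshift p i
        & a = \det (rowsub f (col_mx M1 M2))]].

End FixedMinors.

(* Main.v *)
Require Import Defs.
From HB Require Import structures.
From mathcomp Require Import all_boot all_order all_algebra fraction.
From mathcomp Require Import perm generic_quotient ring_quotient.
From mathcomp Require Import boolp classical_sets cardinality.
From mathcomp Require finmap monalg.
From mathcomp Require Import mpoly.
From mathcomp Require Import zify ring.

(** Each of the three equivalent conditions says that the cokernel of Phi2 has
    finite length: some power of every variable x annihilates it
    (finite_colength). From J^sat = I this follows by the Hilbert-Burch theorem,
    as the last rows of a relation between the maximal minors of phi are in the
    image of Phi2. In the two other cases one would otherwise find a point with
    values in a field, off the origin, where Phi2 is not surjective. The prime of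
    the line through the point contains the maximal minors of Phi2 and has height
    less than d, contrary to the second condition. As the line is cut out by d - 1
    linear forms, the restriction of the Buchsbaum-Rim complex to it would be exact
    at the last term, while a functional that kills the image of Phi2 at the point
    provides a nonzero cycle there (br_finite_colength). It follows that a power of
    every variable multiplies I into J. A prime of height less than d avoids some
    variable, so I and J agree at all these primes.

    (a) is then immediate, J being generated by d elements (G_equivalence).

    (b) Let T be variables for the n maximal minors and write T phi = x B with the
    Jacobian dual B, a matrix of linear forms in T. The maximal minors of B vanish
    on the special fibre ring of I. At a point of this ring where the variables of
    J vanish B has a nonzero left kernel vector a, and the remaining coordinates of
    the point kill the image of Phi2 at a, so that they vanish. Hence the special
    fibre ring of I is finite over that of J, which makes J a reduction of I
    (linear_reduction).

    (c) Both conditions are equivalent to the absence of common zeros off the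
    origin of the entries of the syzygies of the d generators f of J
    (syz_primary). For the condition G this holds because the generators are
    minimal exactly where these entries vanish (G_syz_primary, syz_primary_mu).
    If the entries vanish along a line through the origin, the symmetric algebra
    of J has over this line a fibre as large as the Rees algebra, so J is not of
    linear type (linear_type_syz_primary). If d = 3 and the entries have no common
    zero off the origin, J is of linear type off the origin, because an invertible
    entry eliminates one of the three variables of the symmetric algebra
    (syzygy_entry_power). So the kernel of the map to the Rees algebra is killed by
    powers of the variables. It is zero as the symmetric algebra has positive depth
    at the origin: f has no common divisor, so the module of vectors orthogonal to
    f and to the three variables is free (second_syzygy), and the Koszul complex on
    the coordinates is exact where it is needed (depth_step).

    Existence of points with values in a field follows from Zorn's lemma
    (field_point), bounds on heights from counting monomials (alg_dependent,
    chain_independent), and the theory of common divisors from Gauss' lemma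
    (mpoly_factorial). *)

Set Implicit Arguments.
Unset Strict Implicit.
Unset Printing Implicit Defensive.

Import GRing.Theory.
Local Open Scope classical_set_scope.
Local Open Scope ring_scope.

(** * Ideals and field-valued points *)

Section IdealBasics.
Variable A : comNzRingType.
Implicit Types (I J Q X : set A).

Lemma ideal_sum I (T : Type) (r : seq T) (P : pred T) (F : T -> A) :
  is_ideal I -> (forall i, P i -> I (F i)) -> I (\sum_(i <- r | P i) F i).
Proof. by case=> I0 ID _ IF; apply: (big_ind I). Qed.

Lemma ideal_mulr I a r : is_ideal I -> I a -> I (a * r).
Proof. by case=> _ _ IM Ia; rewrite mulrC; apply: IM. Qed.

Lemma idealN I a : is_ideal I -> I a -> I (- a).
Proof. by case=> _ _ IM Ia; rewrite -mulN1r; apply: IM. Qed.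

Lemma idealB I a b : is_ideal I -> I a -> I b -> I (a - b).
Proof. by move=> iI Ia Ib; case: (iI) => _ ID _; apply: ID => //; apply: idealN. Qed.

Lemma ideal_genP X : is_ideal (ideal_gen X).
Proof.
split.
- by exists 0%N, (fun _ => 0), (fun _ => 0); split; [case | rewrite big_ord0].
- move=> _ _ [m1 [c1 [g1 [X1 ->]]]] [m2 [c2 [g2 [X2 ->]]]].
  exists (m1 + m2)%N, (fun i => match split i with inl j => c1 j | inr j => c2 j end),
    (fun i => match split i with inl j => g1 j | inr j => g2 j end); split.
    by move=> i; case: splitP.
  rewrite big_split_ord /=; congr (_ + _); apply: eq_bigr => i _.
    by rewrite (unsplitK (inl i)).
  by rewrite (unsplitK (inr i)).
- move=> r _ [m [c [g [Xg ->]]]]; exists m, (fun i => r * c i), g; split=> //.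
  by rewrite mulr_sumr; apply: eq_bigr => i _; rewrite mulrA.
Qed.

Lemma ideal_gen_incl X a : X a -> ideal_gen X a.
Proof.
by move=> Xa; exists 1%N, (fun _ => 1), (fun _ => a); split; rewrite // big_ord1 mul1r.
Qed.

Lemma ideal_gen_min X I : is_ideal I -> X `<=` I -> ideal_gen X `<=` I.
Proof.
move=> iI XI _ [m [c [g [Xg ->]]]]; apply: ideal_sum => // i _.
by case: iI => _ _; apply; apply: XI.
Qed.

Lemma prime_exp Q a n : is_prime Q -> Q (a ^+ n) -> Q a.
Proof.
case=> iQ Q1 QM; elim: n => [|n IHn]; first by rewrite expr0 => /Q1.
by rewrite exprS => /QM[].
Qed.

(** A maximal element among the ideals that contain I and no power of f is
    prime: enlarged by either of two elements outside of it, it contains a power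
    of f, and so it contains no product of two such elements. *)
Lemma prime_avoiding I f : is_ideal I -> (forall n, ~ I (f ^+ n)) ->
  exists Q, [/\ is_prime Q, I `<=` Q & ~ Q f].
Proof.
move=> iI If.
(* joining X with I makes the empty chain, whose union is empty, harmless *)
pose P X := is_ideal (X `|` I) /\ forall n, ~ (X `|` I) (f ^+ n).
have chainP : forall F, F `<=` P -> total_on F subset -> P (\bigcup_(X in F) X).
  move=> F FP Ftot; split; last first.
    by move=> n [[X FX Xf]|/If//]; case: (FP X FX) => _ /(_ n); apply; left.
  have [I0 ID IM] := iI.
  have up X a : F X -> (X `|` I) a -> (\bigcup_(Y in F) Y `|` I) a.
    by move=> FX [Xa|Ia]; [left; exists X | right].
  split; first by right.
    move=> a b [[X FX Xa]|Ia] [[Y FY Yb]|Ib]; last by right; apply: ID.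
    - have [XY|YX] := Ftot X Y FX FY.
        have [[_ D _] _] := FP Y FY; apply: (up Y) => //.
        by apply: D; left => //; apply: XY.
      have [[_ D _] _] := FP X FX; apply: (up X) => //.
      by apply: D; left => //; apply: YX.
    - have [[_ D _] _] := FP X FX; apply: (up X) => //.
      by apply: D; [left | right].
    - have [[_ D _] _] := FP Y FY; apply: (up Y) => //.
      by apply: D; [right | left].
  move=> r a [[X FX Xa]|Ia]; last by right; apply: IM.
  have [[_ _ M] _] := FP X FX; apply: (up X) => //.
  by apply: M; left.
have [X [[iQ Qf] Xmax]] := Zorn_bigcup chainP.
set Q := X `|` I in iQ Qf.
have IQ : I `<=` Q by move=> a; right.
have [Q0 QD QM] : is_ideal Q := iQ.
(* by maximality the ideal generated by Q and a meets the powers of f *)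
have meet a : ~ Q a -> exists n q r, Q q /\ f ^+ n = q + r * a.
  move=> Qa; apply: contrapT => meetN.
  pose Y := [set b | exists q r, Q q /\ b = q + r * a].
  have QY : Q `<=` Y by move=> q Qq; exists q, 0; rewrite mul0r addr0.
  have YI : Y `|` I = Y.
    by apply/seteqP; split=> [b [//|/IQ/QY]//|b Yb]; left.
  apply: (Xmax Y).
    split; first by move=> b Xb; apply: QY; left.
    move=> YX; apply: Qa; left; apply: YX.
    by exists 0, 1; rewrite add0r mul1r.
  rewrite /P YI; split; last first.
    by move=> n [q [r [Qq E]]]; apply: meetN; exists n, q, r.
  split; first exact: QY.
    move=> _ _ [q1 [r1 [Qq1 ->]]] [q2 [r2 [Qq2 ->]]].
    exists (q1 + q2), (r1 + r2); split; first exact: QD.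
    by rewrite mulrDl addrACA.
  move=> s _ [q [r [Qq ->]]]; exists (s * q), (s * r); split; first exact: QM.
  by rewrite mulrDr mulrA.
exists Q; split=> //; last by rewrite -[f]expr1; apply: Qf.
split=> //; first by rewrite -[1](expr0 f); apply: Qf.
move=> a b Qab; apply: contrapT => /not_orP[/meet[n [q [r [Qq En]]]]].
move=> /meet[m [q' [r' [Qq' Em]]]].
apply: (Qf (n + m)%N); rewrite exprD En Em mulrDl; apply: (QD).
  exact: ideal_mulr.
rewrite mulrDr; apply: (QD); first exact: (QM).
by rewrite mulrACA; apply: QM.
Qed.

End IdealBasics.

Lemma ideal_preimage (A B : comNzRingType) (h : {rmorphism A -> B}) (I : set B) :
  is_ideal I -> is_ideal [set a | I (h a)].
Proof.
move=> [I0 ID IM]; split=> [|a b|r a] /=; first by rewrite rmorph0.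
  by rewrite rmorphD; apply: ID.
by rewrite rmorphM; apply: IM.
Qed.

Section ResidueField.
Variables (A : comNzRingType) (Q : set A).
Hypothesis Qprime : is_prime Q.

Definition prime_pred : A -> bool := fun a => `[< Q a >].

Let prime_pred_closed : idealr_closed prime_pred.
Proof.
have [[Q0 QD QM] Q1 _] := Qprime; split.
- by apply/asboolP.
- by apply/asboolPn.
- move=> a u v /asboolP Qu /asboolP Qv; apply/asboolP.
  by apply: QD => //; apply: QM.
Qed.

Let prime_pred_prime : prime_idealr_closed prime_pred.
Proof.
have [_ _ QM] := Qprime => u v /asboolP/QM[Qu|Qv]; apply/orP; [left|right];
  exact/asboolP.
Qed.

HB.instance Definition _ := isIdealr.Build A prime_pred prime_pred_closed.
HB.instance Definition _ :=
  isPrimeIdealrClosed.Build A prime_pred prime_pred_prime.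

Let pideal : PrimeIdealr.type A := [the PrimeIdealr.type A of prime_pred].

Definition prime_quot : Type := {ideal_quot pideal}.
HB.instance Definition _ := GRing.ComNzRing.on prime_quot.

Definition pq_unit : pred prime_quot := fun x => `[< exists y, y * x = 1 >].
Definition pq_inv (x : prime_quot) : prime_quot :=
  match pselect (exists y, y * x = 1) with
  | left P => projT1 (cid P)
  | right _ => x
  end.

Let pq_mulVx : {in pq_unit, left_inverse 1 pq_inv *%R}.
Proof.
move=> x /asboolP ux; rewrite /pq_inv; case: pselect => // P.
by case: cid.
Qed.
Let pq_unitPl (x y : prime_quot) : y * x = 1 -> pq_unit x.
Proof. by move=> xy; apply/asboolP; exists y. Qed.
Let pq_inv_out : {in [predC pq_unit], pq_inv =1 id}.
Proof.
move=> x; rewrite inE /= => /asboolPn ux; rewrite /pq_inv.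
by case: pselect.
Qed.
HB.instance Definition _ := GRing.ComNzRing_hasMulInverse.Build prime_quot
  pq_mulVx pq_unitPl pq_inv_out.
HB.instance Definition _ := GRing.ComUnitRing_isIntegral.Build prime_quot
  (@Quotient.rquot_IdomainAxiom A pideal).

Local Open Scope quotient_scope.

Definition residue_map (a : A) : {fraction prime_quot} :=
  tofrac (\pi_{ideal_quot pideal} a : prime_quot).

Lemma residue_map_zmod : zmod_morphism residue_map.
Proof.
by move=> a b; rewrite /residue_map -[RHS]raddfB; congr tofrac; rewrite raddfB.
Qed.
Lemma residue_map_monoid : monoid_morphism residue_map.
Proof.
split; rewrite /residue_map.
  by rewrite -[RHS]tofrac1; congr tofrac; rewrite rmorph1.
by move=> a b; rewrite -[RHS]rmorphM; congr tofrac; rewrite rmorphM.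
Qed.
HB.instance Definition _ := GRing.isZmodMorphism.Build A {fraction prime_quot}
  residue_map residue_map_zmod.
HB.instance Definition _ := GRing.isMonoidMorphism.Build A {fraction prime_quot}
  residue_map residue_map_monoid.

(** The field is the field of fractions of the quotient by Q. *)
Lemma residue_field :
  exists (K : fieldType) (psi : {rmorphism A -> K}),
    forall a, psi a = 0 <-> Q a.
Proof.
exists {fraction prime_quot}, residue_map => a /=.
have piE : (\pi_{ideal_quot pideal} a = 0) <-> Q a.
  have -> : (\pi_{ideal_quot pideal} a = 0) <-> (a == 0 %[mod {ideal_quot pideal}]).
    by split=> [E|/eqP->]; [apply/eqP; rewrite E raddf0 | rewrite raddf0].
  by rewrite -Quotient.idealrBE subr0; split=> [/asboolP|Qa] //; apply/asboolP.
rewrite /residue_map -piE; split=> [/eqP|->]; last exact: tofrac0.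
by rewrite tofrac_eq0 => /eqP.
Qed.

End ResidueField.

(** The form in which the Nullstellensatz is used: an element that is not
    nilpotent modulo an ideal is nonzero at some field-valued point of the
    zero locus. *)
Lemma field_point (A : comNzRingType) (I : set A) (f : A) :
  is_ideal I -> (forall n, ~ I (f ^+ n)) ->
  exists (K : fieldType) (psi : {rmorphism A -> K}),
    (forall a, I a -> psi a = 0) /\ psi f <> 0.
Proof.
move=> iI /(prime_avoiding iI)[Q [pQ IQ Qf]].
have [K [psi psiE]] := residue_field pQ.
by exists K, psi; split=> [a /IQ/psiE//|/psiE].
Qed.

(** * Polynomials in several variables *)

Lemma mpoly_hom_ext n (R : comNzRingType) (S : comNzRingType)
    (f g : {rmorphism {mpoly R[n]} -> S}) :
  (forall c, f c%:MP = g c%:MP) -> (forall i, f 'X_i = g 'X_i) -> f =1 g.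
Proof.
move=> fgC fgX p; rewrite (mpolyE p) !rmorph_sum; apply: eq_bigr => m _ /=.
rewrite -mul_mpolyC !rmorphM fgC mpolyXE_id !rmorph_prod; congr (_ * _).
by apply: eq_bigr => i _; rewrite !rmorphXn fgX.
Qed.

Lemma mpoly_closed_ind n (R : comNzRingType) (G : {mpoly R[n]} -> Prop) :
  (forall c, G c%:MP) -> (forall i, G 'X_i) ->
  (forall p q, G p -> G q -> G (p + q)) -> (forall p q, G p -> G q -> G (p * q)) ->
  forall p, G p.
Proof.
move=> GC GX GD GM p; rewrite (mpolyE p).
apply: (big_ind G); [by rewrite -(mpolyC0 n) | exact: GD | move=> m _].
 rewrite -mul_mpolyC; apply: (GM) => //.
have G1 : G 1 by rewrite -(mpolyC1 n R).
rewrite mpolyXE_id; apply: (big_ind G); [exact: G1 | exact: GM | move=> i _].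
by elim: (m i) => [|e IHe]; rewrite ?expr0 // exprS; apply: (GM).
Qed.

Lemma mmap_XU n (R S : comNzRingType) (h : 'I_n -> S) (f : {rmorphism R -> S}) i :
  mmap f h 'X_i = h i.
Proof. by rewrite mmapX mmap1U. Qed.

Section MuniIso.
Variables (n : nat) (R : comNzRingType).

Lemma muni_X_max : muni ('X_ord_max : {mpoly R[n.+1]}) = 'X.
Proof.
rewrite muniE msuppX big_seq1 mcoeffX eqxx scale1r mnm1E eqxx expr1.
rewrite (_ : [multinom _ | _ < _] = 0%MM) ?mpolyX0 ?scale1r //.
apply/mnmP => i; rewrite mnmE mnm1E mnm0E.
by rewrite -val_eqE /= eq_sym (ltn_eqF (ltn_ord i)).
Qed.

Lemma muni_X_widen (i : 'I_n) :
  muni ('X_(widen_ord (leqnSn n) i) : {mpoly R[n.+1]}) = ('X_i)%:P.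
Proof.
rewrite muniE msuppX big_seq1 mcoeffX eqxx scale1r mnm1E.
rewrite -val_eqE /= (ltn_eqF (ltn_ord i)) expr0 alg_polyC.
congr (_%:P); congr 'X_[_]; apply/mnmP => j.
by rewrite mnmE !mnm1E -!val_eqE.
Qed.

Lemma mwiden_X (i : 'I_n) :
  mwiden ('X_i : {mpoly R[n]}) = 'X_(widen_ord (leqnSn n) i).
Proof. by rewrite mwidenX mnmwiden1. Qed.

Definition unmuni (p : {poly {mpoly R[n]}}) : {mpoly R[n.+1]} :=
  (map_poly (@mwiden n R) p).['X_ord_max].

Lemma unmuni_zmod : zmod_morphism unmuni.
Proof. by move=> p q; rewrite /unmuni rmorphB hornerD hornerN. Qed.
Lemma unmuni_monoid : monoid_morphism unmuni.
Proof.
by split=> [|p q]; rewrite /unmuni ?rmorph1 ?hornerC // rmorphM hornerM.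
Qed.
HB.instance Definition _ := GRing.isZmodMorphism.Build
  {poly {mpoly R[n]}} {mpoly R[n.+1]} unmuni unmuni_zmod.
HB.instance Definition _ := GRing.isMonoidMorphism.Build
  {poly {mpoly R[n]}} {mpoly R[n.+1]} unmuni unmuni_monoid.

Lemma unmuniC c : unmuni c%:P = mwiden c.
Proof. by rewrite /unmuni map_polyC hornerC. Qed.

Lemma unmuniX : unmuni 'X = 'X_ord_max.
Proof. by rewrite /unmuni map_polyX hornerX. Qed.

Lemma muniK : cancel (@muni n R) unmuni.
Proof.
move=> p; rewrite -[RHS]/(idfun p) -[LHS]/((unmuni \o @muni n R) p).
apply: mpoly_hom_ext => [c|i] /=; first by rewrite muniC unmuniC mwidenC.
case: (unliftP ord_max i) => [j|] ->; last by rewrite muni_X_max unmuniX.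
have -> : lift ord_max j = widen_ord (leqnSn n) j.
  by apply: val_inj; apply: lift_max.
by rewrite muni_X_widen unmuniC mwiden_X.
Qed.

Lemma muni_mwiden (p : {mpoly R[n]}) : muni (mwiden p) = p%:P.
Proof.
rewrite -[RHS]/(polyC p) -[LHS]/((@muni n R \o @mwiden n R) p).
apply: mpoly_hom_ext => [c|i] /=; first by rewrite mwidenC muniC.
by rewrite mwiden_X muni_X_widen.
Qed.

Lemma unmuniK : cancel unmuni (@muni n R).
Proof.
elim/poly_ind => [|p c IHp]; first by rewrite !rmorph0.
by rewrite !(rmorphD, rmorphM) /= IHp unmuniC unmuniX muni_X_max muni_mwiden.
Qed.

End MuniIso.

Lemma mmap_mwiden n (R S : comNzRingType) (f : {rmorphism R -> S})
    (h : 'I_n.+1 -> S) (p : {mpoly R[n]}) :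
  mmap f h (mwiden p) = mmap f (fun i => h (widen_ord (leqnSn n) i)) p.
Proof.
rewrite -[LHS]/((mmap f h \o @mwiden n R) p).
apply: mpoly_hom_ext => [c|i] /=; first by rewrite mwidenC !mmapC.
by rewrite mwiden_X !mmap_XU.
Qed.

(** The power of the last variable is that of the lowest term of G as a
    polynomial in this variable. The lemma serves to cancel it when the variable
    stands for a nonzero element of a domain. *)
Lemma mpoly_peel n (R : comNzRingType) (G : {mpoly R[n.+1]}) : G != 0 ->
  exists e G0 H, G0 != 0 /\ G = 'X_ord_max ^+ e * (mwiden G0 + 'X_ord_max * H).
Proof.
have peel (q : {poly {mpoly R[n]}}) : q != 0 ->
    exists e c r, c != 0 /\ q = 'X ^+ e * (c%:P + 'X * r).
  elim/poly_ind: q => [|q c IHq]; first by rewrite eqxx.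
  have [->|c0 _] := eqVneq c 0; last first.
    by exists 0%N, c, q; rewrite expr0 mul1r addrC mulrC.
  rewrite polyC0 addr0 => qX.
  have [|e [c' [r [c'0 ->]]]] := IHq.
    by apply: contraNneq qX => ->; rewrite mul0r.
  by exists e.+1, c', r; split; rewrite // exprSr mulrAC.
move=> G0; have [|e [c [r [c0 E]]]] := peel (muni G).
  by apply: contraNneq G0 => E0; rewrite -[G]muniK E0 rmorph0.
exists e, c, (unmuni r); split=> //.
by rewrite -[LHS]muniK E rmorphM rmorphXn rmorphD rmorphM /= unmuniC unmuniX.
Qed.

(** * Algebraic dependence and lengths of chains of primes *)
Section Dependence.
Variables (k : fieldType) (N : nat).
Local Notation R := {mpoly k[N]}.

Definition degle (b : nat) (p : R) := forall m, m \in msupp p -> (mdeg m <= b)%N.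

Lemma degleM a b p q : degle a p -> degle b q -> degle (a + b) (p * q).
Proof.
move=> pa qb m /msuppM_le/allpairsP[[m1 m2] [/= /pa m1a /qb m2b ->]].
by rewrite mdegD leq_add.
Qed.

Lemma degle1 : degle 0 1.
Proof. by move=> m; rewrite msupp1 inE => /eqP->; rewrite mdeg0. Qed.

Lemma degleX a p n : degle a p -> degle (n * a) (p ^+ n).
Proof.
move=> pa; elim: n => [|n IHn]; first by rewrite expr0; apply: degle1.
by rewrite exprS mulSn; apply: degleM.
Qed.

Lemma degle_prod (T : Type) (r : seq T) (F : T -> R) a :
  (forall i, degle a (F i)) -> degle (size r * a) (\prod_(i <- r) F i).
Proof.
move=> Fa; elim: r => [|x r IHr]; first by rewrite big_nil; apply: degle1.
by rewrite big_cons /= mulSn; apply: degleM.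
Qed.

(** There are about D ^ (N + 1) monomials of degree less than D in each of
    the N + 1 elements f i, while their values lie in a space of dimension
    O(D ^ N). *)
Lemma alg_dependent (f : 'I_N.+1 -> R) :
  exists G : {mpoly k[N.+1]}, G != 0 /\ mmap (@mpolyC N k) f G = 0.
Proof.
pose e := (\max_i msize (f i))%N.
have fe i : degle e (f i).
  move=> m /msize_mdeg_lt/ltnW mf; apply: leq_trans mf _.
  exact: (@leq_bigmax _ (fun i => msize (f i))).
(* the monomials with exponents below D number D ^ N.+1, their values have
   degree less than E, and E ^ N < D ^ N.+1 *)
pose c := (N.+1 * e).+1; pose D := (c ^ N).+1; pose E := (c * D)%N.
pose rows := {ffun 'I_N.+1 -> 'I_D}; pose cols := {ffun 'I_N -> 'I_E}.
pose mon (al : rows) : 'X_{1..N.+1} := [multinom (al i : nat) | i < N.+1].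
pose F (al : rows) : R := \prod_(i < N.+1) f i ^+ al i.
have degF al : degle (N.+1 * (D * e)) (F al).
  have -> : N.+1 = size (index_enum (ordinal N.+1)).
    by rewrite [index_enum _]unlock -enumT size_enum_ord.
  apply: degle_prod => i m /(degleX (fe i)) md.
  by apply: leq_trans md _; rewrite leq_mul2r ltnW ?orbT.
have EF : (N.+1 * (D * e) < E)%N by rewrite mulnCA mulnC /E ltn_mul2r /= ltnSn.
pose M := \matrix_(i < #|{: rows}|, j < #|{: cols}|)
   (F (enum_val i))@_[multinom (enum_val j l : nat) | l < N].
have [u uM u0] : exists2 u : 'rV_ #|{: rows}|, u *m M = 0 & u != 0.
  have : kermx M != 0.
    rewrite kermx_eq0 -row_leq_rank -ltnNge.
    apply: leq_ltn_trans (rank_leq_col M) _.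
    rewrite !card_ffun !card_ord /E expnMn expnS ltn_mul2r expn_gt0 /= /D.
    by rewrite ltnS.
  by case/rowV0Pn => u /sub_kermxP uM u0; exists u.
exists (\sum_i u 0 i *: 'X_[mon (enum_val i)]); split.
  apply: contraNneq u0 => G0; apply/eqP/rowP => i; rewrite mxE.
  have := congr1 (mcoeff (mon (enum_val i))) G0; rewrite mcoeff0 => <-.
  rewrite raddf_sum (bigD1 i) //= mcoeffZ mcoeffX eqxx mulr1.
  rewrite big1 ?addr0 // => j ji; rewrite mcoeffZ mcoeffX.
  case: eqP => [E'|]; last by rewrite mulr0.
  case/eqP: ji; apply: enum_val_inj; apply/ffunP => l; apply: val_inj.
  by have /mnmP/(_ l) := E'; rewrite !mnmE.
rewrite rmorph_sum; apply/mpolyP => m; rewrite mcoeff0 raddf_sum /=.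
under eq_bigr => i _.
  rewrite mmapZ mmapX /mmap1 mul_mpolyC mcoeffZ.
  under [X in X@_m]eq_bigr do rewrite mnmE.
  rewrite -/(F _); over.
have [mE|Em] := ltnP (mdeg m) E; last first.
  apply: big1 => i _; rewrite (memN_msupp_eq0 (m := m)) ?mulr0 //.
  apply/negP => /degF; rewrite leqNgt => /negP; apply.
  exact: leq_trans EF Em.
have mlE l : (m l < E)%N.
  by apply: leq_ltn_trans mE; rewrite mdegE (bigD1 l) //= leq_addr.
pose al : cols := [ffun l => Ordinal (mlE l)].
have := congr1 (fun v : 'rV_ _ => v 0 (enum_rank al)) uM; rewrite !mxE => {2}<-.
apply: eq_bigr => i _; rewrite mxE; congr (_ * _@__).
by apply/mnmP => l; rewrite mnmE enum_rankK ffunE.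
Qed.

End Dependence.

(** Elements a i taken in the successive steps of a chain of primes satisfy no
    polynomial relation with coefficients in a field: a relation can be
    divided by a power of a 0, and what remains constant in a 0 is a relation
    in the next prime. The variables are numbered backwards, so that a 0 is the
    value of the last one. *)
Lemma chain_independent (A : comNzRingType) (k : fieldType)
    (iota : {rmorphism k -> A}) n (Q : nat -> set A) (a : nat -> A) :
  (forall i, (i <= n)%N -> is_prime (Q i)) ->
  (forall i, (i < n)%N -> [/\ Q i `<=` Q i.+1, Q i.+1 (a i) & ~ Q i (a i)]) ->
  forall G : {mpoly k[n]},
    Q 0%N (mmap iota (fun j : 'I_n => a (n - j.+1)%N) G) -> G = 0.
Proof.
elim: n Q a => [|n IHn] Q a Qp Qa G.
  have -> : G = (G@_0%MM)%:MP by apply: msize1_polyC; rewrite -(mpolyKC G) msizeC leq_b1.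
  rewrite mmapC => QG; have [-> |c0] := eqVneq (G@_0%MM) 0; first by rewrite mpolyC0.
  have [[_ _ QM] Q1 _] := Qp 0%N isT; case: Q1.
  by rewrite -(rmorph1 iota) -(mulVf c0) rmorphM; apply: QM.
move=> QG; apply/eqP; apply: contraPT QG => /mpoly_peel[e [G0 [H [G00 ->]]]].
have [Q01 Q1a Q0a] := Qa 0%N isT.
have [_ _ pQ0] := Qp 0%N isT; have [iQ1 _ _] := Qp 1%N isT.
rewrite rmorphM rmorphXn rmorphD rmorphM /= mmap_XU subnn => /pQ0[].
  by move/(prime_exp (Qp 0%N isT)).
move/Q01 => Q1G; case/eqP: G00.
apply: (IHn (fun i => Q i.+1) (fun i => a i.+1)).
- by move=> i; apply: (Qp i.+1).
- by move=> i; apply: (Qa i.+1).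
have := idealB iQ1 Q1G (ideal_mulr 
  (mmap iota (fun j : 'I_n.+1 => a (n.+1 - j.+1)%N) H) iQ1 Q1a).
rewrite addrK mmap_mwiden; congr (Q 1%N _); apply: eq_bigr => m _.
congr (_ * _); apply: eq_bigr => j _ /=.
by rewrite subSn.
Qed.

(** A chain of length d + 1 would provide d + 1 polynomials in d variables that
    satisfy no relation. *)
Lemma mpoly_chain_bound (k : fieldType) d (P : set {mpoly k[d]}) h Q :
  prime_chain P h Q -> (h <= d)%N.
Proof.
case=> Qp Qs _; rewrite leqNgt; apply/negP => dh.
have [a Qa] : {a : nat -> {mpoly k[d]} &
    forall i, (i < h)%N -> Q i.+1 (a i) /\ ~ Q i (a i)}.
  apply: (@choice _ _ (fun i x => (i < h)%N -> Q i.+1 x /\ ~ Q i x)) => i.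
  have [ih|_] := ltnP i h; last by exists 0.
  have [_ /existsNP[x /not_implyP xQ]] := Qs i ih.
  by exists x.
have [G [G0 Gf]] := alg_dependent (fun j : 'I_d.+1 => a (d.+1 - j.+1)%N).
case/eqP: G0; apply: (@chain_independent _ _ (@mpolyC d k) _ Q a).
- by move=> i id; apply: Qp; apply: leq_trans id dh.
- move=> i id; have ih : (i < h)%N by apply: leq_trans id dh.
  by have [? ?] := Qa i ih; have [? _] := Qs i ih.
by rewrite Gf; have [[]] := Qp 0%N isT.
Qed.

Section Heights.
Variable A : comNzRingType.
Implicit Types P : set A.

Lemma prime_height_exists P b : is_prime P ->
  (forall h Q, prime_chain P h Q -> (h <= b)%N) ->
  exists h, (h <= b)%N /\ prime_height P h.
Proof.
move=> pP Pb.
pose X h := `[< exists Q, prime_chain P h Q >].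
have X0 : exists h, X h by exists 0%N; apply/asboolP; exists (fun _ => P); split.
have Xb h : X h -> (h <= b)%N by move=> /asboolP[Q]; apply: Pb.
case: (ex_maxnP X0 Xb) => h Xh hmax; exists h; split; first exact: Xb.
split; first exact/asboolP.
by move=> h' Q' cQ'; apply: hmax; apply/asboolP; exists Q'.
Qed.

Lemma prime_chain_rcons P P' h Q : is_prime P' -> P `<` P' ->
  prime_chain P h Q -> exists Q', prime_chain P' h.+1 Q'.
Proof.
move=> pP' PP' [Qp Qs QP].
exists (fun i => if (i <= h)%N then Q i else P'); split=> [i _|i|].
- by case: leqP => // /Qp.
- rewrite ltnS => ih; rewrite ih ltn_neqAle ih andbT.
  by case: eqP => [->|/eqP ne] /=; [rewrite QP | apply: Qs; rewrite ltn_neqAle ne].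
- by rewrite ltnn.
Qed.

Lemma ker_prime (S : idomainType) (g : {rmorphism A -> S}) :
  is_prime [set a | g a = 0].
Proof.
split=> [|/= /eqP|a b /= /eqP]; last 2 first.
- by rewrite rmorph1 oner_eq0.
- by rewrite rmorphM mulf_eq0 => /orP[]/eqP; [left|right].
split=> [|a b /= a0 b0|r a /= a0]; rewrite /= ?rmorph0 //.
  by rewrite rmorphD a0 b0 addr0.
by rewrite rmorphM a0 mulr0.
Qed.

End Heights.

(** * The cone over a field-valued point *)
Section Cone.
Variables (k : fieldType) (d : nat) (K : fieldType).
Variable psi : {rmorphism {mpoly k[d]} -> K}.
Local Notation R := {mpoly k[d]}.

(** Restriction of polynomials to the line through the origin and psi. Its kernel
    is a homogeneous prime; ideals generated by forms that vanish at psi are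
    contained in it. *)
Definition cone : R -> {poly K} :=
  mmap (polyC \o psi \o @mpolyC d k) (fun i => (psi 'X_i)%:P * 'X).
HB.instance Definition _ := GRing.RMorphism.copy cone
  (mmap (polyC \o psi \o @mpolyC d k) (fun i => (psi 'X_i)%:P * 'X)).

Lemma coneX i : cone 'X_i = (psi 'X_i)%:P * 'X.
Proof. by rewrite /cone mmap_XU. Qed.

Lemma coneC c : cone c%:MP = (psi c%:MP)%:P.
Proof. by rewrite /cone mmapC. Qed.

Lemma cone_homog e f : f \is e.-homog -> cone f = (psi f)%:P * 'X^e.
Proof.
move=> /dhomogP fe; rewrite (mpolyE f) !rmorph_sum mulr_suml !big_seq.
apply: eq_bigr => m /fe me.
rewrite -mul_mpolyC !rmorphM /= coneC mpolyXE_id !rmorph_prod -mulrA; congr (_ * _).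
have -> : 'X^e = \prod_(i < d) 'X^(m i) :> {poly K}.
  by rewrite -(me : mdeg m = e) mdegE -expr_sum.
rewrite -big_split; apply: eq_bigr => i _ /=.
by rewrite !rmorphXn /= coneX exprMn.
Qed.

Lemma cone_horner0 f : (cone f).[0] = psi (f@_0%MM)%:MP.
Proof.
rewrite -[LHS]/((horner_eval 0 \o cone) f).
rewrite -[RHS]/((psi \o @mpolyC d k \o mcoeff 0%MM) f).
apply: mpoly_hom_ext => [c|i] /=.
  by rewrite coneC /horner_eval hornerC mcoeffC eqxx mulr1.
rewrite coneX /horner_eval hornerM hornerX mulr0 mcoeffX -mdeg_eq0 mdeg1.
by rewrite mpolyC0 rmorph0.
Qed.

(** The kernel is a proper part of the ideal of the origin, whose height is at
    most d. *)
Lemma cone_height i : psi 'X_i != 0 ->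
  exists h, (h < d)%N /\ prime_height [set f | cone f = 0] h.
Proof.
move=> xi; have pP := ker_prime cone.
have pM : is_prime [set f : R | mcoeff 0%MM f = 0] by apply: ker_prime.
have d0 : (0 < d)%N by case: (d) i {xi} => // - [].
have [h Q cQ|h [hd hP]] := @prime_height_exists _ _ d.-1 pP.
  rewrite -ltnS prednK //.
  have [|Q' cQ'] := prime_chain_rcons pM _ cQ; last exact: mpoly_chain_bound cQ'.
  split=> [f /= f0|/(_ 'X_i)/=].
    have := cone_horner0 f; rewrite f0 horner0 => /esym/eqP.
    by rewrite -[_ _%:MP]/((psi \o @mpolyC d k) _) fmorph_eq0 => /eqP.
  rewrite mcoeffX -mdeg_eq0 mdeg1 coneX => /(_ erefl)/eqP.
  by rewrite mulf_eq0 polyC_eq0 polyX_eq0 (negbTE xi).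
by exists h; split; rewrite // -(prednK d0).
Qed.

End Cone.

(** A prime containing all the variables is the irrelevant ideal, at the top of
    the chain of the ideals generated by the first variables. *)
Lemma irrelevant_height (k : fieldType) d (P : set {mpoly k[d]}) h :
  is_prime P -> (forall i, P 'X_i) -> prime_height P h -> (d <= h)%N.
Proof.
move=> pP PX [_ hmax].
(* the kernel of s j is generated by the first j variables *)
pose s j : {rmorphism {mpoly k[d]} -> {mpoly k[d]}} :=
  mmap (@mpolyC d k) (fun i => if (i < j)%N then 0 else 'X_i).
have sX j i : s j 'X_i = if (i < j)%N then 0 else 'X_i by rewrite /s /= mmap_XU.
have sC j c : s j c%:MP = c%:MP by rewrite /s /= mmapC.
clearbody s.
have X0 i : 'X_i != 0 :> {mpoly k[d]}.
  by rewrite -msize_poly_eq0 msizeX.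
apply: (hmax d (fun j => [set f | s j f = 0])); split.
- by move=> j _; apply: ker_prime.
- move=> j jd; split=> [f /= f0|/(_ 'X_(Ordinal jd))/=]; last first.
    by rewrite !sX /= ltnn ltnSn => /(_ erefl)/eqP; rewrite (negbTE (X0 _)).
  have -> : s j.+1 f = s j.+1 (s j f); last by rewrite f0 rmorph0.
  rewrite -[RHS]/((s j.+1 \o s j) f); apply: mpoly_hom_ext => [c|i] /=.
    by rewrite !sC.
  rewrite !sX; have [ij|ij] := ltnP i j; last by rewrite sX.
  by rewrite rmorph0 ltnS ltnW.
have [iP P1 _] := pP; have [P0 PD PM] := iP.
have PE f : P (f - s d f).
  elim/mpoly_closed_ind: f => [c|i|p q Pp Pq|p q Pp Pq].
  - by rewrite sC subrr.
  - by rewrite sX ltn_ord subr0.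
  - by rewrite rmorphD opprD addrACA; apply: PD.
  - rewrite rmorphM (_ : _ - _ = q * (p - s d p) + s d p * (q - s d q)).
      by apply: PD; apply: PM.
    by rewrite !mulrBr addrA [q * p]mulrC [q * s d p]mulrC subrK.
have sE f : s d f = (f@_0%MM)%:MP.
  rewrite -[RHS]/((@mpolyC d k \o mcoeff 0%MM) f).
  apply: mpoly_hom_ext => [c|i]; first by rewrite sC /= mcoeffC eqxx mulr1.
  by rewrite sX ltn_ord /= mcoeffX -mdeg_eq0 mdeg1 mpolyC0.
apply/seteqP; split=> f /= Pf; first by have := PE f; rewrite Pf subr0.
apply: contrapT => /eqP; rewrite sE mpolyC_eq0 => f0; apply: P1.
have -> : 1 = (f@_0%MM)^-1%:MP * (f - (f - s d f)).
  by rewrite subKr sE -mpolyCM mulVf.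
by apply: PM; apply: idealB.
Qed.

(** * Factorial rings *)

Section Divisibility.
Variable A : idomainType.
Implicit Types (a b c p q r u : A) (s : seq A).

Definition divides a b := exists c, b = c * a.

Definition prime_elt p :=
  [/\ p != 0, ~ divides p 1 & forall a b, divides p (a * b) -> divides p a \/ divides p b].

Definition primes_seq s := forall p, p \in s -> prime_elt p.

(** Only the existence of factorizations into prime elements is asked, since it
    implies their uniqueness. *)
Definition factorial_ring := forall a, a != 0 ->
  exists u s, [/\ divides u 1, primes_seq s & a = u * \prod_(p <- s) p].

Lemma divides_refl a : divides a a. Proof. by exists 1; rewrite mul1r. Qed.

Lemma divides_trans a b c : divides a b -> divides b c -> divides a c.
Proof. by move=> [x ->] [y ->]; exists (y * x); rewrite mulrA. Qed.

Lemma divides_mull a b c : divides a b -> divides a (c * b).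
Proof. by move=> [x ->]; exists (c * x); rewrite mulrA. Qed.

Lemma divides_mulr a b c : divides a b -> divides a (b * c).
Proof. by rewrite mulrC; apply: divides_mull. Qed.

Lemma divides_add a b c : divides a b -> divides a c -> divides a (b + c).
Proof. by move=> [x ->] [y ->]; exists (x + y); rewrite mulrDl. Qed.

Lemma divides0 a : divides a 0. Proof. by exists 0; rewrite mul0r. Qed.

Lemma divides_mul2l c a b : c != 0 -> divides (c * a) (c * b) -> divides a b.
Proof. by move=> c0 [x E]; exists x; apply: (mulfI c0); rewrite E mulrCA. Qed.

Lemma divides_sum a (T : Type) (r : seq T) (P : pred T) (F : T -> A) :
  (forall i, P i -> divides a (F i)) -> divides a (\sum_(i <- r | P i) F i).
Proof. by apply: (big_ind (divides a)); [apply: divides0 | apply: divides_add]. Qed.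

Lemma prime_ideal p : prime_elt p -> is_prime [set a | divides p a].
Proof.
case=> p0 p1 pM; split=> //; split=> [|a b|r a]; first exact: divides0.
  exact: divides_add.
exact: divides_mull.
Qed.

(** In q = c * p the prime q divides c or p, and in the first case p would be a
    unit. *)
Lemma prime_divides_sym p q : prime_elt p -> prime_elt q ->
  divides p q -> divides q p.
Proof.
move=> [p0 p1 _] [q0 _ qM] [c qE].
have : divides q (c * p) by rewrite -qE; apply: divides_refl.
case/qM => // -[e cE]; case: p1; exists e.
by apply: (mulIf q0); rewrite mul1r {1}qE cE mulrAC.
Qed.

Lemma primes_seq_cons p s : primes_seq (p :: s) -> prime_elt p /\ primes_seq s.
Proof.
move=> ps; split; first by apply: ps; rewrite mem_head.
by move=> q qs; apply: ps; rewrite inE qs orbT.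
Qed.

Lemma primes_seq_consP p s : prime_elt p -> primes_seq s -> primes_seq (p :: s).
Proof. by move=> pp ps q; rewrite inE => /predU1P[->|/ps]. Qed.

Lemma primes_prod_neq0 s : primes_seq s -> \prod_(p <- s) p != 0.
Proof. by move=> ps; rewrite prodf_seq_neq0; apply/allP => p /ps[]. Qed.

Lemma prime_divides_prod p s : prime_elt p ->
  divides p (\prod_(q <- s) q) -> exists2 q, q \in s & divides p q.
Proof.
case=> _ p1 pM; elim: s => [|x s IHs]; first by rewrite big_nil.
rewrite big_cons => /pM[px|/IHs[q qs pq]]; first by exists x; rewrite ?mem_head.
by exists q; rewrite // inE qs orbT.
Qed.

Lemma prime_divides_unit p u : prime_elt p -> divides u 1 -> ~ divides p u.
Proof. by case=> _ p1 _ u1 pu; apply: p1; apply: divides_trans pu u1. Qed.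

(** The primes of s can be cancelled one at a time, as each of them divides r * a
    and not a. *)
Lemma primes_euclid s a r : primes_seq s -> (forall p, p \in s -> ~ divides p a) ->
  divides (\prod_(p <- s) p) (r * a) -> divides (\prod_(p <- s) p) r.
Proof.
elim: s r => [|p s IHs] r ps pa; first by rewrite big_nil; exists r; rewrite mulr1.
have [pp ps'] := primes_seq_cons ps; rewrite big_cons => D.
have [p0 _ pM] := pp.
have : divides p (r * a).
  by apply: divides_trans D; exists (\prod_(j <- s) j); rewrite mulrC.
case/pM => [[r' rE]|/pa]; last by case; rewrite mem_head.
have /IHs[//||r'' r'E] : divides (\prod_(j <- s) j) (r' * a).
- by apply: (divides_mul2l p0); rewrite (_ : p * (r' * a) = r * a) // rE; ring.
- by move=> q qs; apply: pa; rewrite inE qs orbT.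
by exists r''; rewrite rE r'E; ring.
Qed.

(** Here \prod_(p <- s1) p is a greatest common divisor of the product of s and
    of a. The morphism j is the identity when a fraction is reduced, and the
    inclusion of constants when the content of a polynomial is computed. *)
Lemma primes_split (B : idomainType) (j : {rmorphism A -> B}) s (a : B) :
  primes_seq s -> exists s1 s2 (a' : B),
  [/\ \prod_(p <- s) p = (\prod_(p <- s1) p) * \prod_(p <- s2) p,
      a = j (\prod_(p <- s1) p) * a', primes_seq s1, primes_seq s2 &
      forall p, p \in s2 -> ~ exists c : B, a' = c * j p].
Proof.
elim: s => [|p s IHs] ps.
  by exists [::], [::], a; rewrite !big_nil rmorph1 !mul1r.
have [pp /IHs[s1 [s2 [a' [E1 E2 ps1 ps2 pa']]]]] := primes_seq_cons ps.
have [[c cE]|pa] := EM (exists c : B, a' = c * j p).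
  exists (p :: s1), s2, c; rewrite !big_cons E1 mulrA E2 cE rmorphM; split=> //.
  - by ring.
  - exact: primes_seq_consP.
  - by move=> q /pa' qa [e eE]; apply: qa; exists (e * j p); rewrite cE eE; ring.
exists s1, (p :: s2), a'; rewrite !big_cons E1 mulrCA; split=> //.
  exact: primes_seq_consP.
by move=> q; rewrite inE => /predU1P[->|/pa'].
Qed.

Hypothesis Afact : factorial_ring.

(** Dividing both terms by their common primes leaves terms without common
    prime; the last clause is the form in which this is used. *)
Lemma reduced_fraction a b : b != 0 -> exists g a' b',
  [/\ g != 0, a = g * a', b = g * b' &
      forall r, divides b' (r * a') -> divides b' r].
Proof.
move=> b0; have [u [s [[v uv] ps E]]] := Afact b0.
have [s1 [s2 [a' [E1 E2 ps1 ps2 pa']]]] := primes_split idfun a ps.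
exists (\prod_(p <- s1) p), a', (u * \prod_(p <- s2) p); split=> //.
- exact: primes_prod_neq0.
- by rewrite E E1 mulrCA.
have u2 x : divides (\prod_(p <- s2) p) x -> divides (u * \prod_(p <- s2) p) x.
  by move=> [c ->]; exists (c * v); rewrite mulrA -[c * v * u]mulrA -uv mulr1.
move=> r D; apply: u2; apply: primes_euclid ps2 pa' _.
by apply: divides_trans D; exists u.
Qed.

Lemma prime_divisor b : b != 0 -> ~ divides b 1 ->
  exists2 p, prime_elt p & divides p b.
Proof.
move=> b0 b1; have [u [[|p s] [u1 ps E]]] := Afact b0.
  by case: b1; rewrite E big_nil mulr1.
have [pp _] := primes_seq_cons ps; exists p => //.
by exists (u * \prod_(j <- s) j); rewrite E big_cons; ring.
Qed.

End Divisibility.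

Lemma field_factorial (k : fieldType) : factorial_ring k.
Proof.
move=> a a0; exists a, [::]; rewrite big_nil mulr1; split=> //.
by exists a^-1; rewrite mulVf.
Qed.

Lemma factorial_iso (A B : idomainType) (f : {rmorphism A -> B})
    (g : {rmorphism B -> A}) : cancel f g -> cancel g f ->
  factorial_ring A -> factorial_ring B.
Proof.
move=> fK gK fA.
have fdiv x y : divides (f x) (f y) <-> divides x y.
  split=> [[c E]|[c ->]]; last by exists (f c); rewrite rmorphM.
  by exists (g c); apply: (can_inj fK); rewrite rmorphM gK.
have fprime p : prime_elt p -> prime_elt (f p).
  case=> p0 p1 pM; split.
  - by apply: contraNneq p0 => E; rewrite -[p]fK E rmorph0.
  - by rewrite -(rmorph1 f) fdiv.
  - by move=> a b; rewrite -[a]gK -[b]gK -rmorphM !fdiv; apply: pM.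
move=> b b0; have gb0 : g b != 0.
  by apply: contraNneq b0 => E; rewrite -[b]gK E rmorph0.
have [u [s [u1 ps E]]] := fA _ gb0; exists (f u), (map f s); split.
- by rewrite -(rmorph1 f) fdiv.
- by move=> _ /mapP[p /ps/fprime pp ->].
- by rewrite -[b]gK E rmorphM rmorph_prod big_map.
Qed.

(** * Gauss' lemma *)
Section PolyFactorial.
Variable A : idomainType.
Hypothesis Afact : factorial_ring A.
Implicit Types (f g h : {poly A}) (s : seq A).

Lemma divides_polyC (c : A) f : divides c%:P f <-> forall i, divides c f`_i.
Proof.
split=> [[g ->] i|fc]; first by rewrite coefMC; exists g`_i.
have [h hE] := @choice _ _ (fun i x => f`_i = x * c) fc.
exists (\poly_(i < size f) h i); apply/polyP => i; rewrite coefMC coef_poly.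
by case: ltnP => [_|/(nth_default 0)->]; rewrite ?mul0r.
Qed.

(** Reduction modulo p maps {poly A} to the polynomials over a field. *)
Lemma prime_polyC (p : A) : prime_elt p -> prime_elt p%:P.
Proof.
move=> pp; have [p0 p1 pM] := pp.
have [K [psi psiE]] := residue_field (prime_ideal pp).
have pE f : divides p%:P f <-> map_poly psi f = 0.
  rewrite divides_polyC -polyP; split=> H i; have := H i.
    by rewrite coef_map coef0 => /psiE.
  by rewrite coef_map coef0 => /psiE.
split=> [|/divides_polyC/(_ 0%N)|f g].
- by rewrite polyC_eq0.
- by rewrite coef1.
by rewrite !pE rmorphM => /eqP; rewrite mulf_eq0 => /orP[]/eqP; [left|right].
Qed.

Lemma primes_polyC s : primes_seq s -> primes_seq (map polyC s).
Proof. by move=> ps _ /mapP[p /ps/prime_polyC pp ->]. Qed.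

Definition primitive f := forall p : A, prime_elt p -> ~ divides p%:P f.

(** The primes to be taken out of f are found among those of its leading
    coefficient. *)
Lemma content f : f != 0 -> exists s f0,
  [/\ primes_seq s, primitive f0 & f = (\prod_(p <- s) p)%:P * f0].
Proof.
move=> f0; have lf0 : lead_coef f != 0 by rewrite lead_coef_eq0.
have [u [s [u1 ps E]]] := Afact lf0.
have [s1 [s2 [f' [E1 E2 ps1 ps2 pf']]]] := primes_split polyC f ps.
exists s1, f'; split=> // p pp pf'p.
have s10 := primes_prod_neq0 ps1.
have /divides_polyC/(_ (size f').-1) : divides p%:P f' by [].
have -> : f'`_(size f').-1 = u * \prod_(p <- s2) p.
  have lE : lead_coef f = (\prod_(p <- s1) p) * lead_coef f'.
    by rewrite E2 lead_coefM lead_coefC.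
  by apply: (mulfI s10); rewrite -lE E E1 mulrCA.
have [_ _ pM] := pp; case/pM => [/(prime_divides_unit pp)//|].
case/(prime_divides_prod pp) => q qs pq; apply: (pf' q qs).
have /divides_trans := prime_divides_sym pp (ps2 q qs) pq.
have [c ->] := pf'p; have [e ->] := prime_divides_sym pp (ps2 q qs) pq.
by move=> _; exists (c * e%:P); rewrite polyCM mulrA.
Qed.

Lemma primitive_factor f g h : primitive f -> f = g * h -> primitive g /\ primitive h.
Proof.
move=> pf E; split=> p pp; rewrite -/(divides _ _) => D; apply: (pf p pp); rewrite E.
  exact: divides_mulr.
exact: divides_mull.
Qed.

(** A factorization over the fraction field, with denominator c, descends to A:
    the primes of c remain prime in {poly A}, so that each can be cancelled with
    a prime factor of g or of h. *)
Lemma clear_denominators (c : A) f g h : c != 0 -> c%:P * f = g * h ->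
  exists g' h', [/\ f = g' * h', size g' = size g & size h' = size h].
Proof.
move=> c0; have [u [s [[v uv] ps ->]]] := Afact c0.
have v0 : v != 0 by apply: contra_eq_neq uv => ->; rewrite mul0r oner_neq0.
rewrite polyCM => E.
have {E} : (\prod_(p <- s) p)%:P * f = (v%:P * g) * h.
  by rewrite -[v%:P * g * h]mulrA -E !mulrA -polyCM -uv polyC1 mul1r.
rewrite -(_ : size (v%:P * g) = size g); last by rewrite mul_polyC size_scale.
move: (v%:P * g) => {}g; elim: s ps g h => [|p s IHs] ps g h.
  by rewrite big_nil polyC1 mul1r => ->; exists g, h.
have [pp ps'] := primes_seq_cons ps; have [p0 _ pM] := prime_polyC pp.
have sp q : size (q * p%:P) = size q.
  by rewrite mulrC mul_polyC size_scale // -polyC_eq0.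
rewrite big_cons polyCM -mulrA => E.
have /pM[[q qE]|[q qE]] : divides p%:P (g * h).
- by rewrite -E; apply: divides_mulr; apply: divides_refl.
- rewrite qE sp; apply: IHs => //; apply: (mulfI p0); rewrite E qE; ring.
- rewrite qE sp; apply: IHs => //; apply: (mulfI p0); rewrite E qE; ring.
Qed.

(** No prime of the denominator c divides f, so each of them divides h. *)
Lemma primitive_divides (c : A) f g h : c != 0 -> primitive f ->
  c%:P * g = h * f -> divides f g.
Proof.
move=> c0 pf; have [u [s [[v uv] ps ->]]] := Afact c0.
have v0 : v != 0 by apply: contra_eq_neq uv => ->; rewrite mul0r oner_neq0.
rewrite polyCM => E.
have {E} : (\prod_(p <- s) p)%:P * g = (v%:P * h) * f.
  by rewrite -[v%:P * h * f]mulrA -E !mulrA -polyCM -uv polyC1 mul1r.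
move: (v%:P * h) => {}h; elim: s ps h => [|p s IHs] ps h.
  by rewrite big_nil polyC1 mul1r => ->; exists h.
have [pp ps'] := primes_seq_cons ps; have [p0 _ pM] := prime_polyC pp.
rewrite big_cons polyCM -mulrA => E.
have /pM[[q qE]|/(pf p pp)//] : divides p%:P (h * f).
  by rewrite -E; apply: divides_mulr; apply: divides_refl.
by apply: (IHs ps' q); apply: (mulfI p0); rewrite E qE; ring.
Qed.

(** If f does not divide a, then it is prime to a over the fraction field, as its
    factors there descend to A. Bezout's identity, with a nonzero constant e as
    denominator, then shows that f divides e * b as soon as it divides a * b. *)
Lemma irreducible_prime f : primitive f -> (1 < size f)%N ->
  (forall g h, f = g * h -> (size g <= 1)%N || (size h <= 1)%N) ->
  prime_elt f.
Proof.
move=> pf sf firr; have f0 : f != 0 by rewrite -size_poly_gt0 (ltn_trans _ sf).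
split=> //.
  case=> g /(congr1 (fun q : {poly A} => size q)); rewrite size_poly1.
  have [->|g0] := eqVneq g 0; first by rewrite mul0r size_poly0.
  rewrite size_mul // => E; move: E; have sg : (0 < size g)%N by rewrite size_poly_gt0.
  by move: (leq_add sg sf); rewrite add1n; case: (_ + _)%N => // n; rewrite ltnS /= => /[swap] <-.
move=> a b [q abE]; apply: contrapT => /not_orP[fa fb].
pose g := gcdp f a.
have /Pdiv.Idomain.dvdpP[[c h] /= c0 cE] : g %| f by apply: dvdp_gcdl.
have /Pdiv.Idomain.dvdpP[[c' r] /= c'0 c'E] : g %| a by apply: dvdp_gcdr.
rewrite -!mul_polyC in cE c'E.
have [h' [g' [fE sh sg]]] := clear_denominators c0 cE.
case/orP: (firr _ _ fE); rewrite ?sh ?sg => s1.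
  have hE := size1_polyC s1; have h0 : h`_0 != 0.
    apply: contra_neq f0 => E; move: cE; rewrite hE E mul0r => /eqP.
    by rewrite mulf_eq0 polyC_eq0 (negbTE c0) => /eqP.
  apply: fa; apply: (@primitive_divides (h`_0 * c') _ _ (r * c%:P)) => //.
    by rewrite mulf_neq0.
  by rewrite polyCM -mulrA c'E -[_ * f]mulrA cE {2}hE; ring.
have cop : coprimep f a.
  rewrite coprimep_def eqn_leq s1 size_poly_gt0; apply: contra_neq f0 => E.
  move: cE; rewrite (E : g = 0) mulr0 => /eqP.
  by rewrite mulf_eq0 polyC_eq0 (negbTE c0) => /eqP.
have [[u v] /= uvE] := Pdiv.Idomain.Bezout_coprimepP _ _ cop.
move: uvE; rewrite -size_poly_eq1 => /eqP s1'.
have eE := size1_polyC (eq_leq s1').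
have e0 : (u * f + v * a)`_0 != 0.
  by rewrite -polyC_eq0 -eE -size_poly_eq0 s1'.
apply: fb; apply: (@primitive_divides _ _ _ (u * b + v * q) e0) => //.
rewrite -eE mulrDl mulrDl -[v * a * b]mulrA abE; ring.
Qed.

(** The content is factored in A; the primitive part is split by induction on its
    size until its factors are irreducible, hence prime. *)
Lemma poly_factorial : factorial_ring {poly A}.
Proof.
move=> f f0; have [s [f' [ps pf' E]]] := content f0.
have f'0 : f' != 0 by apply: contra_neq f0 => E'; rewrite E E' mulr0.
suff [u [t [u1 pt f'E]]] : exists u t, [/\ divides u 1, primes_seq t &
    f' = u * \prod_(p <- t) p].
  exists u, (map polyC s ++ t); split=> //.
    by move=> p; rewrite mem_cat => /orP[/(primes_polyC ps)|/pt].
  by rewrite E f'E big_cat big_map /= rmorph_prod mulrCA.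
have [n] := ubnP (size f'); elim: n f' pf' f'0 {E} => // n IHn g pg g0 sg.
have [s1|s1] := leqP (size g) 1.
  have gE := size1_polyC s1; exists g, [::]; rewrite big_nil mulr1; split=> //.
  have c0 : g`_0 != 0 by rewrite -polyC_eq0 -gE.
  have [v|c1] := EM (divides g`_0 1).
    by case: v => v vE; exists v%:P; rewrite gE -polyCM -vE.
  have [p pp [e eE]] := prime_divisor Afact c0 c1.
  by case: (pg p pp); exists e%:P; rewrite -polyCM -eE.
have [[a [b [gE sa sb]]]|irr] := EM (exists a b,
    [/\ g = a * b, (1 < size a)%N & (1 < size b)%N]).
  have [pa pb] := primitive_factor pg gE.
  have a0 : a != 0 by rewrite -size_poly_gt0 (ltn_trans _ sa).
  have b0 : b != 0 by rewrite -size_poly_gt0 (ltn_trans _ sb).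
  move: sg; rewrite gE size_mul // => sg.
  have [|u [t [u1 pt aE]]] := IHn a pa a0.
    move: sg; case: (size b) sb => [|[|y]] // _; rewrite !addnS /= ltnS => sg.
    by apply: leq_ltn_trans sg; apply: leq_addr.
  have [|u' [t' [u1' pt' bE]]] := IHn b pb b0.
    move: sg; case: (size a) sa => [|[|y]] // _; rewrite !addSn /= ltnS => sg.
    by apply: leq_ltn_trans sg; apply: leq_addl.
  exists (u * u'), (t ++ t'); split.
  - by case: u1 u1' => [x xE] [y yE]; exists (x * y); rewrite mulrACA -xE -yE mulr1.
  - by move=> p; rewrite mem_cat => /orP[/pt|/pt'].
  - by rewrite big_cat /= {1}aE {1}bE mulrACA.
exists 1, [:: g]; rewrite big_seq1 mul1r; split=> //; first exact: divides_refl.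
move=> p; rewrite inE => /eqP->; apply: irreducible_prime => // a b gE.
rewrite -implyNb -ltnNge; apply/implyP => sa; rewrite leqNgt; apply/negP => sb.
by apply: irr; exists a, b.
Qed.

End PolyFactorial.

Lemma mpoly_factorial (A : idomainType) n : factorial_ring A ->
  factorial_ring {mpoly A[n]}.
Proof.
move=> fA; elim: n => [|n IHn].
  apply: (@factorial_iso _ _ (@mpolyC 0 A) (mcoeff 0%MM)) fA.
    by move=> c; rewrite /= mcoeffC eqxx mulr1.
  exact: mpolyKC.
apply: (factorial_iso (@unmuniK n A) (@muniK n A)).
exact: poly_factorial.
Qed.

Lemma mpoly_field_factorial (k : fieldType) n : factorial_ring {mpoly k[n]}.
Proof. exact: (@mpoly_factorial k n (@field_factorial k)). Qed.

(** * Codimension two and the Hilbert-Burch theorem *)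

(** A nonzero prime ideal inside (p) contains a prime element; p divides it, hence
    is divisible by it, and the two ideals are equal. *)
Lemma principal_prime_height (A : idomainType) (p : A) :
  factorial_ring A -> prime_elt p ->
  exists h, (h <= 1)%N /\ prime_height [set a | divides p a] h.
Proof.
move=> fA pp; apply: prime_height_exists; first exact: prime_ideal.
move=> [|[|h]] Q // [Qp Qs QE].
have [Q12 Q21] := Qs h.+1 (ltnSn _).
have [_ /existsNP[f /not_implyP[Qf Qf']]] := Qs h (ltnW (ltnSn _)).
have [[Q0 _ _] _ _] := Qp h (ltnW (ltnW (ltnSn _))).
have [iQ Q1 QM] := Qp h.+1 (ltnW (ltnSn _)).
have f0 : f != 0 by apply: contra_notN Qf' => /eqP->.
have [u [s [[v uv] ps fE]]] := fA f f0.
have [q qs Qq] : exists2 q, q \in s & Q h.+1 q.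
  have : Q h.+1 (\prod_(q <- s) q).
    have -> : \prod_(q <- s) q = v * f by rewrite fE mulrA -uv mul1r.
    by case: iQ => _ _; apply.
  elim: (s) => [|x t IHt]; first by rewrite big_nil => /Q1.
  rewrite big_cons => /QM[Qx|/IHt[q qt Qq]]; first by exists x; rewrite ?mem_head.
  by exists q; rewrite // inE qt orbT.
case: Q21 => a; rewrite QE => -[c ->].
case: (iQ) => _ _; apply.
have : Q h.+2 q by apply: Q12.
rewrite QE /= => /(prime_divides_sym pp (ps q qs))[e ->].
by case: (iQ) => _ _; apply.
Qed.

Section Codim2.
Variables (A : idomainType) (I : set A).
Hypothesis (fA : factorial_ring A) (hI : ideal_height I 2).

Lemma codim2_prime_elt p : prime_elt p -> ~ (forall a, I a -> divides p a).
Proof.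
move=> pp Ip; have [h [h1 hP]] := principal_prime_height fA pp.
by have := hI.2 _ _ (prime_ideal pp) Ip hP; rewrite leqNgt ltnS h1.
Qed.

Lemma codim2_neq0 : exists2 a, I a & a != 0.
Proof.
apply: contrapT => I0.
have I0' : I `<=` [set 0].
  by move=> a Ia; apply: contrapT => /eqP a0; apply: I0; exists a.
have p0 : is_prime [set (0 : A)].
  split=> [|/eqP|a b /eqP]; last 2 first.
  - by rewrite oner_eq0.
  - by rewrite mulf_eq0 => /orP[]/eqP; [left|right].
  by split=> [|a b -> ->|r a ->] //=; rewrite ?addr0 ?mulr0.
have [|h [h0 hP]] := @prime_height_exists _ _ 0%N p0.
  move=> [|h] Q // [Qp Qs QE]; have [_ []] := Qs h (ltnSn _).
  by rewrite QE => _ ->; case: (Qp h (leqnSn _)) => -[].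
by have := hI.2 _ _ p0 I0' hP; rewrite leqn0 in h0; rewrite (eqP h0).
Qed.

Lemma codim2_common_divisor b : (forall a, I a -> divides b a) -> divides b 1.
Proof.
move=> Ib; apply: contrapT => b1.
have b0 : b != 0.
  have [a Ia a0] := codim2_neq0; apply: contra_neq a0 => E.
  by have [c ->] := Ib a Ia; rewrite E mulr0.
have [p pp pb] := prime_divisor fA b0 b1.
by apply: (codim2_prime_elt pp) => a /Ib; apply: divides_trans.
Qed.

End Codim2.

Section SignedMinors.
Variables (A : comNzRingType) (m : nat).
Implicit Types (phi : 'M[A]_(m.+1, m)).

Definition signed_minor phi (i : 'I_m.+1) : A := (-1) ^+ i * \det (row' i phi).

(** Laplace expansion along the first column. *)
Lemma det_row_mx phi (v : 'cV[A]_m.+1) :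
  \det (row_mx v phi : 'M_(1 + m)) = \sum_i signed_minor phi i * v i 0.
Proof.
rewrite (expand_det_col _ (lshift m 0)); apply: eq_bigr => i _.
rewrite row_mxEl mulrC /cofactor /signed_minor addn0; congr (_ * \det _ * _).
apply/matrixP => a b; rewrite !mxE.
have -> : lift (lshift m 0) b = rshift 1 b :> 'I_(1 + m) by apply: val_inj.
by rewrite (unsplitK (inr b)).
Qed.

Lemma signed_minor_syzygy phi j : \sum_i signed_minor phi i * phi i j = 0.
Proof.
have -> : \sum_i signed_minor phi i * phi i j = \det (row_mx (col j phi) phi : 'M_(1 + m)).
  by rewrite det_row_mx; apply: eq_bigr => i _; rewrite mxE.
rewrite -det_tr; apply: (determinant_alternate (i1 := lshift m 0) (i2 := rshift 1 j)).
  by rewrite eq_lrshift.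
by move=> i; rewrite !mxE (unsplitK (inl _)) (unsplitK (inr _)) mxE.
Qed.

Lemma signed_minor_mul phi (w : 'cV[A]_m) :
  \sum_i signed_minor phi i * (phi *m w) i 0 = 0.
Proof.
under eq_bigr do rewrite mxE mulr_sumr.
rewrite exchange_big big1 // => j _ /=.
under eq_bigr do rewrite mulrA.
by rewrite -mulr_suml signed_minor_syzygy mul0r.
Qed.

End SignedMinors.

(** The Hilbert-Burch theorem: Cramer's rule solves phi w = u over the fraction
    field with any nonzero maximal minor as a denominator, and the minors
    have no common divisor. *)
Lemma hilbert_burch (A : idomainType) m (phi : 'M[A]_(m.+1, m)) (u : 'cV[A]_m.+1) :
  factorial_ring A ->
  (exists i, signed_minor phi i != 0) ->
  (forall b, (forall i, divides b (signed_minor phi i)) -> divides b 1) ->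
  \sum_i signed_minor phi i * u i 0 = 0 ->
  exists w : 'cV[A]_m, u = phi *m w.
Proof.
move=> fA [i0 D0] Dgcd Du.
pose D i := signed_minor phi i.
(* D i * u = phi b i is Cramer's rule for the rows other than i *)
pose b (i : 'I_m.+1) : 'cV[A]_m := (-1) ^+ i *: (\adj (row' i phi) *m row' i u).
have bE i : D i != 0 -> D i *: u = phi *m b i.
  move=> Di0; apply/eqP; rewrite -subr_eq0; set e := _ - _.
  have rowM (x : 'cV[A]_m) : row' i (phi *m x) = row' i phi *m x.
    by apply/matrixP => x1 x2; rewrite !mxE; apply: eq_bigr => j _; rewrite mxE.
  have rowe : row' i e = 0.
    rewrite /e linearB /= linearZ /= rowM /b -scalemxAr mulmxA mul_mx_adj.
    by rewrite mul_scalar_mx scalerA subrr.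
  have eE j : j != i -> e j 0 = 0.
    case: (unliftP i j) => [l ->|->] ji; last by rewrite eqxx in ji.
    by have /matrixP/(_ l 0) := rowe; rewrite mxE [RHS]mxE.
  have ei : e i 0 = 0.
    apply: (mulfI Di0); rewrite mulr0.
    have : \sum_j D j * e j 0 = 0.
      transitivity (D i * (\sum_j D j * u j 0) - \sum_j D j * (phi *m b i) j 0).
        rewrite mulr_sumr -sumrB; apply: eq_bigr => j _.
        by rewrite /e mxE [(D i *: u) j 0]mxE [(- (phi *m b i)) j 0]mxE; ring.
      by rewrite Du mulr0 signed_minor_mul subr0.
    by rewrite (bigD1 i) //= big1 ?addr0 // => j /eE->; rewrite mulr0.
  apply/eqP/matrixP => j l; rewrite ord1 [RHS]mxE.
  by have [->|/eE] := eqVneq j i.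
clearbody b.
have phi_inj (x : 'cV[A]_m) : phi *m x = 0 -> x = 0.
  move=> x0; have : row' i0 phi *m x = 0.
    apply/matrixP => x1 x2; have /matrixP/(_ (lift i0 x1) x2) := x0.
    by rewrite !mxE => {2}<-; apply: eq_bigr => j _; rewrite mxE.
  move/(congr1 (mulmx (\adj (row' i0 phi)))); rewrite mulmxA mul_adj_mx mulmx0.
  rewrite mul_scalar_mx => /eqP; rewrite scalemx_eq0.
  case/orP => [d0|/eqP//]; case/eqP: D0.
  by rewrite /signed_minor (eqP d0) mulr0.
have bb i : D i != 0 -> D i *: b i0 = D i0 *: b i.
  move=> Di; apply/eqP; rewrite -subr_eq0; apply/eqP/phi_inj.
  rewrite mulmxBr -!scalemxAr -!bE //; apply/eqP; rewrite subr_eq0; apply/eqP.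
  by rewrite !scalerA mulrC.
(* b i / D i does not depend on i, so that the denominator of its reduced form
   divides all the minors *)
have [w wE] : exists w : 'I_m -> A, forall j, b i0 j 0 = D i0 * w j.
  suff W j : exists x, b i0 j 0 = D i0 * x.
    by have [w wE] := choice W; exists w.
  have [g [a' [b' [g0 aE b'E b'a']]]] := reduced_fraction fA (b i0 j 0) D0.
  have [i|v vE] := Dgcd b'.
    have [Di|Di] := eqVneq (signed_minor phi i) 0; first by rewrite Di; apply: divides0.
    apply: b'a'; exists (b i j 0); apply: (mulfI g0).
    have /matrixP/(_ j 0) := bb i Di; rewrite !mxE aE.
    by rewrite {2}/D b'E => E; rewrite mulrCA /D in E *; rewrite E; ring.
  by exists (a' * v); rewrite aE /D b'E mulrACA [b' * v]mulrC -vE mulr1.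
exists (\col_j w j); apply/matrixP => i j; rewrite ord1; apply: (mulfI D0).
have /matrixP/(_ i 0) := bE i0 D0; rewrite !mxE => ->.
by rewrite mulr_sumr; apply: eq_bigr => l _; rewrite mxE wE mulrCA.
Qed.

(** * Ideals of maximal minors *)

Section Increasing.

Lemma increasing_inj t q (f : 'I_t -> 'I_q) : increasing f -> injective f.
Proof.
move=> fi i j E; apply: val_inj => /=.
by case: (ltngtP i j) => // /fi; rewrite E ltnn.
Qed.

(** An increasing map is the sorted enumeration of its image. *)
Lemma increasing_eq t q (f g : 'I_t -> 'I_q) :
  increasing f -> increasing g -> codom f =i codom g -> f =1 g.
Proof.
move=> fi gi fg.
have srt (h : 'I_t -> 'I_q) : increasing h ->
    sorted ltn [seq val (h i) | i <- enum 'I_t].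
  move=> hi; apply: (homo_sorted (e := fun i j : 'I_t => (i < j)%N)).
    by move=> i j; apply: hi.
  by have := iota_ltn_sorted 0 t; rewrite -val_enum_ord sorted_map.
have E : [seq val (f i) | i <- enum 'I_t] = [seq val (g i) | i <- enum 'I_t].
  apply: (irr_sorted_eq ltn_trans ltnn (srt f fi) (srt g gi)) => x.
  apply/mapP/mapP => -[i _ ->].
    have : f i \in codom g by rewrite -fg codom_f.
    by case/codomP => j ->; exists j; rewrite ?mem_enum.
  have : g i \in codom f by rewrite fg codom_f.
  by case/codomP => j ->; exists j; rewrite ?mem_enum.
by move=> i; apply: val_inj; move/eq_in_map: E => /(_ i); rewrite mem_enum; apply.
Qed.

Lemma increasing_lift n (i : 'I_n.+1) : increasing (lift i).
Proof.
move=> a b; rewrite /= /bump; case: (leqP i a); case: (leqP i b) => /=; lia.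
Qed.

Lemma increasing_id t (f : 'I_t -> 'I_t) : increasing f -> f =1 id.
Proof.
move=> fi; apply: increasing_eq => // x.
have -> : x \in codom (@id 'I_t) by apply/codomP; exists x.
by apply/codomP; exists (invF (increasing_inj fi) x); rewrite f_invF.
Qed.

Lemma increasing_omit n (f : 'I_n -> 'I_n.+1) (i : 'I_n.+1) :
  increasing f -> (forall l, f l != i) -> f =1 lift i.
Proof.
move=> fi fN; apply: increasing_eq => //; first exact: increasing_lift.
have cE (h : 'I_n -> 'I_n.+1) : injective h -> (forall l, h l != i) ->
    codom h =i predC1 i.
  move=> hinj hN; apply/subset_cardP.
    by rewrite card_codom // cardC1 !card_ord.
  by apply/fintype.subsetP => _ /codomP[l ->]; rewrite !inE.
move=> x; rewrite cE //; last exact: increasing_inj.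
rewrite cE // => [|l]; first exact: lift_inj.
by rewrite eq_sym neq_lift.
Qed.

Lemma increasing_miss n (f : 'I_n -> 'I_n.+1) :
  increasing f -> exists i : 'I_n.+1, f =1 lift i.
Proof.
move=> fi; have [i iP] : exists i, i \notin codom f.
  apply/existsP; rewrite -negb_forall; apply/negP => /forallP all.
  have : (#|'I_n.+1| <= #|codom f|)%N by apply/subset_leq_card/fintype.subsetP => x _.
  by rewrite card_codom ?card_ord ?ltnn //; apply: increasing_inj.
exists i; apply: increasing_omit => // l.
by apply: contraNneq iP => <-; apply: codom_f.
Qed.

End Increasing.

Section FamilyIdeal.
Variables (A : comNzRingType) (T : finType) (g : T -> A).

Definition family_ideal : set A := [set a | exists c, a = \sum_i c i * g i].

Lemma family_idealP : is_ideal family_ideal.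
Proof.
split; first by exists (fun _ => 0); rewrite big1 // => i _; rewrite mul0r.
  move=> _ _ [c ->] [c' ->]; exists (fun i => c i + c' i).
  by rewrite -big_split; apply: eq_bigr => i _; rewrite mulrDl.
move=> r _ [c ->]; exists (fun i => r * c i).
by rewrite mulr_sumr; apply: eq_bigr => i _; rewrite mulrA.
Qed.

Lemma family_ideal_in i : family_ideal (g i).
Proof.
exists (fun j => (j == i)%:R); rewrite (bigD1 i) //= eqxx mul1r big1 ?addr0 //.
by move=> j /negbTE->; rewrite mul0r.
Qed.

Lemma family_ideal_min I : is_ideal I -> (forall i, I (g i)) -> family_ideal `<=` I.
Proof.
move=> iI Ig _ [c ->]; apply: ideal_sum => // i _.
by case: (iI) => _ _; apply.
Qed.

(** The generators of X are those of the family up to multiples, which will be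
    signs, and repetitions. *)
Lemma ideal_gen_family (X : set A) : X `<=` family_ideal ->
  (forall i, exists2 u, X u & exists c, g i = c * u) -> ideal_gen X = family_ideal.
Proof.
move=> XF gX; apply/seteqP; split; first exact: ideal_gen_min family_idealP XF.
apply: family_ideal_min (ideal_genP X) _ => i.
have [u Xu [c ->]] := gX i; have [_ _ M] := ideal_genP X.
by apply: M; apply: ideal_gen_incl.
Qed.

End FamilyIdeal.

(** An increasing choice of m rows out of m + 1 is the omission of one row. The
    cast allows for q that is equal to m + 1 without being convertible to it. *)
Lemma minors_ideal_max (A : comNzRingType) q m (E : q = m.+1) (M : 'M[A]_(q, m)) : minors_ideal m M =
  family_ideal (signed_minor (castmx (E, erefl m) M)).
Proof.
subst q; rewrite castmx_id.
apply: ideal_gen_family => [_ [f [g [fi gi ->]]]|i].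
  have [i fE] := increasing_miss fi.
  have -> : mxsub f g M = row' i M.
    by apply/matrixP => a b; rewrite !mxE fE (increasing_id gi).
  exists (fun j => (j == i)%:R * (-1) ^+ i); rewrite (bigD1 i) //= big1 => [|j ji].
    by rewrite eqxx mul1r addr0 signrMK.
  by rewrite (negbTE ji) !mul0r.
exists (\det (row' i M)); last by exists ((-1) ^+ i).
exists (lift i), id; split=> //; exact: increasing_lift.
Qed.

Lemma omitted_minors_ideal (A : comNzRingType) q m d (E : q = m.+1)
    (M : 'M[A]_(q, m)) (h : 'I_d -> 'I_q) :
  ideal_gen [set a | exists i f, [/\ increasing f, forall l, f l != h i &
                                    a = \det (rowsub f M)]] =
  family_ideal (fun i => signed_minor (castmx (E, erefl m) M) (cast_ord E (h i))).
Proof.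
subst q; rewrite castmx_id.
apply: ideal_gen_family => [_ [i [f [fi fN ->]]]|i].
  have -> : rowsub f M = row' (h i) M.
    by apply/matrixP => a b; rewrite !mxE (increasing_omit fi fN).
  exists (fun j => (j == i)%:R * (-1) ^+ h i); rewrite (bigD1 i) //= big1 => [|j ji].
    by rewrite cast_ord_id eqxx mul1r addr0 signrMK.
  by rewrite (negbTE ji) !mul0r.
exists (\det (row' (h i) M)); last by exists ((-1) ^+ h i); rewrite cast_ord_id.
exists i, (lift (h i)); split=> //; first exact: increasing_lift.
by move=> l; rewrite eq_sym neq_lift.
Qed.

Section CokernelAnnihilator.
Variables (A : comNzRingType) (p m : nat) (M : 'M[A]_(p, m)).

(** The annihilator of the cokernel of M. *)
Definition coker_ann : set A := [set a | exists W, M *m W = a%:M].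

Lemma coker_annP : is_ideal coker_ann.
Proof.
split; first by exists 0; rewrite mulmx0 raddf0.
  by move=> a b [W WE] [V VE]; exists (W + V); rewrite mulmxDr WE VE raddfD.
by move=> r a [W WE]; exists (r *: W); rewrite -scalemxAr WE scale_scalar_mx.
Qed.

(** Cramer's rule. *)
Lemma coker_ann_minor (g : 'I_p -> 'I_m) : coker_ann (\det (colsub g M)).
Proof.
exists (\matrix_(i, j) (i == g j)%:R *m \adj (colsub g M)).
rewrite mulmxA -mul_mx_adj; congr (_ *m _); apply/matrixP => i j; rewrite !mxE.
rewrite (bigD1 (g j)) //= mxE eqxx mulr1 big1 ?addr0 // => l /negbTE lj.
by rewrite mxE lj mulr0.
Qed.

Lemma coker_ann_minors : minors_ideal p M `<=` coker_ann.
Proof.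
apply: ideal_gen_min coker_annP _ => _ [f [g [fi gi ->]]].
have -> : mxsub f g M = colsub g M.
  by apply/matrixP => a b; rewrite !mxE (increasing_id fi).
exact: coker_ann_minor.
Qed.

End CokernelAnnihilator.

Lemma det_homog (k : fieldType) d n (M : 'M[{mpoly k[d]}]_n) (r : 'I_n -> nat) :
  (forall i j, M i j \is (r i).-homog) -> \det M \is (\sum_i r i)%N.-homog.
Proof.
move=> Mr; rewrite rpred_sum // => s _; rewrite -signr_odd mulr_sign.
suff H : \prod_i M i (s i) \is (\sum_i r i)%N.-homog by case: ifP => _; rewrite ?dhomogN.
apply: (big_rec2 (fun (x : {mpoly k[d]}) y => x \is y.-homog)); first exact: dhomog1.
by move=> i x y _ xy; apply: dhomogM.
Qed.

(** * The ideals I and J and the cokernel of Phi2 *)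

Section Setup.
Variables (k : fieldType) (d p m : nat) (E : (d + p = m.+1)%N).
Local Notation R := {mpoly k[d]}.
Variables (Phi1 : 'M[R]_(d, m)) (Phi2 : 'M[R]_(p, m)).

Definition phi : 'M[R]_(m.+1, m) := castmx (E, erefl m) (col_mx Phi1 Phi2).
Definition top (i : 'I_d) : 'I_m.+1 := cast_ord E (lshift p i).
Definition bot (j : 'I_p) : 'I_m.+1 := cast_ord E (rshift d j).
Definition Delta : 'I_m.+1 -> R := signed_minor phi.
Definition idealI : set R := family_ideal Delta.
Definition idealJ : set R := family_ideal (fun i => Delta (top i)).

Lemma phi_top i j : phi (top i) j = Phi1 i j.
Proof. by rewrite castmxE cast_ord_id cast_ordK col_mxEu. Qed.

Lemma phi_bot i j : phi (bot i) j = Phi2 i j.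
Proof. by rewrite castmxE cast_ord_id cast_ordK col_mxEd. Qed.

Lemma sum_rows (V : nmodType) (F : 'I_m.+1 -> V) :
  \sum_i F i = \sum_i F (top i) + \sum_j F (bot j).
Proof.
rewrite (reindex (cast_ord E)) ?big_split_ord //=.
by exists (cast_ord (esym E)) => i _; rewrite ?cast_ordK ?cast_ordKV.
Qed.

Lemma idealJI : idealJ `<=` idealI.
Proof.
by apply: family_ideal_min (family_idealP _) _ => i; apply: family_ideal_in.
Qed.

(** If Phi2 W = a then the columns of phi W are relations between the minors,
    which express a * Delta (bot j) by the Delta (top i). *)
Lemma coker_ann_mulI a b : coker_ann Phi2 a -> idealI b -> idealJ (a * b).
Proof.
move=> [W WE] [c ->]; rewrite mulr_sumr; have iJ := family_idealP (fun i => Delta (top i)).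
apply: ideal_sum => // i _; rewrite mulrCA; case: (iJ) => _ _; apply.
have {c} -> : i = cast_ord E (cast_ord (esym E) i) by rewrite cast_ordKV.
case: (split_ordP (cast_ord (esym E) i)) => j ->.
  by case: (iJ) => _ _; apply; apply: (family_ideal_in (fun i => Delta (top i))).
rewrite -/(bot j).
have := signed_minor_mul phi (col j W); rewrite sum_rows => /eqP.
rewrite addrC addr_eq0 => /eqP DE.
have -> : a * Delta (bot j) = \sum_i Delta (bot i) * (phi *m col j W) (bot i) 0.
  rewrite (bigD1 j) //= big1 ?addr0 => [|l lj].
    have /matrixP/(_ j j) := WE; rewrite [RHS]mxE eqxx mulr1n => <-.
    by rewrite mulrC !mxE; congr (_ * _); apply: eq_bigr => x _; rewrite phi_bot mxE.
  have /matrixP/(_ l j) := WE; rewrite [RHS]mxE (negbTE lj) mulr0n => H.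
  rewrite [X in _ * X](_ : _ = 0) ?mulr0 // -H !mxE.
  by apply: eq_bigr => x _; rewrite phi_bot mxE.
rewrite DE; apply: idealN => //; apply: ideal_sum => // l _.
by apply: ideal_mulr => //; apply: (family_ideal_in (fun i => Delta (top i))).
Qed.

(** The finite length of the cokernel of Phi2, in the form in which the three
    equivalent conditions are used. *)
Definition finite_colength := forall i, exists l, coker_ann Phi2 ('X_i ^+ l).

Lemma finite_colength_mulI : finite_colength ->
  forall i, exists l, forall b, idealI b -> idealJ ('X_i ^+ l * b).
Proof. by move=> C i; have [l Cl] := C i; exists l => b; apply: coker_ann_mulI. Qed.

(** Off the origin some variable is invertible, so Phi2 is surjective there. *)
Lemma finite_colength_point (K : fieldType) (psi : {rmorphism R -> K}) i
    (lam : 'rV[K]_p) : finite_colength -> psi 'X_i != 0 ->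
  lam *m map_mx psi Phi2 = 0 -> lam = 0.
Proof.
move=> C xi l0; have [l [W WE]] := C i.
have /(congr1 (mulmx lam)) := congr1 (map_mx psi) WE.
rewrite map_mxM mulmxA l0 mul0mx map_scalar_mx mul_mx_scalar rmorphXn /=.
by move=> /esym/eqP; rewrite scalemx_eq0 expf_eq0 (negbTE xi) andbF => /eqP.
Qed.

Lemma irrelevant_exp i l : ideal_exp (@irrelevant k d) l ('X_i ^+ l).
Proof.
elim: l => [|l IHl]; first by [].
rewrite exprS; apply: ideal_gen_incl; exists 'X_i, ('X_i ^+ l); split=> //.
by apply: ideal_gen_incl; exists i.
Qed.

Hypothesis hI : ideal_height idealI 2.

Lemma Delta_neq0 : exists i, Delta i != 0.
Proof.
have [a [c ->] a0] := codim2_neq0 hI; apply: contrapT => D0.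
case/eqP: a0; apply: big1 => i _; apply/eqP; rewrite mulf_eq0; apply/orP; right.
by apply/negPn/negP => Di; apply: D0; exists i.
Qed.

Lemma Delta_coprime b : (forall i, divides b (Delta i)) -> divides b 1.
Proof.
move=> Db; apply: (@codim2_common_divisor _ _ (@mpoly_field_factorial k d) hI).
by move=> _ [c ->]; apply: divides_sum => i _; apply: divides_mull.
Qed.

Lemma Delta_syzygy (u : 'cV[R]_m.+1) : \sum_i Delta i * u i 0 = 0 ->
  exists w, u = phi *m w.
Proof.
apply: hilbert_burch; first exact: mpoly_field_factorial.
  exact: Delta_neq0.
exact: Delta_coprime.
Qed.

(** An expression of 'X_i ^+ L * Delta (bot j) by the Delta (top i) is a relation
    between the minors, hence in the image of phi by the Hilbert-Burch theorem.
    Its last rows show that 'X_i ^+ L times the j-th basis vector is in the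
    image of Phi2. *)
Lemma saturation_finite_colength :
  saturation idealJ = idealI -> finite_colength.
Proof.
move=> satJ i.
have sat j : exists l, idealJ ('X_i ^+ l * Delta (bot j)).
  have : saturation idealJ (Delta (bot j)) by rewrite satJ; apply: family_ideal_in.
  by case=> l [_ Jl]; exists l; rewrite mulrC; apply: Jl; apply: irrelevant_exp.
have [l lP] := choice sat; pose L := (\sum_j l j)%N; exists L.
suff W j : exists w : 'cV_m, Phi2 *m w = 'X_i ^+ L *: delta_mx j 0.
  have [w wE] := choice W; exists (\matrix_(a, b) w b a 0).
  apply/matrixP => a b; have /matrixP/(_ a 0) := wE b; rewrite !mxE eqxx andbT.
  rewrite mulr_natr => <-.
  by apply: eq_bigr => x _; rewrite mxE.
have [c cE] : idealJ ('X_i ^+ L * Delta (bot j)).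
  rewrite /L (bigD1 j) //= addnC exprD -mulrA.
  by have [_ _ M] := family_idealP (fun i => Delta (top i)); apply: M; apply: lP.
pose u : 'cV[R]_m.+1 := castmx (E, erefl 1%N)
  (col_mx (\col_a - c a) ('X_i ^+ L *: delta_mx j 0)).
have uT a : u (top a) 0 = - c a.
  by rewrite castmxE cast_ord_id cast_ordK col_mxEu mxE.
have uB a : u (bot a) 0 = 'X_i ^+ L * (a == j)%:R.
  by rewrite castmxE cast_ord_id cast_ordK col_mxEd !mxE eqxx andbT.
have [|w uw] := @Delta_syzygy u.
  move: (Delta) cE => D cE; rewrite sum_rows.
  have -> : \sum_a D (bot a) * u (bot a) 0 = 'X_i ^+ L * D (bot j).
    rewrite (bigD1 j) //= uB eqxx mulr1 big1 ?addr0 => [|a /negbTE aj].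
      by rewrite mulrC.
    by rewrite uB aj !mulr0.
  rewrite cE -big_split big1 // => a _ /=.
  by rewrite uT mulrN mulrC addNr.
exists w; apply/matrixP => a b; rewrite ord1 [RHS]mxE [delta_mx _ _ _ _]mxE eqxx andbT.
rewrite -uB uw !mxE; apply: eq_bigr => x _; by rewrite phi_bot.
Qed.

Hypothesis Phi2_homog : forall i j, Phi2 i j \is 1.-homog.

Lemma minors_homog (f : 'I_p -> 'I_p) (g : 'I_p -> 'I_m) :
  \det (mxsub f g Phi2) \is p.-homog.
Proof.
have := @det_homog k d p (mxsub f g Phi2) (fun _ => 1%N).
by rewrite sum1_card card_ord; apply => i j; rewrite mxE.
Qed.

(** The cone over a zero of the maximal minors of Phi2 off the origin would be a
    prime that contains them and has height less than d. *)
Lemma height_finite_colength :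
  ideal_height (minors_ideal p Phi2) d -> finite_colength.
Proof.
move=> hP i; apply: contrapT => /forallNP noX.
have [|K [psi [psi0 /eqP xi]]] := @field_point _ _ 'X_i (coker_annP Phi2).
  by move=> l; apply: noX.
have [h [hd hC]] := cone_height xi.
suff mC : minors_ideal p Phi2 `<=` [set f | cone psi f = 0].
  by have := hP.2 _ _ (ker_prime _) mC hC; rewrite leqNgt hd.
have [iC _ _] := ker_prime (cone psi).
apply: ideal_gen_min iC _ => _ [f [g [fi gi ->]]] /=.
rewrite (cone_homog psi (minors_homog f g)) psi0 ?polyC0 ?mul0r //.
by apply: coker_ann_minors; apply: ideal_gen_incl; exists f, g.
Qed.

End Setup.

(** * Extension of scalars and reduction of complexes *)

Lemma left_kernel_minors (K : fieldType) p m (M : 'M[K]_(p, m)) :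
  (forall g : 'I_p -> 'I_m, \det (colsub g M) = 0) ->
  exists2 lam : 'rV[K]_p, lam != 0 & lam *m M = 0.
Proof.
move=> M0; have [fM|fM] := boolP (row_free M); last first.
  have : kermx M != 0 by rewrite kermx_eq0.
  by case/rowV0Pn => lam /sub_kermxP ? ?; exists lam.
have fMt : row_full M^T by rewrite /row_full mxrank_tr.
have := fullrowsub_unit fMt; rewrite unitmxE unitfE -det_tr.
set g := fullrankfun fMt; have -> : (rowsub g M^T)^T = colsub g M.
  by apply/matrixP => i j; rewrite !mxE.
by rewrite M0 eqxx.
Qed.

Section BaseChange.
Variables (k K : fieldType) (iota : {rmorphism k -> K}).

(** This replaces a basis of K over k, of which finitely many elements are needed
    at a time. *)
Lemma independent_span (L : seq K) : exists r (e : 'I_r -> K),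
  (forall c : 'I_r -> k, \sum_i iota (c i) * e i = 0 -> forall i, c i = 0) /\
  (forall u, u \in L -> exists c : 'I_r -> k, u = \sum_i iota (c i) * e i).
Proof.
elim: L => [|u L [r [e [ei eL]]]].
  by exists 0%N, (fun _ => 0); split=> // c _ [].
have [[c cE]|uN] := EM (exists c : 'I_r -> k, u = \sum_i iota (c i) * e i).
  exists r, e; split=> // v; rewrite inE => /predU1P[->|/eL//].
  by exists c.
pose e' (i : 'I_r.+1) := if unlift ord0 i is Some j then e j else u.
have e'0 : e' ord0 = u by rewrite /e' unlift_none.
have e'S j : e' (lift ord0 j) = e j by rewrite /e' liftK.
have sumE (c : 'I_r.+1 -> k) : \sum_i iota (c i) * e' i =
    iota (c ord0) * u + \sum_j iota (c (lift ord0 j)) * e j.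
  by rewrite big_ord_recl e'0; congr (_ + _); apply: eq_bigr => j _; rewrite e'S.
exists r.+1, e'; split=> [c|v].
  rewrite sumE; have [c0|c0] := eqVneq (c ord0) 0.
    rewrite c0 rmorph0 mul0r add0r => /ei c1 i.
    by case: (unliftP ord0 i) => [j|] ->.
  move=> H; case: uN; exists (fun j => - (c ord0)^-1 * c (lift ord0 j)).
  have ic0 : iota (c ord0) != 0 by rewrite fmorph_eq0.
  apply: (mulfI ic0); move/eqP: H; rewrite addr_eq0 => /eqP->.
  rewrite mulr_sumr -sumrN.
  apply: eq_bigr => j _; rewrite rmorphM rmorphN fmorphV !mulrA mulrN.
  by rewrite mulfV // mulN1r mulNr.
rewrite inE => /predU1P[->|/eL[c ->]].
  exists (fun i => if i == ord0 then 1 else 0); rewrite sumE eqxx rmorph1 mul1r.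
  rewrite big1 ?addr0 // => j _.
  by rewrite eq_sym (negbTE (neq_lift _ _)) rmorph0 mul0r.
exists (fun i => if unlift ord0 i is Some j then c j else 0).
rewrite sumE unlift_none rmorph0 mul0r add0r.
by apply: eq_bigr => j _; rewrite liftK.
Qed.

Variable d : nat.
Local Notation ext := (map_mpoly iota).

Lemma mpoly_span (C : finType) (x : {ffun C -> {mpoly K[d]}}) :
  exists r (e : 'I_r -> K) (X : 'I_r -> {ffun C -> {mpoly k[d]}}),
    (forall c : 'I_r -> k, \sum_i iota (c i) * e i = 0 -> forall i, c i = 0) /\
    forall c, x c = \sum_i e i *: ext (X i c).
Proof.
pose L := [seq (x c)@_m | c <- enum C, m <- msupp (x c)].
have [r [e [ei eL]]] := independent_span L.
have [phi phiE] : {phi : K -> 'I_r -> k &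
    forall u, u \in L -> u = \sum_i iota (phi u i) * e i}.
  apply: (@choice _ _ (fun u c => u \in L -> u = \sum_i iota (c i) * e i)) => u.
  have [/eL[c cE]|uL] := boolP (u \in L); first by exists c.
  by exists (fun _ => 0).
exists r, e, (fun i => [ffun c => \sum_(m <- msupp (x c)) phi (x c)@_m i *: 'X_[m]]).
split=> // c; under eq_bigr do rewrite ffunE rmorph_sum scaler_sumr.
rewrite exchange_big /= {1}(mpolyE (x c)) !big_seq; apply: eq_bigr => m mx.
rewrite {1}(phiE (x c)@_m); last by apply/allpairsPdep; exists c, m; rewrite mem_enum.
rewrite scaler_suml; apply: eq_bigr => i _.
by rewrite map_mpolyZ map_mpolyX scalerA mulrC.
Qed.

Lemma mpoly_independent r (e : 'I_r -> K) (P : 'I_r -> {mpoly k[d]}) :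
  (forall c : 'I_r -> k, \sum_i iota (c i) * e i = 0 -> forall i, c i = 0) ->
  \sum_i e i *: ext (P i) = 0 -> forall i, P i = 0.
Proof.
move=> ei P0 i; apply/mpolyP => m; rewrite mcoeff0.
apply: (ei (fun j => (P j)@_m)); have := congr1 (mcoeff m) P0.
rewrite mcoeff0 raddf_sum /=; apply: etrans.
by apply: eq_bigr => j _; rewrite mcoeffZ mcoeff_map_mpoly mulrC.
Qed.

(** Exactness over k is inherited by K, which is free over k. *)
Lemma exact_base_change (B C F : finType) (D : B -> C -> {mpoly k[d]})
    (D' : C -> F -> {mpoly k[d]}) :
  (forall x, mat_apply D x = 0 -> exists y, x = mat_apply D' y) ->
  forall x : {ffun C -> {mpoly K[d]}},
    mat_apply (fun b c => ext (D b c)) x = 0 ->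
    exists y, x = mat_apply (fun b c => ext (D' b c)) y.
Proof.
move=> ex x; have [r [e [X [ei xE]]]] := mpoly_span x => Dx.
have DX i : mat_apply D (X i) = 0.
  apply/ffunP => b; rewrite [RHS]ffunE; move: i.
  apply: (@mpoly_independent r e (fun i => mat_apply D (X i) b) ei).
  have /ffunP/(_ b) := Dx; rewrite !ffunE; apply: etrans.
  under eq_bigr do rewrite ffunE rmorph_sum scaler_sumr.
  rewrite exchange_big; apply: eq_bigr => c _ /=.
  rewrite xE mulr_sumr; apply: eq_bigr => i _.
  by rewrite rmorphM scalerAr.
have [Y YE] := choice (fun i => ex _ (DX i)).
exists [ffun f => \sum_i e i *: ext (Y i f)]; apply/ffunP => c.
rewrite xE ffunE; under eq_bigr do rewrite YE ffunE rmorph_sum scaler_sumr.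
rewrite exchange_big; apply: eq_bigr => f _ /=.
rewrite ffunE mulr_sumr; apply: eq_bigr => i _.
by rewrite rmorphM scalerAr.
Qed.

End BaseChange.

Section ExactModulo.
Variables (k : fieldType) (d : nat) (B : nat -> finType).
Local Notation R := {mpoly k[d]}.
Variable D : forall i, B i -> B i.+1 -> R.

Lemma ffunBE (C : finType) (x y : {ffun C -> R}) c : (x - y) c = x c - y c.
Proof. by rewrite !ffunE. Qed.

Lemma ffunNE (C : finType) (x : {ffun C -> R}) c : (- x) c = - x c.
Proof. by rewrite ffunE. Qed.

Lemma mat_applyB (C F : finType) (M : C -> F -> R) x y :
  mat_apply M (x - y) = mat_apply M x - mat_apply M y.
Proof.
apply/ffunP => c; rewrite !ffunE -sumrB; apply: eq_bigr => f _.
by rewrite !ffunE mulrBr.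
Qed.

Lemma mat_apply_scale (C F : finType) (M : C -> F -> R) r (x : {ffun F -> R}) c :
  mat_apply M [ffun f => r * x f] c = r * mat_apply M x c.
Proof.
rewrite !ffunE mulr_sumr; apply: eq_bigr => f _.
by rewrite ffunE mulrCA.
Qed.

Lemma mat_apply_ideal (Y : set R) (C F : finType) (M : C -> F -> R)
    (x : {ffun F -> R}) c :
  is_ideal Y -> (forall f, Y (x f)) -> Y (mat_apply M x c).
Proof.
move=> iY Yx; rewrite ffunE; apply: ideal_sum => // f _.
by case: iY => _ _; apply.
Qed.

Definition exact_from (Y : set R) j := forall i (x : {ffun B i.+1 -> R}),
  (j <= i)%N -> (forall b, Y (mat_apply (@D i) x b)) ->
  exists y, forall c, Y (x c - mat_apply (@D i.+1) y c).

Hypothesis DD : forall i y, mat_apply (@D i) (mat_apply (@D i.+1) y) = 0.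

(** Modulo one more element t of a regular sequence, exactness is lost in one
    position only. The image of a cycle x is t * w, where w is a cycle as t is
    regular, hence w is the image of some v; then x - t * v is a cycle modulo
    the previous elements. *)
Lemma exact_from_step (Y Y' : set R) t j : is_ideal Y -> is_ideal Y' ->
  Y `<=` Y' -> Y' t -> (forall f, Y (t * f) -> Y f) ->
  (forall f, Y' f -> exists w, Y (f - t * w)) ->
  exact_from Y j -> exact_from Y' j.+1.
Proof.
move=> iY iY' YY' Y't treg tY ex [//|i] x ji Dx.
have [w wE] := choice (fun b => tY _ (Dx b)).
pose W : {ffun B i.+1 -> R} := [ffun b => w b].
have [b|v vE] := ex i W ji.
  apply: treg; rewrite -mat_apply_scale.
  have -> : mat_apply (@D i) [ffun f => t * W f] b =
      - mat_apply (@D i) (mat_apply (@D i.+1) x - [ffun f => t * W f]) b.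
    by rewrite mat_applyB DD sub0r ffunNE opprK.
  apply: idealN => //; apply: mat_apply_ideal => // c.
  by rewrite ffunBE [[ffun f => t * W f] c]ffunE [W c]ffunE.
pose z := x - [ffun c => t * v c].
have [b|y yE] := ex i.+1 z (ltnW ji).
  rewrite mat_applyB ffunBE mat_apply_scale.
  have -> : mat_apply (D (i:=i.+1)) x b - t * mat_apply (D (i:=i.+1)) v b =
     (mat_apply (D (i:=i.+1)) x b - t * w b) + t * (W b - mat_apply (D (i:=i.+1)) v b).
    by rewrite [W b]ffunE; ring.
  have [_ ID IM] := iY; apply: ID => //; apply: IM; exact: vE.
exists y => c; have := YY' _ (yE c).
rewrite ffunBE [[ffun c => t * v c] c]ffunE => H.
have -> : x c - mat_apply (D (i:=i.+2)) y c =
  (x c - t * v c - mat_apply (D (i:=i.+2)) y c) + v c * t by ring.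
by have [_ ID IM] := iY'; apply: ID => //; apply: IM.
Qed.

End ExactModulo.

(** * Restriction to a line *)

Section LineIdeals.
Variables (K : fieldType) (d : nat) (a : 'I_d -> K) (i0 : 'I_d).
Hypothesis ai0 : a i0 != 0.
Local Notation S := {mpoly K[d]}.

(** The quotient map by the forms line_form j for j < q, which eliminates the first
    q coordinates; for q = d it is the restriction to the line spanned by a. *)
Definition restr_line q : S -> S :=
  mmap (@mpolyC d K) (fun j : 'I_d => if (j < q)%N then (a j / a i0)%:MP * 'X_i0 else 'X_j).
HB.instance Definition _ q := GRing.RMorphism.copy (restr_line q)
  (mmap (@mpolyC d K) (fun j : 'I_d => if (j < q)%N then (a j / a i0)%:MP * 'X_i0 else 'X_j)).

Definition line_form (q : 'I_d) : S := 'X_q - (a q / a i0)%:MP * 'X_i0.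

Lemma restr_lineC q c : restr_line q c%:MP = c%:MP.
Proof. by rewrite /restr_line mmapC. Qed.

Lemma restr_lineX q j : restr_line q 'X_j =
  if (j < q)%N then (a j / a i0)%:MP * 'X_i0 else 'X_j.
Proof. by rewrite /restr_line mmap_XU. Qed.

Lemma restr_line_i0 q : restr_line q 'X_i0 = 'X_i0.
Proof. by rewrite restr_lineX divff // mpolyC1 mul1r if_same. Qed.

Lemma restr_line_id f : restr_line 0 f = f.
Proof.
rewrite -[RHS]/(idfun f); apply: mpoly_hom_ext => [c|j] /=.
  exact: restr_lineC.
exact: restr_lineX.
Qed.

Lemma restr_line_comp q q' f : (q <= q')%N ->
  restr_line q' (restr_line q f) = restr_line q' f.
Proof.
move=> qq'; rewrite -[LHS]/((restr_line q' \o restr_line q) f).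
apply: mpoly_hom_ext => [c|j] /=; first by rewrite !restr_lineC.
rewrite !restr_lineX; case: ltnP => [jq|_]; last by rewrite restr_lineX.
by rewrite rmorphM /= restr_lineC restr_line_i0 (leq_trans jq qq').
Qed.

Lemma line_form_neq0 q : q != i0 -> line_form q != 0.
Proof.
move=> qi; apply/eqP => /(congr1 (mcoeff U_(q))).
rewrite mcoeffB mcoeffCM !mcoeffXU mcoeff0 eqxx eq_sym (negbTE qi) mulr0 subr0.
by apply/eqP; rewrite oner_neq0.
Qed.

Lemma restr_line_form (q : 'I_d) : restr_line q.+1 (line_form q) = 0.
Proof.
by rewrite rmorphB rmorphM /= restr_lineC restr_line_i0 restr_lineX ltnSn subrr.
Qed.

Lemma restr_line_formE (q : 'I_d) : restr_line q (line_form q) = line_form q.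
Proof.
by rewrite rmorphB rmorphM /= restr_lineC restr_line_i0 restr_lineX ltnn.
Qed.

Lemma restr_line_step (q : 'I_d) f : restr_line q.+1 f = 0 ->
  exists w, restr_line q (f - line_form q * w) = 0.
Proof.
(* the quotient by the form line_form q alone *)
pose tau : {rmorphism S -> S} :=
  mmap (@mpolyC d K) (fun j => if j == q then (a q / a i0)%:MP * 'X_i0 else 'X_j).
have tauC c : tau c%:MP = c%:MP by rewrite /tau /= mmapC.
have tauX j : tau 'X_j = if j == q then (a q / a i0)%:MP * 'X_i0 else 'X_j.
  by rewrite /tau /= mmap_XU.
clearbody tau.
have tauE h : exists w, h - tau h = line_form q * w.
  elim/mpoly_closed_ind: h => [c|j|g h [w gE] [v hE]|g h [w gE] [v hE]].
  - by exists 0; rewrite tauC subrr mulr0.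
  - rewrite tauX; case: eqP => [->|_]; first by exists 1; rewrite mulr1.
    by exists 0; rewrite subrr mulr0.
  - by exists (w + v); rewrite rmorphD opprD addrACA gE hE mulrDr.
  - exists (w * h + tau g * v); rewrite rmorphM mulrDr mulrA -gE [tau g * v]mulrC.
    by rewrite mulrA -hE; ring.
have tau_line h : tau (restr_line q h) = restr_line q.+1 h.
  rewrite -[LHS]/((tau \o restr_line q) h).
  apply: mpoly_hom_ext => [c|j] /=; first by rewrite !restr_lineC tauC.
  have ti : tau 'X_i0 = 'X_i0.
    by rewrite tauX; case: eqP => [<-|//]; rewrite divff // mpolyC1 mul1r.
  rewrite !restr_lineX ltnS; case: ltngtP => jq.
  - by rewrite rmorphM tauC ti.
  - by rewrite tauX -val_eqE gtn_eqF.
  - by rewrite (val_inj jq) tauX eqxx.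
move=> f0; have [w] := tauE (restr_line q f); rewrite tau_line f0 subr0 => fE.
exists w; rewrite rmorphB rmorphM /= restr_line_formE.
have := congr1 (restr_line q) fE; rewrite rmorphM /= restr_line_formE => <-.
by rewrite restr_line_comp // subrr.
Qed.

Lemma restr_line_skip f : restr_line i0.+1 f = restr_line i0 f.
Proof.
apply: mpoly_hom_ext => [c|j]; first by rewrite /= !restr_lineC.
rewrite /= !restr_lineX ltnS leq_eqVlt; case: eqP => [/val_inj->|//].
by rewrite /= ltnn divff // mpolyC1 mul1r.
Qed.

Variable B : nat -> finType.
Variable D : forall i, B i -> B i.+1 -> S.
Hypothesis exD : forall i x, mat_apply (@D i) x = 0 -> exists y, x = mat_apply (@D i.+1) y.
Hypothesis DD : forall i y, mat_apply (@D i) (mat_apply (@D i.+1) y) = 0.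

(** The line is cut out by a regular sequence of d - 1 linear forms: the form of
    index i0 vanishes, which explains the offset. *)
Lemma exact_from_line q : (q <= d)%N ->
  exact_from D [set f | restr_line q f = 0] (q - (i0 < q))%N.
Proof.
elim: q => [_ i x _ Dx|q IHq qd].
  have [|y ->] := exD (x := x).
    by apply/ffunP => b; have := Dx b; rewrite /= restr_line_id => ->; rewrite ffunE.
  by exists y => c /=; rewrite subrr rmorph0.
have {}IHq := IHq (ltnW qd); pose Q := Ordinal qd.
have [Qi|Qi] := eqVneq Q i0.
  have -> : restr_line q.+1 = restr_line q.
    by apply/funext => f; have := restr_line_skip f; rewrite -Qi.
  by move: IHq; rewrite -Qi /= ltnn ltnSn subn0 subn1 /=.
have -> : (q.+1 - (i0 < q.+1) = (q - (i0 < q)).+1)%N.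
  have : q != i0 :> nat by [].
  case: (ltngtP i0 q) => [iq|qi|->] //=.
    by move=> _; rewrite ltnS (ltnW iq) !subn1 prednK ?(leq_ltn_trans _ iq).
  by move=> _; rewrite ltnS leqNgt qi !subn0.
have [iY _ _] := ker_prime (restr_line q).
have [iY' _ _] := ker_prime (restr_line q.+1).
apply: (exact_from_step DD iY iY' _ (restr_line_form Q) _ _ IHq).
- by move=> f /= f0; rewrite -(restr_line_comp f (leqnSn q)) f0 rmorph0.
- move=> f /= /eqP; rewrite rmorphM /= (restr_line_formE Q) mulf_eq0.
  by rewrite (negbTE (line_form_neq0 Qi)) => /eqP.
- by move=> f /= f0; apply: (@restr_line_step Q).
Qed.

End LineIdeals.

(** * Exactness of the Buchsbaum-Rim complex *)

Section BuchsbaumRimExact.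
Variables (k : fieldType) (d' p m : nat).
Local Notation d := d'.+3.
Local Notation R := {mpoly k[d]}.
Hypothesis E : (d + p = m.+1)%N.
Variable Phi2 : 'M[R]_(p, m).
Hypothesis Phi2_homog : forall i j, Phi2 i j \is 1.-homog.
Local Notation B := (br_basis p m).
Local Notation D := (fun i => @br_diff R p m Phi2 i).
Hypothesis exact : forall i x,
  mat_apply (@D i) x = 0 <-> exists y, x = mat_apply (@D i.+1) y.

Variables (K : fieldType) (psi : {rmorphism R -> K}).
Local Notation S := {mpoly K[d]}.
Variable iota : {rmorphism k -> K}.
Hypothesis iotaE : forall c, psi c%:MP = iota c.
Local Notation ext := (map_mpoly iota).
Let DK i (b : B i) (c : B i.+1) : S := ext (D i b c).

Lemma br_ext_exact i x : mat_apply (@DK i) x = 0 ->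
  exists y, x = mat_apply (@DK i.+1) y.
Proof. by apply: exact_base_change => z /exact. Qed.

Lemma br_ext_complex i y : mat_apply (@DK i) (mat_apply (@DK i.+1) y) = 0.
Proof.
apply/ffunP => b; rewrite !ffunE.
under eq_bigr do rewrite ffunE mulr_sumr.
rewrite exchange_big big1 // => f _ /=.
under eq_bigr do rewrite mulrA -rmorphM.
rewrite -mulr_suml -rmorph_sum.
suff -> : \sum_c D i b c * D i.+1 c f = 0 by rewrite rmorph0 mul0r.
have [_ /(_ (ex_intro _ [ffun g => (g == f)%:R] erefl))] :=
  exact (mat_apply (@D i.+1) [ffun g => (g == f)%:R]).
move=> /ffunP/(_ b); rewrite !ffunE; apply: etrans.
apply: eq_bigr => c _; rewrite ffunE; congr (_ * _).
rewrite (bigD1 f) //= ffunE eqxx mulr1 big1 ?addr0 // => g /negbTE gf.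
by rewrite ffunE gf mulr0.
Qed.

Variable i0 : 'I_d.
Hypothesis xi0 : psi 'X_i0 != 0.
Let a i := psi 'X_i.
Local Notation restr := (restr_line a i0).

(** On the line, a linear form is its value at the point times a coordinate. *)
Lemma restr_ext_linear f : f \is 1.-homog ->
  restr d (ext f) = (psi f)%:MP * ((a i0)^-1 *: 'X_i0).
Proof.
move=> f1; set t : S := _ *: _.
pose theta : {rmorphism {poly K} -> S} := horner_eval t \o map_poly (@mpolyC d K).
have thC c : theta c%:P = c%:MP by rewrite /theta /= map_polyC /horner_eval hornerC.
have thX : theta 'X = t by rewrite /theta /= map_polyX /horner_eval hornerX.
clearbody theta.
have -> : restr d (ext f) = theta (cone psi f).
  rewrite -[LHS]/((restr d \o ext) f) -[RHS]/((theta \o cone psi) f).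
  apply: mpoly_hom_ext => [c|i] /=.
    by rewrite coneC iotaE map_mpolyC restr_lineC thC.
  rewrite coneX map_mpolyX restr_lineX ltn_ord [RHS]rmorphM thC thX /t /a.
  by rewrite -mul_mpolyC mulrA -mpolyCM.
by rewrite (cone_homog psi f1) expr1 rmorphM thC thX.
Qed.

Variable lam : 'rV[K]_p.
Hypothesis lam0 : lam *m map_mx psi Phi2 = 0.

Definition lam_pow (mm : 'X_{1..p}) : K := \prod_(j < p) lam 0 j ^+ mm j.

Local Notation allcols := (finset.setTfor 'I_m).
Local Notation top_basis := {q : 'X_{1..p < d'.+2} * {set 'I_m} |
  (mdeg q.1 == d'.+1) && (#|q.2| == p + 1 + d'.+1)%N}.
(** A chain in the top term of the complex: the divided power of a functional that
    kills the image of Phi2 at the point, tensored with the orientation of the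
    full set of columns. *)
Let v : {ffun B d -> S} :=
  finfun (fun b : B d => (lam_pow (val (b : top_basis)).1)%:MP : S).

Lemma br_top_size : (p + 1 + d'.+1 = m)%N.
Proof. by move: E; lia. Qed.

Lemma br_top_setT (b : top_basis) : (val b).2 = allcols.
Proof.
apply/eqP; rewrite eqEcard finset.subsetT cardsT card_ord /=.
by case/andP: (valP b) => _ /eqP->; rewrite br_top_size.
Qed.

Lemma br_top_cycle b : restr d (mat_apply (@DK d'.+2) v b) = 0.
Proof.
pose b' : {q : 'X_{1..p < d'.+1} * {set 'I_m} |
  (mdeg q.1 == d') && (#|q.2| == p + 1 + d')%N} := b.
have topP j : (mdeg ((val b').1 + U_(j))%MM < d'.+2)%N.
  by case/andP: (valP b') => /eqP md _; rewrite mdegD mdeg1 addn1 md.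
have topQ j : (mdeg (BMultinom (topP j), allcols).1 == d'.+1) &&
    (#|(BMultinom (topP j), allcols).2| == p + 1 + d'.+1)%N.
  case/andP: (valP b') => /eqP md _.
  by rewrite /= mdegD mdeg1 addn1 md eqxx cardsT card_ord br_top_size /=.
pose bt j : top_basis := exist _ (BMultinom (topP j), allcols) (topQ j).
have [mu muE] : {mu : {rmorphism R -> S} | forall f, mu f = restr d (ext f)}.
  by exists (restr d \o ext).
pose G (c : top_basis) j : S :=
  (\sum_(s in (val c).2 | ((val c).1 == ((val b').1 + U_(j))%MM :> 'X_{1..p}) &&
                          ((val b').2 == (val c).2 :\ s))
     mu (br_sign _ s (val c).2 * Phi2 j s)) * (lam_pow (val c).1)%:MP.
have -> : restr d (mat_apply (@DK d'.+2) v b) = \sum_(c : B d) \sum_j G c j.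
  rewrite ffunE rmorph_sum; apply: eq_bigr => c _.
  have -> : v c = (lam_pow (val (c : top_basis)).1)%:MP by rewrite ffunE.
  transitivity (mu (@br_diff R p m Phi2 d'.+2 b c) *
                restr d (lam_pow (val (c : top_basis)).1)%:MP).
    by rewrite muE -rmorphM.
  rewrite restr_lineC /= /br_koszul rmorph_sum mulr_suml.
  by apply: eq_bigr => j _; rewrite /G rmorph_sum.
rewrite exchange_big /=.
have Gt j : \sum_(c : B d) G c j = G (bt j) j.
  rewrite (bigD1 (bt j : B d)) //= big1 ?addr0 // => c cb.
  rewrite /G big_pred0 ?mul0r // => s; apply/negbTE; apply: contra cb.
  case/and3P => _ /eqP cE _; apply/eqP/val_inj => /=.
  rewrite [val c]surjective_pairing br_top_setT; congr pair.
  by apply: val_inj.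
under eq_bigr do rewrite Gt /G /= big_distrl /=.
under eq_bigr => j _.
  under eq_bigl do rewrite finset.in_setT eqxx /=.
  over.
rewrite (exchange_big_dep (fun s => (val b').2 == allcols :\ s)) //=.
have key s : \sum_j (psi (Phi2 j s))%:MP * (lam_pow ((val b').1 + U_(j))%MM)%:MP = 0 :> S.
  under eq_bigr => j _.
    have -> : lam_pow ((val b').1 + U_(j))%MM = lam_pow (val b').1 * lam 0 j.
      rewrite /lam_pow; under eq_bigr do rewrite mnmDE exprD.
      rewrite big_split; congr (_ * _); rewrite (bigD1 j) //= mnm1E eqxx expr1.
      by rewrite big1 ?mulr1 // => l /negbTE lj; rewrite mnm1E eq_sym lj.
    rewrite -mpolyCM mulrCA; over.
  rewrite -rmorph_sum -mulr_sumr /=.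
  have /rowP/(_ s) := lam0; rewrite !mxE => H.
  under eq_bigr do rewrite mulrC.
  rewrite [X in _ * X](_ : _ = 0) ?mulr0 ?mpolyC0 // -[RHS]H.
  by apply: eq_bigr => j _; rewrite mxE.
apply: big1 => s sP.
under eq_bigl do rewrite sP.
transitivity (mu (br_sign _ s allcols) * ((a i0)^-1 *: 'X_i0) *
    \sum_j (psi (Phi2 j s))%:MP * (lam_pow ((val b').1 + U_(j))%MM)%:MP).
  rewrite mulr_sumr; apply: eq_bigr => j _.
  by rewrite rmorphM [mu (Phi2 j s)]muE restr_ext_linear //; ring.
by rewrite key mulr0.
Qed.

(** On the line the complex remains exact at its last term, so the cycle v
    vanishes; among its entries are the powers of those of lam. *)
Lemma br_point_injective : lam = 0.
Proof.
have ex := @exact_from_line K d a i0 xi0 B DK br_ext_exact br_ext_complex d (leqnn d).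
have [||y yE] := ex d'.+2 v.
- by rewrite ltn_ord subn1.
- exact: br_top_cycle.
have empty (f : B d.+1) : False.
  pose f' : {q : 'X_{1..p < d'.+3} * {set 'I_m} |
    (mdeg q.1 == d'.+2) && (#|q.2| == p + 1 + d'.+2)%N} := f.
  have := max_card (mem (val f').2); rewrite card_ord.
  by case/andP: (valP f') => _ /eqP->; move: br_top_size; lia.
have v0 c : v c = 0.
  have := yE c; rewrite /= [mat_apply _ _ _]ffunE big1 ?subr0 => [|f]; last by case: (empty f).
  by rewrite ffunE restr_lineC.
apply/rowP => j; rewrite mxE.
have mP : (mdeg (U_(j) *+ d'.+1 : 'X_{1..p}) < d'.+2)%N by rewrite mdegMn mdeg1 mul1n.
have bP : (mdeg (BMultinom mP, allcols).1 == d'.+1) &&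
    (#|(BMultinom mP, allcols).2| == p + 1 + d'.+1)%N.
  by rewrite /= mdegMn mdeg1 mul1n !eqxx cardsT card_ord br_top_size /=.
have /eqP := v0 (exist _ (BMultinom mP, allcols) bP : top_basis).
rewrite ffunE mpolyC_eq0 /lam_pow (bigD1 j) //= big1 => [|l lj].
  by rewrite mulr1 mulmnE mnm1E eqxx mul1n expf_eq0 => /eqP.
by rewrite mulmnE mnm1E eq_sym (negbTE lj) expr0.
Qed.

End BuchsbaumRimExact.

(** If the cokernel of Phi2 had infinite length, Phi2 would fail to be surjective
    at a point off the origin, and a nonzero functional lam would kill its image
    there. The line through this point is cut out by d - 1 forms, while the
    complex has length d; so its restriction to the line is still exact at the
    last term, where lam provides a nonzero cycle. *)
Lemma br_finite_colength (k : fieldType) d p m (E : (d + p = m.+1)%N)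
    (Phi2 : 'M[{mpoly k[d]}]_(p, m)) : (3 <= d)%N ->
  (forall i j, Phi2 i j \is 1.-homog) ->
  (forall i x, mat_apply (@br_diff {mpoly k[d]} p m Phi2 i) x = 0 <->
     exists y, x = mat_apply (@br_diff {mpoly k[d]} p m Phi2 i.+1) y) ->
  finite_colength Phi2.
Proof.
case: d E Phi2 => [|[|[|d]]] // E Phi2 _ Phi2_homog exact i.
apply: contrapT => /forallNP noX.
have [|K [psi [psi0 /eqP xi]]] := @field_point _ _ 'X_i (coker_annP Phi2).
  by move=> l; apply: noX.
have [g|lam lam0 lamM] := @left_kernel_minors K p m (map_mx psi Phi2).
  rewrite -(psi0 (\det (colsub g Phi2))); last exact: coker_ann_minor.
  by rewrite -det_map_mx map_mxsub.
case/eqP: lam0; apply: (br_point_injective E Phi2_homog exact _ xi lamM).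
exact: (fun c => erefl ((psi \o @mpolyC _ k) c)).
Qed.

(** * Powers of ideals *)

Section IdealProducts.
Variable A : comNzRingType.
Implicit Types I J : set A.

Lemma ideal_mul_in I J a b : I a -> J b -> ideal_mul I J (a * b).
Proof. by move=> Ia Jb; apply: ideal_gen_incl; exists a, b. Qed.

Lemma ideal_mul_min I J L : is_ideal L ->
  (forall a b, I a -> J b -> L (a * b)) -> ideal_mul I J `<=` L.
Proof. by move=> iL H; apply: ideal_gen_min => // _ [a [b [Ia Jb ->]]]; apply: H. Qed.

Lemma ideal_expP I l : is_ideal (ideal_exp I l).
Proof. by case: l => [|l]; [split | apply: ideal_genP]. Qed.

Lemma ideal_expS I l a b : I a -> ideal_exp I l b -> ideal_exp I l.+1 (a * b).
Proof. exact: ideal_mul_in. Qed.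

Lemma ideal_exp_mul I l n a b :
  ideal_exp I l a -> ideal_exp I n b -> ideal_exp I (l + n) (a * b).
Proof.
elim: l a => [|l IHl] a Ia In; first by have [_ _ M] := ideal_expP I n; apply: M.
pose L := [set c | ideal_exp I (l.+1 + n) (c * b)].
have iL : is_ideal L.
  have [E0 ED EM] := ideal_expP I (l.+1 + n).
  split; rewrite /L /= ?mul0r //; [move=> x y | move=> r x].
    by rewrite mulrDl; apply: ED.
  by rewrite -mulrA; apply: EM.
apply: (ideal_mul_min iL) a Ia => x y Ix Iy.
by rewrite /L /= -mulrA; apply: ideal_mul_in => //; apply: IHl.
Qed.

Lemma ideal_mul_exp I J l n a b :
  ideal_mul J (ideal_exp I l) a -> ideal_exp I n b ->
  ideal_mul J (ideal_exp I (l + n)) (a * b).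
Proof.
move=> Ja In; pose L := [set c | ideal_mul J (ideal_exp I (l + n)) (c * b)].
have iL : is_ideal L.
  have [E0 ED EM] := ideal_genP [set a | exists x y, [/\ J x, ideal_exp I (l + n) y & a = x * y]].
  split; rewrite /L /= ?mul0r //; [move=> x y | move=> r x].
    by rewrite mulrDl; apply: ED.
  by rewrite -mulrA; apply: EM.
apply: (ideal_mul_min iL) a Ja => x y Jx Iy.
by rewrite /L /= -mulrA; apply: ideal_mul_in => //; apply: ideal_exp_mul.
Qed.

Variables (n : nat) (g : 'I_n -> A).
Local Notation I := (family_ideal g).

Lemma ideal_exp_monomial (al : 'X_{1..n}) : ideal_exp I (mdeg al) (mmap1 g al).
Proof.
rewrite mdegE /mmap1; apply: (big_rec2 (fun a e => ideal_exp I e a)) => // i e a _ Ie.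
apply: ideal_exp_mul => //; elim: (al i) => [|l IHl] //.
by rewrite exprS; apply: ideal_expS => //; apply: family_ideal_in.
Qed.

Lemma ideal_exp_monomials e L : is_ideal L ->
  (forall al : 'X_{1..n}, mdeg al = e -> L (mmap1 g al)) -> ideal_exp I e `<=` L.
Proof.
elim: e L => [|e IHe] L iL Lg.
  by move=> a _; have [_ _ M] := iL; rewrite -[a]mulr1 -(mmap11 g); apply: M; apply: Lg; rewrite mdeg0.
apply: ideal_mul_min => // a b [c ->] Ib; rewrite mulr_suml; apply: ideal_sum => // i _.
have iLi : is_ideal [set x | L (g i * x)].
  have [L0 LD LM] := iL; split; rewrite /= ?mulr0 //; [move=> x y|move=> r x].
    by rewrite mulrDr; apply: LD.
  by rewrite mulrCA; apply: LM.
rewrite -mulrA; have [_ _ M] := iL; apply: M; apply: (IHe _ iLi) Ib => al ale /=.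
rewrite -(mmap1U g i) -commr_mmap1_M; last by move=> j x; apply: mulrC.
apply: Lg.
by rewrite mdegD mdeg1 ale.
Qed.

End IdealProducts.

Lemma linear_form_sum (k : fieldType) d (f : {mpoly k[d]}) : f \is 1.-homog ->
  f = \sum_l f@_U_(l) *: 'X_l.
Proof.
move=> /dhomogP f1; apply/mpolyP => mm; rewrite raddf_sum /=.
under eq_bigr do rewrite mcoeffZ mcoeffX.
have [mf|mf] := boolP (mm \in msupp f); last first.
  rewrite (memN_msupp_eq0 mf) big1 // => l _.
  by case: eqP => [E|_]; rewrite ?mulr0 // E (memN_msupp_eq0 mf) mul0r.
have := f1 mm mf => /eqP; rewrite mdeg_eq1 => /existsP[l /eqP mE].
rewrite (bigD1 l) //= mE eqxx mulr1 big1 ?addr0 // => j jl.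
by rewrite eq_mnm1 (negbTE jl) mulr0.
Qed.

(** * The linear case *)

Section Reduction.
Variables (k : fieldType) (d p m : nat) (E : (d + p = m.+1)%N).
Local Notation R := {mpoly k[d]}.
Variables (phi : 'M[R]_(m.+1, m)) (Phi2 : 'M[R]_(p, m)) (Delta : 'I_m.+1 -> R).
Local Notation top := (top E).
Local Notation bot := (bot E).
Local Notation I := (family_ideal Delta).
Local Notation J := (family_ideal (fun i => Delta (top i))).
Local Notation T := {mpoly k[m.+1]}.

(** When the Delta i are forms of one degree, the image is the special fibre ring
    of I. *)
Definition fibre : T -> {poly R} :=
  mmap (polyC \o @mpolyC d k) (fun i => (Delta i)%:P * 'X).
HB.instance Definition _ := GRing.RMorphism.copy fibre
  (mmap (polyC \o @mpolyC d k) (fun i => (Delta i)%:P * 'X)).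

Lemma fibreX i : fibre 'X_i = (Delta i)%:P * 'X.
Proof. by rewrite /fibre mmap_XU. Qed.

Lemma fibreC c : fibre c%:MP = (c%:MP)%:P.
Proof. by rewrite /fibre mmapC. Qed.

Lemma fibre_coef G e : ideal_exp I e (fibre G)`_e.
Proof.
elim/mpoly_closed_ind: G e => [c|i|G H IG IH|G H IG IH] e.
- rewrite fibreC coefC; case: e => //= e.
  by have [] := ideal_expP I e.+1.
- rewrite fibreX coefMX; case: e => //= e; rewrite coefC; case: e => [|e] /=.
    by rewrite -[Delta i]mulr1; apply: ideal_mul_in => //; apply: family_ideal_in.
  by have [] := ideal_expP I e.+2.
- rewrite (rmorphD fibre) coefD; have [_ ED _] := ideal_expP I e.
  by apply: ED; [exact: IG | exact: IH].
- rewrite (rmorphM fibre) coefM; apply: ideal_sum (ideal_expP I e) _ => j _.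
  by have := ideal_exp_mul (IG j) (IH (e - j)%N); rewrite subnKC // leq_ord.
Qed.

Hypothesis Delta_phi : forall j, \sum_i Delta i * phi i j = 0.
Hypothesis phi_homog : forall i j, phi i j \is 1.-homog.
Hypothesis phi_bot : forall i j, phi (bot i) j = Phi2 i j.
Hypothesis colength : finite_colength Phi2.
Hypothesis d_gt0 : (0 < d)%N.

(** The Jacobian dual of phi: T phi = x B. *)
Definition jacobian_dual : 'M[T]_(d, m) :=
  \matrix_(l, j) \sum_i ((phi i j)@_U_(l)) *: 'X_i.

(** In the Rees algebra the row of the variables 'X_l is killed by the Jacobian
    dual, and it is nonzero in a domain. *)
Lemma jacobian_dual_minor (g : 'I_d -> 'I_m) :
  fibre (\det (colsub g jacobian_dual)) = 0.
Proof.
pose x : 'rV[{poly R}]_d := \row_l ('X_l)%:P.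
have xB : x *m map_mx fibre (colsub g jacobian_dual) = 0.
  apply/rowP => j; rewrite !mxE.
  transitivity (\sum_i (Delta i * phi i (g j))%:P * 'X : {poly R}); last first.
    by rewrite -mulr_suml -rmorph_sum /= Delta_phi mul0r.
  under eq_bigr do rewrite !mxE rmorph_sum mulr_sumr.
  rewrite exchange_big; apply: eq_bigr => i _ /=.
  rewrite [in RHS](linear_form_sum (phi_homog i (g j))) mulr_sumr rmorph_sum mulr_suml.
  apply: eq_bigr => l _; rewrite -[in LHS]mul_mpolyC rmorphM /= fibreC fibreX.
  by rewrite -mul_mpolyC !polyCM; ring.
have : \det (map_mx fibre (colsub g jacobian_dual)) *: x = 0.
  by rewrite -mul_mx_scalar -mul_mx_adj mulmxA xB mul0mx.
rewrite det_map_mx => /rowP/(_ (Ordinal d_gt0)); rewrite !mxE => /eqP.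
rewrite mulf_eq0 polyC_eq0 => /orP[/eqP//|/eqP/(congr1 (mcoeff U_(Ordinal d_gt0)))].
by rewrite mcoeffXU eqxx mcoeff0 => /eqP; rewrite oner_eq0.
Qed.

(** The special fibre ring of I is finite over that of J, as no point psi of it
    other than the origin annihilates all the 'X_(top i). At such a point the
    Jacobian dual would have a nonzero left kernel vector a, and then the
    coordinates of psi on the rows of Phi2 would be a functional that kills the
    image of Phi2 at the point a. *)
Lemma fibre_integral j : exists l G (c : 'I_d -> T),
  fibre G = 0 /\ 'X_(bot j) ^+ l = G + \sum_i c i * 'X_(top i).
Proof.
pose L : set T := [set F | exists G (c : 'I_d -> T),
  fibre G = 0 /\ F = G + \sum_i c i * 'X_(top i)].
have iL : is_ideal L.
  split.
  - exists 0, (fun _ => 0); rewrite (rmorph0 fibre) add0r big1 // => i _.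
    by rewrite mul0r.
  - move=> _ _ [G [c [G0 ->]]] [G' [c' [G0' ->]]]; exists (G + G'), (fun i => c i + c' i).
    rewrite (rmorphD fibre) /= G0 G0' addr0 addrACA; split=> //; congr (_ + _).
    by rewrite -big_split; apply: eq_bigr => i _; rewrite mulrDl.
  - move=> r _ [G [c [G0 ->]]]; exists (r * G), (fun i => r * c i).
    rewrite (rmorphM fibre) /= G0 mulr0 mulrDr; split=> //; congr (_ + _).
    by rewrite mulr_sumr; apply: eq_bigr => i _; rewrite mulrA.
apply: contrapT => /forallNP noL.
have [|K [psi [psi0 psij]]] := @field_point _ L 'X_(bot j) iL.
  by move=> l [G [c H]]; apply: (noL l); exists G, c.
have psiG G : fibre G = 0 -> psi G = 0.
  move=> G0; apply: psi0; exists G, (fun _ => 0); split=> //.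
  by rewrite big1 ?addr0 // => i _; rewrite mul0r.
have psiT i : psi 'X_(top i) = 0.
  apply: psi0; exists 0, (fun l => (l == i)%:R); rewrite (rmorph0 fibre) add0r; split=> //.
  rewrite (bigD1 i) //= eqxx mul1r big1 ?addr0 // => l /negbTE->.
  by rewrite mul0r.
have [g|a a0 aB] := @left_kernel_minors K d m (map_mx psi jacobian_dual).
  by rewrite -map_mxsub det_map_mx psiG // jacobian_dual_minor.
have [i ai] : exists i, a 0 i != 0.
  apply: contrapT => /forallNP ai; case/eqP: a0; apply/rowP => i; rewrite mxE.
  by apply/eqP/negPn/negP/ai.
pose psi' : {rmorphism R -> K} := mmap (psi \o @mpolyC _ k) (fun l => a 0 l).
have psi'X l : psi' 'X_l = a 0 l by rewrite /psi' /= mmap_XU.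
have psi'C c : psi' c%:MP = psi c%:MP by rewrite /psi' /= mmapC.
clearbody psi'.
pose lam : 'rV[K]_p := \row_l psi 'X_(bot l).
have lam0 : lam = 0.
  apply: (@finite_colength_point _ _ _ _ _ _ psi' i lam colength).
    by rewrite psi'X.
  apply/rowP => c; rewrite !mxE; have /rowP/(_ c) := aB; rewrite !mxE; apply: etrans.
  transitivity (\sum_i psi 'X_i * psi' (phi i c)).
    rewrite (sum_rows E) [X in _ = X + _]big1 => [|l _]; last by rewrite psiT mul0r.
    by rewrite add0r; apply: eq_bigr => l _; rewrite !mxE phi_bot.
  under [RHS]eq_bigr do rewrite !mxE rmorph_sum mulr_sumr.
  rewrite exchange_big; apply: eq_bigr => l _ /=.
  rewrite [in LHS](linear_form_sum (phi_homog l c)) rmorph_sum mulr_sumr.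
  apply: eq_bigr => x _; rewrite -!mul_mpolyC !rmorphM /= psi'C psi'X; ring.
by apply: psij; have /rowP/(_ j) := lam0; rewrite !mxE.
Qed.

(** The equation of fibre_integral, multiplied by 'X_(bot j), is read in degree
    l + 1. *)
Lemma Delta_integral j : exists l,
  ideal_mul J (ideal_exp I l) (Delta (bot j) ^+ l.+1).
Proof.
have [l [G [c [G0 XE]]]] := fibre_integral j; exists l.
have /(congr1 (fun P : {poly R} => P`_l.+1)) := congr1 fibre (congr1 ( *%R 'X_(bot j)) XE).
rewrite /= -exprS mulrDr mulr_sumr (rmorphD fibre) (rmorphM fibre 'X_(bot j) G) /= G0 mulr0 add0r.
rewrite (rmorphXn fibre) /= fibreX exprMn -rmorphXn coefCM coefXn eqxx mulr1 => ->.
rewrite (rmorph_sum fibre) coef_sum.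
apply: ideal_sum (ideal_genP _) _ => i _.
rewrite mulrA (rmorphM fibre) /= fibreX mulrA coefMX /= mulrC coefCM.
apply: ideal_mul_in; last exact: fibre_coef.
exact: (family_ideal_in (fun i => Delta (top i))).
Qed.

(** A monomial of large degree in the Delta i has a factor Delta (top i), or else
    some Delta (bot j) occurs in it with a large exponent. *)
Lemma linear_reduction : is_reduction J I.
Proof.
have JI : J `<=` I.
  by apply: family_ideal_min (family_idealP _) _ => i; apply: family_ideal_in.
split; first exact: JI.
have [l lP] := choice Delta_integral; pose N := (\sum_j l j)%N; exists N.
apply/seteqP; split; last first.
  apply: ideal_mul_min (ideal_expP I N.+1) _ => a b Ja Ib.
  by apply: ideal_expS => //; apply: JI.
apply: ideal_exp_monomials (ideal_genP _) _ => al alN.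
have split_mon (be : 'X_{1..m.+1}) : (be <= al)%MM ->
    mmap1 Delta al = mmap1 Delta be * mmap1 Delta (al - be)%MM /\
    (mdeg be + mdeg (al - be)%MM = N.+1)%N.
  move=> bal; rewrite -commr_mmap1_M; last by move=> x y; apply: mulrC.
  by rewrite -mdegD addmC submK.
have [[i ti]|/forallNP noT] := EM (exists i, al (top i) != 0%N).
  have [|-> dE] := split_mon U_(top i)%MM; first by rewrite lep1mP.
  rewrite mmap1U; apply: ideal_mul_in.
    exact: (family_ideal_in (fun i => Delta (top i))).
  have <- : mdeg (al - U_(top i))%MM = N by move: dE; rewrite mdeg1 add1n => -[].
  exact: ideal_exp_monomial.
have [j lj] : exists j, (l j < al (bot j))%N.
  apply: contrapT => /forallNP lt; have : (N.+1 <= N)%N; last by rewrite ltnn.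
  rewrite -{1}alN mdegE (sum_rows E) big1 ?add0r => [|i _].
    by apply: leq_sum => j _; rewrite leqNgt; apply/negP/lt.
  by have /negP := noT i; rewrite negbK => /eqP.
pose be := (U_(bot j) *+ (l j).+1)%MM.
have [|-> dE] := split_mon be.
  apply/mnm_lepP => x; rewrite mulmnE mnm1E; case: eqP => [<-|//].
  by rewrite mul1n.
have -> : mmap1 Delta be = Delta (bot j) ^+ (l j).+1.
  rewrite /mmap1 (bigD1 (bot j)) //= mulmnE mnm1E eqxx mul1n big1 ?mulr1 // => x xj.
  by rewrite mulmnE mnm1E eq_sym (negbTE xj).
have -> : N = (l j + mdeg (al - be)%MM)%N.
  by move: dE; rewrite mdegMn mdeg1 mul1n addSn => -[].
by apply: ideal_mul_exp; [apply: lP | apply: ideal_exp_monomial].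
Qed.

End Reduction.

(** * Localization at a prime *)

Lemma frac_cancel (F : fieldType) (x y z : F) : x != 0 -> x * y * (z / x) = y * z.
Proof. by move=> x0; field. Qed.

Lemma frac_eliminate (F : fieldType) (x y z w s t : F) :
  x * w / s - y * (z / t * w) / s = (x / s - y / s * (z / t)) * w.
Proof. by ring. Qed.

Section LocalRing.
Variables (A : idomainType) (P : set A).
Hypothesis pP : is_prime P.
Implicit Types I J : set A.
Local Notation AP := (loc_ideal P setT).

Lemma not_prime_mul s t : ~ P s -> ~ P t -> ~ P (s * t).
Proof. by have [_ _ PM] := pP => Ps Pt /PM[]. Qed.

Lemma not_prime1 : ~ P 1. Proof. by case: pP. Qed.

Lemma not_prime_neq0 s : ~ P s -> tofrac s != 0.
Proof.
by have [[P0 _ _] _ _] := pP => Ps; rewrite tofrac_eq0; apply: contra_notN Ps => /eqP->.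
Qed.

Lemma loc_idealD I x y : is_ideal I -> loc_ideal P I x -> loc_ideal P I y ->
  loc_ideal P I (x + y).
Proof.
move=> [I0 ID IM] [a [s [Ia Ps ->]]] [b [t [Ib Pt ->]]].
exists (t * a + s * b), (s * t); split; first by apply: ID; apply: IM.
  exact: not_prime_mul.
have s0 := not_prime_neq0 Ps; have t0 := not_prime_neq0 Pt.
by rewrite addf_div // tofracD !tofracM [tofrac a * _]mulrC [tofrac b * _]mulrC.
Qed.

Lemma loc_ideal_mul I x y : is_ideal I -> AP x -> loc_ideal P I y ->
  loc_ideal P I (x * y).
Proof.
move=> [I0 ID IM] [a [s [_ Ps ->]]] [b [t [Ib Pt ->]]].
exists (a * b), (s * t); split; [exact: IM | exact: not_prime_mul |].
by rewrite !tofracM invfM mulrACA.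
Qed.

Lemma loc_ideal_in I a : I a -> loc_ideal P I (tofrac a).
Proof.
by move=> Ia; exists a, 1; split; rewrite ?tofrac1 ?divr1 //; apply: not_prime1.
Qed.

Lemma loc_ring_in a : AP (tofrac a). Proof. exact: loc_ideal_in. Qed.

Lemma loc_ring_sum (T : finType) (F : T -> {fraction A}) :
  (forall i, AP (F i)) -> AP (\sum_i F i).
Proof.
move=> FA; apply: (big_ind AP) => //.
  by rewrite -tofrac0; apply: loc_ring_in.
by move=> x y; apply: loc_idealD; split.
Qed.

Lemma loc_ring_mul x y : AP x -> AP y -> AP (x * y).
Proof. by apply: loc_ideal_mul; split. Qed.

Lemma loc_ideal_eq I J s : J `<=` I -> ~ P s -> (forall b, I b -> J (s * b)) ->
  loc_ideal P I = loc_ideal P J.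
Proof.
move=> JI Ps sI; apply/seteqP; split=> x [a [t [Ia Pt ->]]].
  exists (s * a), (s * t); split; [exact: sI | exact: not_prime_mul |].
  by rewrite !tofracM -mulf_div divff ?mul1r // not_prime_neq0.
by exists a, t; split=> //; apply: JI.
Qed.

Lemma loc_common_denominator (T : finType) (x : T -> {fraction A}) :
  (forall i, AP (x i)) ->
  exists s (r : T -> A), ~ P s /\ forall i, tofrac s * x i = tofrac (r i).
Proof.
move=> Ax; have [a aP] : {a : T -> A * A & forall i, ~ P (a i).2 /\ x i = tofrac (a i).1 / tofrac (a i).2}.
  apply: (@choice _ _ (fun i a => ~ P a.2 /\ x i = tofrac a.1 / tofrac a.2)) => i.
  by have [b [t [_ Pt E]]] := Ax i; exists (b, t).
exists (\prod_i (a i).2), (fun i => (\prod_(j | j != i) (a j).2) * (a i).1); split.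
  by apply: (big_ind (fun s => ~ P s)); [apply: not_prime1 | apply: not_prime_mul | move=> i _; have [] := aP i].
move=> i; have [Pi ->] := aP i; rewrite (bigD1 i) //= !tofracM.
by rewrite frac_cancel // not_prime_neq0.
Qed.

Variables (n : nat) (f : 'I_n -> A).
Local Notation J := (family_ideal f).

Lemma loc_generated_family : loc_generated P J n.
Proof.
exists (fun i => tofrac (f i)); split=> [i|x [a [s [[c ->] Ps ->]]]].
  by apply: loc_ideal_in; apply: family_ideal_in.
exists (fun i => tofrac (c i) / tofrac s); split=> [i|].
  by exists (c i), s.
rewrite rmorph_sum mulr_suml; apply: eq_bigr => i _.
by rewrite /= tofracM mulrAC.
Qed.

(** The syzygy can be solved for f i, which makes this generator superfluous. *)
Lemma loc_generated_syzygy (c : 'I_n -> A) i :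
  \sum_j c j * f j = 0 -> ~ P (c i) -> loc_generated P J n.-1.
Proof.
case: n f c i => [|n'] g c i; first by case: i.
move=> cg Pi; exists (fun j => tofrac (g (lift i j))); split=> [j|].
  by apply: loc_ideal_in; apply: family_ideal_in.
have ci0 := not_prime_neq0 Pi.
have AP0 : is_ideal (@setT A) by split.
move=> x [a [s [[b ->] Ps ->]]].
exists (fun j => tofrac (b (lift i j)) / tofrac s
   - tofrac (b i) / tofrac s * (tofrac (c (lift i j)) / tofrac (c i))); split=> [j|].
  apply: loc_idealD => //.
    by exists (b (lift i j)), s.
  rewrite -mulN1r -tofrac1 -tofracN; apply: loc_ring_mul; first exact: loc_ring_in.
  by apply: loc_ring_mul; [exists (b i), s | exists (c (lift i j)), (c i)].
have ciE : tofrac (c i) * tofrac (g i) =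
    - \sum_j tofrac (c (lift i j)) * tofrac (g (lift i j)).
  have := congr1 (@FracField.tofrac A) cg; rewrite (bigD1_ord i) // tofracD tofrac0 tofracM.
  rewrite rmorph_sum => /eqP; rewrite addr_eq0 => /eqP->; congr (- _).
  by apply: eq_bigr => j _; rewrite /= tofracM.
have giE : tofrac (g i) = - \sum_j tofrac (c (lift i j)) / tofrac (c i) * tofrac (g (lift i j)).
  apply: (mulfI ci0); rewrite ciE mulrN; congr (- _); rewrite mulr_sumr.
  by apply: eq_bigr => j _; rewrite mulrA mulrCA divff // mulr1.
rewrite (bigD1_ord i) //= tofracD tofracM giE mulrN mulr_sumr rmorph_sum mulrDl.
rewrite mulNr !mulr_suml -sumrN -big_split /=; apply: eq_bigr => j _.
by rewrite /= tofracM addrC frac_eliminate.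
Qed.

End LocalRing.

(** * The conditions G on I and J *)

Section CompareG.
Variables (k : fieldType) (d : nat).
Local Notation R := {mpoly k[d]}.
Variables (I : set R) (f : 'I_d -> R).
Local Notation J := (family_ideal f).
Hypothesis JI : J `<=` I.
Hypothesis quotIJ : forall i, exists l, forall b, I b -> J ('X_i ^+ l * b).

(** A prime of height less than d avoids some variable, and a power of this
    variable multiplies I into J. *)
Lemma low_prime_loc (P : set R) h : is_prime P -> prime_height P h -> (h < d)%N ->
  loc_ideal P I = loc_ideal P J.
Proof.
move=> pP hP hd.
have [i Pi] : exists i, ~ P 'X_i.
  apply: contrapT => /forallNP Pi; move: hd; rewrite ltnNge.
  by rewrite (irrelevant_height pP _ hP) // => i; apply: contrapT.
have [l lI] := quotIJ i; apply: (loc_ideal_eq pP JI _ lI).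
by move/(prime_exp pP).
Qed.

Lemma low_prime_contains (P : set R) h : is_prime P -> prime_height P h -> (h < d)%N ->
  J `<=` P -> I `<=` P.
Proof.
move=> pP hP hd JP.
have [i Pi] : exists i, ~ P 'X_i.
  apply: contrapT => /forallNP Pi; move: hd; rewrite ltnNge.
  by rewrite (irrelevant_height pP _ hP) // => i; apply: contrapT.
have [l lI] := quotIJ i; move=> b /lI/JP; have [_ _ PM] := pP.
by case/PM => // /(prime_exp pP).
Qed.

(** At primes of height less than d the two ideals agree; at the other primes the
    d generators of J are few enough. *)
Lemma G_equivalence : (2 <= d)%N -> satisfies_Ginf J <-> satisfies_G d I.
Proof.
move=> d2; split=> [GJ P h pP IP hP hd|GI s s2 P h pP JP hP hs].
  have hd' : (h < d)%N by rewrite -ltnS prednK ?(ltnW d2) // in hd *.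
  have [|m [mh]] := GJ d d2 P h pP _ hP hd; first by move=> b /JI/IP.
  by rewrite /loc_generated -(low_prime_loc pP hP hd') => ?; exists m.
have [hd|hd] := ltnP h d; last by exists d; split; [|apply: loc_generated_family].
have [|m [mh]] := GI P h pP (low_prime_contains pP hP hd JP) hP.
  by rewrite -ltnS prednK // (ltnW d2).
by rewrite /loc_generated (low_prime_loc pP hP hd) => ?; exists m.
Qed.

End CompareG.

(** * The entries of the syzygies *)

Lemma pihomogM (k : fieldType) d e D (q r : {mpoly k[d]}) : r \is D.-homog ->
  pihomog [measure of mdeg] (e + D) (q * r) = pihomog [measure of mdeg] e q * r.
Proof.
move=> rD; rewrite {1}(pihomog_partitionE (leqnn (msize q))) mulr_suml raddf_sum /=.
have pD (i : 'I_(msize q)) : pihomog [measure of mdeg] (e + D)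
    (pihomog [measure of mdeg] i q * r) =
    if i == e :> nat then pihomog [measure of mdeg] e q * r else 0.
  have h := dhomogM (pihomogP [measure of mdeg] i q) rD.
  case: eqP => [<-|/eqP ie]; first exact: pihomog_dE.
  by rewrite (pihomog_ne0 _ h) // eqn_add2r.
under eq_bigr do rewrite pD.
have [eq|eq] := ltnP e (msize q).
  rewrite (bigD1 (Ordinal eq)) //= eqxx big1 ?addr0 // => i ie.
  by rewrite ifN //; apply: contra ie => /eqP ie; apply/eqP/val_inj.
rewrite big1 => [|i _]; last by rewrite ifN // ltn_eqF // (leq_trans (ltn_ord i) eq).
rewrite [pihomog _ e q](_ : _ = 0) ?mul0r // pihomogE big1_seq // => mm /andP[/eqP me].
by move/msize_mdeg_lt; rewrite me ltnNge eq.
Qed.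

Lemma exists_other d (j : 'I_d) : (2 <= d)%N -> exists l, l != j.
Proof.
case: d j => [|[|d]] // j _; have [->|j0] := eqVneq j ord0; first by exists ord_max.
by exists ord0; rewrite eq_sym.
Qed.
Section Syzygies.
Variables (k : fieldType) (d : nat).
Local Notation R := {mpoly k[d]}.
Variable f : 'I_d -> R.
Local Notation J := (family_ideal f).

Definition syz_entry : set R :=
  [set a | exists c i, \sum_j c j * f j = 0 /\ a = c i].

Definition syz_ideal : set R := ideal_gen syz_entry.

(** The entries of the syzygies of f, that is, of a presentation matrix of J, have
    no common zero off the origin. This condition links the condition G to
    linear type. *)
Definition syz_primary := forall i, exists l, syz_ideal ('X_i ^+ l).

Lemma koszul_entry i j : i != j -> syz_entry (f j).
Proof.
move=> ij; exists (fun l => if l == i then f j else if l == j then - f i else 0), i.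
have ji : j != i by rewrite eq_sym.
rewrite eqxx; split=> //; rewrite (bigD1 i) //= eqxx (bigD1 j) //= eqxx (negbTE ji).
rewrite big1 ?addr0; first by rewrite mulNr mulrC subrr.
by move=> l /andP[/negbTE-> /negbTE->]; rewrite mul0r.
Qed.

Variable D : nat.
Hypothesis f_homog : forall i, f i \is D.-homog.

(** The entries of the syzygies generate a graded ideal, since the homogeneous
    components of a syzygy are syzygies. So with psi its zero locus contains the
    line through psi. *)
Lemma syz_point : ~ syz_primary ->
  exists (K : fieldType) (psi : {rmorphism R -> K}) i,
    psi 'X_i != 0 /\ forall a, syz_entry a -> cone psi a = 0.
Proof.
move=> /existsNP[i /forallNP noX].
have [K [psi [psi0 /eqP xi]]] := field_point (ideal_genP syz_entry) noX.
exists K, psi, i; split=> // _ [c [j [cf ->]]].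
rewrite (pihomog_partitionE (leqnn (msize (c j)))) rmorph_sum big1 // => e _ /=.
rewrite (cone_homog psi (pihomogP _ e _)) psi0 ?polyC0 ?mul0r //.
apply: ideal_gen_incl; exists (fun l => pihomog [measure of mdeg] e (c l)), j; split=> //.
under eq_bigr do rewrite -(pihomogM _ _ (f_homog _)).
by rewrite -raddf_sum cf raddf0.
Qed.

Variable I : set R.
Hypothesis JI : J `<=` I.
Hypothesis quotIJ : forall i, exists l, forall b, I b -> J ('X_i ^+ l * b).
Hypothesis d2 : (2 <= d)%N.

(** Where the entries of the syzygies of the d generators vanish, these generators
    are minimal. If this happens off the origin it happens at the cone P over
    some point, whose height is less than d. *)
Lemma G_syz_primary : satisfies_G d I -> syz_primary.
Proof.
move=> GI; apply: contrapT => /syz_point[K [psi [i [xi syz0]]]].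
have [h [hd hP]] := cone_height xi; set P := [set g | _] in hP.
have pP : is_prime P := ker_prime (cone psi).
have JP : J `<=` P.
  move=> _ [c ->]; have [iP _ _] := pP; apply: ideal_sum => // j _.
  have [_ _ M] := iP; apply: M; rewrite /P /=; apply: syz0.
  have [l lj] := exists_other j d2.
  exact: koszul_entry lj.
have [|m [mh [u [uI uG]]]] := GI P h pP (low_prime_contains quotIJ pP hP hd JP) hP.
  by rewrite -ltnS prednK // (ltnW d2).
rewrite (low_prime_loc JI quotIJ pP hP hd) in uI uG.
have [U UE] : exists U : 'I_d -> 'I_m -> {fraction R}, forall j,
    (forall a, loc_ideal P setT (U j a)) /\ tofrac (f j) = \sum_a U j a * u a.
  have H j : exists V : 'I_m -> {fraction R},
     (forall a, loc_ideal P setT (V a)) /\ tofrac (f j) = \sum_a V a * u a.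
    by apply: uG; apply: loc_ideal_in => //; apply: family_ideal_in.
  by have [U UE] := choice H; exists U.
have [V VE] : exists V : 'I_m -> 'I_d -> {fraction R}, forall a,
    (forall j, loc_ideal P setT (V a j)) /\ u a = \sum_j V a j * tofrac (f j).
  have H a : exists V : 'I_d -> {fraction R},
     (forall j, loc_ideal P setT (V j)) /\ u a = \sum_j V j * tofrac (f j).
    have [_ [s [[c ->] Ps ->]]] := uI a; exists (fun j => tofrac (c j) / tofrac s).
    split=> [j|]; first by exists (c j), s.
    rewrite rmorph_sum mulr_suml; apply: eq_bigr => j _.
    by rewrite /= tofracM mulrAC.
  by have [V VE] := choice H; exists V.
(* W has rank at most m and fixes f, so the rows of 1 - W are syzygies and
   vanish at P: there W is the identity, although det W = 0 *)
pose W : 'M[{fraction R}]_d := (\matrix_(j, a) U j a) *m (\matrix_(a, j) V a j).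
have WE j l : W j l = \sum_a U j a * V a l.
  by rewrite mxE; apply: eq_bigr => a _; rewrite !mxE.
have [|s [r [Ps rE]]] := @loc_common_denominator _ P pP _
    (fun jl : 'I_d * 'I_d => W jl.1 jl.2) _.
  move=> [j l] /=; rewrite WE; apply: loc_ring_sum => // a.
  by apply: loc_ring_mul => //; [have [] := UE j | have [] := VE a].
pose r_mx : 'M[R]_d := \matrix_(j, l) r (j, l).
have syz_row j : \sum_l ((j == l)%:R * s - r (j, l)) * f l = 0.
  apply/eqP; rewrite -tofrac_eq0 rmorph_sum /=.
  under eq_bigr do rewrite tofracM tofracB -rE mulrBl tofracM -mulrA mulrCA -mulrA.
  rewrite sumrB -!mulr_sumr (bigD1 j) //= eqxx tofrac1 mul1r big1 => [|l lj]; last first.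
    by rewrite eq_sym (negbTE lj) tofrac0 mul0r.
  rewrite addr0 -mulrBr; apply/eqP; rewrite [X in _ * X](_ : _ = 0) ?mulr0 //.
  apply/eqP; rewrite subr_eq0; apply/eqP; rewrite (UE j).2.
  under [RHS]eq_bigr do rewrite WE mulr_suml.
  rewrite exchange_big; apply: eq_bigr => a _ /=.
  by rewrite (VE a).2 mulr_sumr; apply: eq_bigr => l _; rewrite mulrA.
have cone_r : map_mx (cone psi) r_mx = (cone psi s)%:M.
  apply/matrixP => j l; rewrite !mxE.
  have /eqP : cone psi ((j == l)%:R * s - r (j, l)) = 0.
    by apply: syz0; exists (fun l => (j == l)%:R * s - r (j, l)), l.
  rewrite rmorphB rmorphM /= subr_eq0 => /eqP<-.
  by rewrite rmorph_nat mulr_natl.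
have det_W : \det W = 0.
  apply/eqP/negPn/negP => W0; have : \rank W = d.
    by apply: mxrank_unit; rewrite unitmxE unitfE.
  apply/eqP; rewrite neq_ltn; apply/orP; left; apply: leq_ltn_trans hd.
  apply: leq_trans mh; apply: leq_trans (mxrankM_maxl _ _) _.
  exact: rank_leq_col.
have det_r : \det r_mx = 0.
  apply/eqP; rewrite -tofrac_eq0 -det_map_mx.
  have -> : map_mx (@FracField.tofrac R) r_mx = tofrac s *: W.
    by apply/matrixP => j l; rewrite !mxE -(rE (j, l)) /= WE; congr (_ * _); apply: eq_bigr => a _; rewrite !mxE.
  by rewrite detZ det_W mulr0.
have := congr1 (cone psi) det_r; rewrite -det_map_mx cone_r det_scalar rmorph0.
move/eqP; rewrite expf_eq0 => /andP[_ /eqP s0].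
exact: Ps.
Qed.

(** An entry of a syzygy outside P makes one of the d generators superfluous
    at P. *)
Lemma syz_primary_mu (P : set R) h : syz_primary -> is_prime P ->
  prime_height P h -> (h < d)%N -> loc_generated P I d.-1.
Proof.
move=> prim pP hP hd.
have [i Pi] : exists i, ~ P 'X_i.
  apply: contrapT => /forallNP Pi; move: hd; rewrite ltnNge.
  by rewrite (irrelevant_height pP _ hP) // => i; apply: contrapT.
have [l lS] := prim i; have [iP _ _] := pP.
have [[a [[c [j [cf ->]]] cj]]|noS] := EM (exists a, syz_entry a /\ ~ P a).
  rewrite /loc_generated (low_prime_loc JI quotIJ pP hP hd).
  exact: (loc_generated_syzygy pP cf cj).
case: Pi; apply: (prime_exp pP (n := l)); apply: (ideal_gen_min iP) lS => a aS.
by apply: contrapT => Pa; apply: noS; exists a.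
Qed.

End Syzygies.

(** * The ideal of the symmetric algebra of three elements *)

Lemma ord3_cover (i j l a : 'I_3) : i != j -> i != l -> j != l ->
  [|| a == i, a == j | a == l].
Proof.
by move: i j l a => [[|[|[|//]]] ?] [[|[|[|//]]] ?] [[|[|[|//]]] ?] [[|[|[|//]]] ?].
Qed.

Lemma sum_ord3 (V : nmodType) (F : 'I_3 -> V) i j l :
  i != j -> i != l -> j != l -> \sum_a F a = F i + F j + F l.
Proof.
move=> ij il jl; rewrite (bigD1 i) // (bigD1 j) 1?eq_sym //= (bigD1 l) /=; last first.
  by rewrite !(eq_sym l) il jl.
rewrite big1 ?addr0 ?addrA // => a /andP[/andP[ai aj] al].
by have := ord3_cover a ij il jl; rewrite (negbTE ai) (negbTE aj) (negbTE al).
Qed.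

Lemma mmap_scale_homog (A C : comNzRingType) n (iota : {rmorphism A -> C})
    (h : 'I_n -> C) y e (G : {mpoly A[n]}) : G \is e.-homog ->
  mmap iota (fun i => h i * y) G = mmap iota h G * y ^+ e.
Proof.
move=> /dhomogP Ge; rewrite mulr_suml /mmap !big_seq; apply: eq_bigr => mm /Ge me.
rewrite -mulrA; congr (_ * _); rewrite /mmap1 -(me : mdeg mm = e) mdegE expr_sum -big_split.
by apply: eq_bigr => i _; rewrite exprMn.
Qed.

Lemma mmap_congr (A C : comNzRingType) n (iota : {rmorphism A -> C})
    (h h' : 'I_n -> C) (L : set C) (G : {mpoly A[n]}) : is_ideal L ->
  (forall i, L (h i - h' i)) -> L (mmap iota h G - mmap iota h' G).
Proof.
move=> iL hL; have [L0 LD LM] := iL.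
elim/mpoly_closed_ind: G => [c|i|p q Lp Lq|p q Lp Lq].
- by rewrite !mmapC subrr.
- by rewrite !mmap_XU.
- by rewrite !rmorphD opprD addrACA; apply: LD.
- rewrite !rmorphM /=; set a := mmap _ _ _ in Lp *; set b := mmap _ _ _ in Lq *.
  set a' := mmap _ _ _ in Lp *; set b' := mmap _ _ _ in Lq *.
  have -> : a * b - a' * b' = b * (a - a') + a' * (b - b') by ring.
  by apply: LD; apply: LM.
Qed.

Lemma divides_mpolyC (A : idomainType) n (c : A) (q : {mpoly A[n]}) :
  divides c%:MP q <-> forall mm, divides c q@_mm.
Proof.
split=> [[g ->] mm|qc]; first by exists g@_mm; rewrite mulrC mcoeffCM mulrC.
have [g gE] := choice qc; exists (\sum_(mm <- msupp q) g mm *: 'X_[mm]).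
rewrite {1}(mpolyE q) mulr_suml; apply: eq_bigr => mm _.
by rewrite {1}gE -scalerAl ['X_[mm] * _]mulrC mul_mpolyC scalerA.
Qed.

(** The radical of the colon ideal of L by F. *)
Lemma radical_colon_ideal (A : comNzRingType) (L : set A) (F : A) : is_ideal L ->
  is_ideal [set r | exists n, L (r ^+ n * F)].
Proof.
move=> [L0 LD LM]; split=> /=; first by exists 1%N; rewrite expr1 mul0r.
  move=> r s [n rn] [m sm]; exists (n + m)%N; rewrite exprDn mulr_suml.
  apply: ideal_sum => // i _; rewrite mulrnAl -mulr_natl; apply: (LM).
  have [ni|ni] := leqP n (n + m - i)%N.
    rewrite -(subnK ni) exprD (_ : _ * F = r ^+ (n + m - i - n) * s ^+ i * (r ^+ n * F)).
      exact: (LM).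
    by ring.
  have mi : (m <= i)%N by lia.
  rewrite -{2}(subnK mi) exprD.
  rewrite (_ : _ * F = r ^+ (n + m - i) * s ^+ (i - m) * (s ^+ m * F)); first exact: (LM).
  by ring.
by move=> r s [n sn]; exists n; rewrite exprMn -mulrA; apply: LM.
Qed.

Section LinearTypeCore.
Variable A : idomainType.
Hypothesis A_factorial : factorial_ring A.
Local Notation S := {mpoly A[3]}.
Variable f : 'I_3 -> A.
Hypothesis f_coprime : forall b, (forall i, divides b (f i)) -> divides b 1.
Hypothesis f_neq0 : exists i, f i != 0.
Implicit Types (F G : S) (z : 'I_3 -> S).
Local Notation T i := ('X_i : S).

(** The ideal of the symmetric algebra of (f) in S = A[T]. *)
Definition sym_ideal : set S := [set F | exists z,
  \sum_i z i * (f i)%:MP = 0 /\ F = \sum_i z i * T i].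

Lemma sym_idealP : is_ideal sym_ideal.
Proof.
split.
- by exists (fun _ => 0); split; rewrite big1 // => i _; rewrite mul0r.
- move=> _ _ [z [zf ->]] [y [yf ->]]; exists (fun i => z i + y i); split.
    by under eq_bigr do rewrite mulrDl; rewrite big_split /= zf yf addr0.
  by under [RHS]eq_bigr do rewrite mulrDl; rewrite big_split.
- move=> r _ [z [zf ->]]; exists (fun i => r * z i); split.
    by under eq_bigr do rewrite -mulrA; rewrite -mulr_sumr zf mulr0.
  by under [RHS]eq_bigr do rewrite -mulrA; rewrite -mulr_sumr.
Qed.

(** The vector w is the cross product of f and T. A vector z that is orthogonal to
    f and to T is a multiple of it over the fraction field; a denominator would
    divide the entries of w, which have no common divisor as those of f have
    none. *)
Lemma second_syzygy : exists w : 'I_3 -> S, (exists i, w i != 0) /\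
  \sum_i w i * (f i)%:MP = 0 /\ \sum_i w i * T i = 0 /\
  forall z, \sum_i z i * (f i)%:MP = 0 -> \sum_i z i * T i = 0 ->
    exists u, forall i, z i = u * w i.
Proof.
have [i fi0] := f_neq0.
have [j [l [ij il jl]]] : exists j l : 'I_3, [/\ i != j, i != l & j != l].
  case: i {fi0} => [[|[|[|//]]] ?].
  - by exists (Ordinal (isT : 1 < 3)%N), (Ordinal (isT : 2 < 3)%N).
  - by exists (Ordinal (isT : 0 < 3)%N), (Ordinal (isT : 2 < 3)%N).
  - by exists (Ordinal (isT : 0 < 3)%N), (Ordinal (isT : 1 < 3)%N).
pose wi : S := (f j)%:MP * T l - (f l)%:MP * T j.
pose wj : S := (f l)%:MP * T i - (f i)%:MP * T l.
pose wl : S := (f i)%:MP * T j - (f j)%:MP * T i.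
pose w a := if a == i then wi else if a == j then wj else wl.
have wiE : w i = wi by rewrite /w eqxx.
have wjE : w j = wj by rewrite /w (eq_sym j) (negbTE ij) eqxx.
have wlE : w l = wl by rewrite /w (eq_sym l i) (eq_sym l j) (negbTE il) (negbTE jl).
have sum3 (F : 'I_3 -> S) := sum_ord3 F ij il jl.
have coefT a b c : (c%:MP * T a : S)@_U_(b) = c * (a == b)%:R.
  by rewrite mcoeffCM mcoeffXU.
have wl0 : wl != 0.
  apply/eqP => /(congr1 (mcoeff U_(j))); rewrite mcoeffB !coefT eqxx (negbTE ij).
  by rewrite mcoeff0 mulr1 mulr0 subr0 => /eqP; rewrite (negbTE fi0).
have wj0 : wj != 0.
  apply/eqP => /(congr1 (mcoeff U_(l))); rewrite mcoeffB !coefT eqxx (negbTE il).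
  by rewrite mcoeff0 mulr1 mulr0 sub0r => /eqP; rewrite oppr_eq0 (negbTE fi0).
have wS : (msize wl <= 2)%N /\ (msize wj <= 2)%N.
  have sz a c : (msize (c%:MP * T a : S) <= 2)%N.
    by rewrite mul_mpolyC (leq_trans (msizeZ_le _ _)) // msizeX mdeg1.
  by split; rewrite (leq_trans (msizeD_le _ _)) // geq_max msizeN !sz.
exists w; split; first by exists l; rewrite wlE.
rewrite !sum3 wiE wjE wlE; split; first by rewrite /wi /wj /wl; ring.
split; first by rewrite /wi /wj /wl; ring.
move=> z; rewrite !sum3 => zf zT.
have zjl : z j * wl = z l * wj.
  apply/eqP; rewrite -subr_eq0; apply/eqP.
  transitivity ((f i)%:MP * (z i * T i + z j * T j + z l * T l)
    - T i * (z i * (f i)%:MP + z j * (f j)%:MP + z l * (f l)%:MP)).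
    by rewrite /wl /wj; ring.
  by rewrite zf zT !mulr0 subr0.
have fS : factorial_ring S := @mpoly_factorial A 3 A_factorial.
have [g [a' [b' [g0 zE wE eucl]]]] := reduced_fraction fS (z l) wl0.
(* b' is the denominator of z l / wl in reduced form *)
have b'wj : divides b' wj.
  apply: eucl; exists (z j); apply: (mulfI g0).
  by rewrite mulrCA -zE mulrC -zjl wE; ring.
have [v b'v] : divides b' 1.
  have b'0 : b' != 0 by apply: contraNneq wl0 => E; rewrite wE E mulr0.
  have [q qE] := b'wj.
  have q0 : q != 0 by apply: contraNneq wj0 => E; rewrite qE E mul0r.
  have [s1|s1] := leqP (msize b') 1.
    have bC := msize1_polyC s1; set be := b'@_0%MM in bC.
    have /divides_mpolyC wl_be : divides be%:MP wl.
      by rewrite -bC wE; apply: divides_mull; apply: divides_refl.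
    have /divides_mpolyC wj_be : divides be%:MP wj by rewrite -bC.
    have [x xE] : divides be 1.
      apply: f_coprime => a; have /or3P[/eqP->|/eqP->|/eqP->] := ord3_cover a ij il jl.
      - have := wl_be U_(j)%MM; rewrite mcoeffB !coefT eqxx (negbTE ij).
        by rewrite mulr1 mulr0 subr0.
      - have := wl_be U_(i)%MM; rewrite mcoeffB !coefT eqxx eq_sym (negbTE ij).
        by rewrite mulr1 mulr0 sub0r => -[x xE]; exists (- x); rewrite mulNr -xE opprK.
      - have := wj_be U_(i)%MM; rewrite mcoeffB !coefT eqxx eq_sym (negbTE il).
        by rewrite mulr1 mulr0 subr0.
    by exists x%:MP; rewrite bC -mpolyCM -xE.
  (* otherwise the cofactors of b' in wl and wj are constants *)
  have const y : y != 0 -> (msize (y * b') <= 2)%N -> y = (y@_0%MM)%:MP.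
    move=> y0; rewrite msizeM // => sy; apply: msize1_polyC.
    by move: sy s1; lia.
  have gC : g = (g@_0%MM)%:MP by apply: const => //; rewrite -wE; case: wS.
  have qC : q = (q@_0%MM)%:MP by apply: const => //; rewrite -qE; case: wS.
  have := congr1 (mcoeff U_(l)) wE; rewrite mcoeffB !coefT (negbTE jl) (negbTE il).
  rewrite !mulr0 subr0 gC mcoeffCM => /esym/eqP; rewrite mulf_eq0 => /orP[/eqP gz|/eqP bz].
    by case/eqP: g0; rewrite gC gz mpolyC0.
  have := congr1 (mcoeff U_(l)) qE; rewrite mcoeffB !coefT eqxx (negbTE il).
  rewrite mulr0 mulr1 sub0r qC mcoeffCM bz mulr0 => /eqP.
  by rewrite oppr_eq0 (negbTE fi0).
pose u := a' * v.
have zl : z l = u * wl.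
  transitivity (g * a' * (v * b')); first by rewrite -b'v mulr1.
  by rewrite wE /u; ring.
have zj : z j = u * wj.
  by apply: (mulIf wl0); rewrite zjl zl; ring.
have zi : z i = u * wi.
  have fi0' : (f i)%:MP != 0 :> S by rewrite mpolyC_eq0.
  apply: (mulIf fi0'); apply/eqP; rewrite -subr_eq0; apply/eqP.
  rewrite -[RHS]zf zj zl /wi /wj /wl; ring.
exists u => a; have /or3P[/eqP->|/eqP->|/eqP->] := ord3_cover a ij il jl.
- by rewrite wiE.
- by rewrite wjE.
- by rewrite wlE.
Qed.

End LinearTypeCore.

(** * Elimination of a variable by a syzygy *)

Lemma ord3_third (j l : 'I_3) : exists i : 'I_3, i != j /\ i != l.
Proof.
pose o i (hi : (i < 3)%N) := Ordinal hi.
by move: j l => [[|[|[|//]]] ?] [[|[|[|//]]] ?]; first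
  [by exists (o 0%N isT) | by exists (o 1%N isT) | by exists (o 2%N isT)].
Qed.

Lemma mmap_id n (C : comNzRingType) (G : {mpoly C[n]}) :
  mmap (@mpolyC n C) (fun i => 'X_i) G = G.
Proof.
rewrite -[RHS]/(idfun G); apply: mpoly_hom_ext => [c|i] /=; first by rewrite mmapC.
by rewrite mmap_XU.
Qed.

Section LinearTypeLocal.
Variable A : idomainType.
Hypothesis A_factorial : factorial_ring A.
Local Notation S := {mpoly A[3]}.
Variable f : 'I_3 -> A.
Implicit Types (F G H : S).
Local Notation T i := ('X_i : S).
Local Notation L := (sym_ideal f).

(** The map onto the Rees algebra of (f) in terms of three variables. *)
Definition rees3 : S -> {poly A} := mmap polyC (fun i => (f i)%:P * 'X).
HB.instance Definition _ := GRing.RMorphism.copy rees3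
  (mmap polyC (fun i => (f i)%:P * 'X)).

Lemma meval_map n (C B : comNzRingType) (h : {rmorphism C -> B}) (x : 'I_n -> C)
    (G : {mpoly C[n]}) : mmap h (fun i => h (x i)) G = h G.@[x].
Proof.
rewrite -[RHS]/((h \o meval x) G); apply: mpoly_hom_ext => [c|i] /=.
  by rewrite mmapC mevalC.
by rewrite mmap_XU mevalXU.
Qed.

Lemma rees3_homog e G : G \is e.-homog -> rees3 G = (G.@[f])%:P * 'X^e.
Proof. by move=> Ge; rewrite /rees3 (mmap_scale_homog _ _ _ Ge) meval_map. Qed.

Lemma rees3_component F e : rees3 F = 0 ->
  (pihomog [measure of mdeg] e F).@[f] = 0.
Proof.
have [eF F0|eF _] := ltnP e (msize F); last first.
  rewrite (_ : pihomog _ e F = 0) ?meval0 // pihomogE big1_seq // => mm /andP[/eqP me].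
  by move/msize_mdeg_lt; rewrite me ltnNge eF.
have := congr1 (fun q : {poly A} => q`_e) F0.
rewrite coef0 {1}(pihomog_partitionE (leqnn (msize F))) rmorph_sum coef_sum /=.
rewrite (bigD1 (Ordinal eF)) //= big1 ?addr0 => [|i ie].
  by rewrite (rees3_homog (pihomogP _ _ _)) coefCM coefXn eqxx mulr1.
rewrite (rees3_homog (pihomogP _ _ _)) coefCM coefXn.
rewrite (_ : (e == i :> nat) = false) ?mulr0 //; apply: contraNF ie => /eqP ei.
by apply/eqP/val_inj.
Qed.

(** As a and b are coprime, b is a nonzero divisor modulo b T i - a T j. *)
Lemma cancel_linear_form (a b : A) i j (F Q : S) N : i != j -> b != 0 ->
  (forall r, divides b (r * a) -> divides b r) ->
  (b%:MP) ^+ N * F = (b%:MP * T i - a%:MP * T j) * Q ->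
  exists Q', F = (b%:MP * T i - a%:MP * T j) * Q'.
Proof.
move=> ij b0 ba; have bS : b%:MP != 0 :> S by rewrite mpolyC_eq0.
elim: N Q => [|N IHN] Q; first by rewrite expr0 mul1r => ->; exists Q.
rewrite exprS => E.
have [Q' QE] : divides b%:MP Q.
  apply/divides_mpolyC => mm; apply: ba.
  have /divides_mpolyC/(_ (mm + U_(j))%MM) : divides b%:MP (a%:MP * (Q * T j)).
    exists (T i * Q - b%:MP ^+ N * F); apply/eqP; rewrite -subr_eq0; apply/eqP.
    transitivity (b%:MP * b%:MP ^+ N * F - (b%:MP * T i - a%:MP * T j) * Q).
      by ring.
    by rewrite E subrr.
  by rewrite mcoeffCM addmC mcoeffMX mulrC.
apply: (IHN Q'); apply: (mulfI bS); rewrite mulrA E QE; ring.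
Qed.

Hypothesis f_neq0 : exists i, f i != 0.

(** Where an entry c l of a syzygy is invertible, T l is eliminated, and modulo
    the Koszul-type relation b T i = a T j between the two other generators a
    form that vanishes at f is zero. *)
Lemma syzygy_entry_homog (c : 'I_3 -> A) l e G : \sum_i c i * f i = 0 ->
  G \is e.-homog -> G.@[f] = 0 -> L ((c l)%:MP ^+ e * G).
Proof.
move=> cf Ge G0; have iL := sym_idealP f; have [L0 LD LM] := iL.
have [cl0|cl0] := eqVneq (c l) 0.
  rewrite cl0 mpolyC0; case: e Ge => [|e] Ge; last by rewrite expr0n mul0r.
  rewrite (_ : G = 0) ?mulr0 //; apply/mpolyP => mm; rewrite mcoeff0.
  have GC : G = (G@_0%MM)%:MP.
    apply: msize1_polyC; rewrite msizeE; apply/bigmax_leqP_seq => m' mG _.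
    by move/dhomogP: Ge => /(_ m' mG) /= ->.
  by move: G0; rewrite {1}GC mevalC => E; rewrite GC E mpolyC0 mcoeff0.
have [j [jl fj0]] : exists j, j != l /\ f j != 0.
  apply: contrapT => noj; have fj j : j != l -> f j = 0.
    by move=> jl; apply/eqP/negPn/negP => fj; apply: noj; exists j.
  have [i fi] := f_neq0; have il : i = l.
    by apply/eqP/negPn/negP => /fj E; rewrite E eqxx in fi.
  move: cf; rewrite (bigD1 l) //= big1 ?addr0 => [|j jl]; last by rewrite fj ?mulr0.
  by move/eqP; rewrite mulf_eq0 (negbTE cl0) -il (negbTE fi).
have [i [ij il]] := ord3_third j l.
have Eil : (l == i) = false by rewrite eq_sym (negbTE il).
have Ejl : (l == j) = false by rewrite eq_sym (negbTE jl).
have Eij : (j == i) = false by rewrite eq_sym (negbTE ij).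
(* c l times the variables, after the elimination of T l *)
pose u1 a : S := if a == i then T i * (c l)%:MP else if a == j then T j * (c l)%:MP
  else - ((c i)%:MP * T i + (c j)%:MP * T j).
pose G1 := mmap (@mpolyC 3 A) u1 G.
have LG1 : L ((c l)%:MP ^+ e * G - G1).
  rewrite mulrC -{1}(mmap_id G) -(mmap_scale_homog _ _ _ Ge); apply: mmap_congr => // a.
  have /or3P[/eqP->|/eqP->|/eqP->] := ord3_cover a ij il jl; rewrite /u1 ?eqxx ?Eij ?Eil ?Ejl ?subrr //.
  exists (fun a => (c a)%:MP); split.
    by under eq_bigr do rewrite -mpolyCM; rewrite -rmorph_sum cf rmorph0.
  by rewrite (sum_ord3 _ ij il jl); ring.
suff LG : L G1.
  by rewrite -(subrK G1 (_ * G)); apply: LD.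
have [g [al [be [g0 fiE fjE eucl]]]] := reduced_fraction A_factorial (f i) fj0.
have be0 : be != 0 by apply: contraNneq fj0 => E; rewrite fjE E mulr0.
pose Pi : S := be%:MP * T i - al%:MP * T j.
have LPi : L Pi.
  exists (fun a => if a == i then be%:MP else if a == j then - al%:MP else 0).
  rewrite !(sum_ord3 _ ij il jl) !eqxx Eij Eil Ejl !mul0r !addr0; split.
    by rewrite mulNr -!mpolyCM fiE fjE [be * _]mulrCA [al * _]mulrCA [al * be]mulrC subrr.
  by rewrite mulNr.
suff [Q' ->] : exists Q, G1 = Pi * Q by rewrite mulrC; apply: LM.
(* c l times f, divided by g; modulo Pi, be times u1 is T j times this vector *)
pose val a : A := if a == i then c l * al else if a == j then c l * be
  else - (c i * al + c j * be).
have iPi : is_ideal [set x | exists Q, x = Pi * Q].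
  split=> /= [|x y [p ->] [q ->]|r x [p ->]]; first by exists 0; rewrite mulr0.
    by exists (p + q); rewrite mulrDr.
  by exists (r * p); rewrite mulrCA.
have valE : G.@[val] = 0.
  have ge0 : g ^+ e != 0 by rewrite expf_eq0 (negbTE g0) andbF.
  apply: (mulIf ge0); rewrite mul0r.
  rewrite -[LHS](mmap_scale_homog (GRing.RMorphism.clone _ _ idfun _) _ _ Ge).
  have -> : (fun a => val a * g) = (fun a => f a * c l).
    apply/funext => a.
    have /or3P[/eqP->|/eqP->|/eqP->] := ord3_cover a ij il jl; rewrite /val ?eqxx ?Eij ?Eil ?Ejl.
    - by rewrite fiE; ring.
    - by rewrite fjE; ring.
    - move: cf; rewrite (sum_ord3 _ ij il jl) => /eqP; rewrite addrC addr_eq0 => /eqP cf.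
      by rewrite mulrC [f l * _]mulrC cf fiE fjE; ring.
  by rewrite (mmap_scale_homog _ _ _ Ge) [X in X * _]G0 mul0r.
have [Q GQ] : [set x | exists Q, x = Pi * Q] (G1 * be%:MP ^+ e).
  have <- : mmap (@mpolyC 3 A) (fun a => u1 a * be%:MP) G - mmap (@mpolyC 3 A) (fun a => (val a)%:MP * T j) G
      = G1 * be%:MP ^+ e.
    by rewrite !(mmap_scale_homog _ _ _ Ge) meval_map valE rmorph0 mul0r subr0.
  apply: mmap_congr => // a /=.
  have /or3P[/eqP->|/eqP->|/eqP->] := ord3_cover a ij il jl; rewrite /u1 /val ?eqxx ?Eij ?Eil ?Ejl.
  - by exists (c l)%:MP; rewrite mpolyCM /Pi; ring.
  - by exists 0; rewrite mpolyCM; ring.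
  - by exists (- (c i)%:MP); rewrite mpolyCN mpolyCD !mpolyCM /Pi; ring.
by apply: (@cancel_linear_form al be i j G1 Q e ij be0 eucl); rewrite mulrC.
Qed.

(** On the open set where some entry of a syzygy is invertible, (f) is of linear
    type. *)
Lemma syzygy_entry_power F (c : 'I_3 -> A) l : rees3 F = 0 ->
  \sum_i c i * f i = 0 -> exists N, L ((c l)%:MP ^+ N * F).
Proof.
move=> F0 cf; exists (msize F); have iL := sym_idealP f.
rewrite {2}(pihomog_partitionE (leqnn (msize F))) mulr_sumr.
apply: ideal_sum => // e _.
rewrite (_ : _ ^+ _ = (c l)%:MP ^+ (msize F - e) * (c l)%:MP ^+ e); last first.
  by rewrite -exprD subnK // ltnW.
rewrite -mulrA.
have [_ _ LM] := iL; apply: LM; apply: syzygy_entry_homog cf (pihomogP _ _ _) _.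
exact: rees3_component.
Qed.

End LinearTypeLocal.

(** * Depth of the symmetric algebra at the origin *)

Section DepthStep.
Variable A : idomainType.
Hypothesis A_factorial : factorial_ring A.
Local Notation S := {mpoly A[3]}.
Variable f : 'I_3 -> A.
Hypothesis f_coprime : forall b, (forall i, divides b (f i)) -> divides b 1.
Hypothesis f_neq0 : exists i, f i != 0.
Local Notation L := (sym_ideal f).
Variables x0 x1 x2 : S.
Hypothesis x0_neq0 : x0 != 0.
Hypothesis reg1 : forall r, divides x0 (x1 * r) -> divides x0 r.
Hypothesis reg2 : forall r, (exists a b, x2 * r = x0 * a + x1 * b) ->
  exists a b, r = x0 * a + x1 * b.

(** The symmetric algebra S / L has positive depth at the origin, since it is
    resolved by S, the syzygies of f and a free module, of depths 3, at least 2
    and 3. Concretely, the syzygies z0, z1, z2 over x0 F, x1 F, x2 F differ by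
    multiples of the cross product of f and T, and the cocycle of these
    differences is corrected by exactness of the Koszul complex on x0, x1, x2. *)
Lemma depth_step (F : S) : L (x0 * F) -> L (x1 * F) -> L (x2 * F) -> L F.
Proof.
move=> [z0 [z0f z0T]] [z1 [z1f z1T]] [z2 [z2f z2T]].
have [w [[i0 wi0] [wf [wT wP]]]] := second_syzygy A_factorial f_coprime f_neq0.
have diff (a b : S) (z y : 'I_3 -> S) :
    \sum_i z i * (f i)%:MP = 0 -> \sum_i y i * (f i)%:MP = 0 ->
    a * F = \sum_i z i * 'X_i -> b * F = \sum_i y i * 'X_i ->
    exists u, forall i, b * z i - a * y i = u * w i.
  move=> zf yf zT yT; apply: (wP (fun i => b * z i - a * y i)).
    under eq_bigr do rewrite mulrBl -!mulrA; rewrite sumrB -!mulr_sumr zf yf.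
    by rewrite !mulr0 subr0.
  under eq_bigr do rewrite mulrBl -!mulrA; rewrite sumrB -!mulr_sumr -zT -yT.
  by rewrite mulrCA subrr.
have [u01 u01E] := diff _ _ _ _ z0f z1f z0T z1T.
have [u02 u02E] := diff _ _ _ _ z0f z2f z0T z2T.
have [u12 u12E] := diff _ _ _ _ z1f z2f z1T z2T.
have cocycle : x2 * u01 = x0 * (- u12) + x1 * u02.
  apply: (mulIf wi0); rewrite mulrDl -!mulrA mulNr -u01E -u02E -u12E; ring.
have [|v1 [v0 u01v]] := reg2 (r := u01); first by exists (- u12), u02.
pose y0 i := z0 i - v0 * w i; pose y1 i := z1 i + v1 * w i.
have y01 i : x1 * y0 i = x0 * y1 i.
  apply/eqP; rewrite -subr_eq0; apply/eqP.
  transitivity ((x1 * z0 i - x0 * z1 i) - u01 * w i); first by rewrite u01v /y0 /y1; ring.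
  by rewrite u01E subrr.
have Y i : exists z, y0 i = z * x0.
  by apply: reg1; exists (y1 i); rewrite y01 mulrC.
have [z zE] := choice Y; exists z; split.
  apply: (mulfI x0_neq0); rewrite mulr0 mulr_sumr.
  under eq_bigr do rewrite mulrA [x0 * _]mulrC -zE mulrBl -mulrA.
  by rewrite sumrB -mulr_sumr z0f wf mulr0 subr0.
apply: (mulfI x0_neq0); rewrite z0T mulr_sumr.
under [RHS]eq_bigr do rewrite mulrA [x0 * _]mulrC -zE mulrBl -mulrA.
by rewrite sumrB -mulr_sumr wT mulr0 subr0.
Qed.

End DepthStep.

Section CoordinateRegular.
Variables (k : fieldType) (d n : nat).
Local Notation R := {mpoly k[d]}.
Local Notation S := {mpoly R[n]}.
Variable Z : pred 'I_d.

Definition kill_vars : R -> R :=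
  mmap (@mpolyC d k) (fun i => if Z i then 0 else 'X_i).
HB.instance Definition _ := GRing.RMorphism.copy kill_vars
  (mmap (@mpolyC d k) (fun i => if Z i then 0 else 'X_i)).

Lemma kill_varsX i : kill_vars 'X_i = if Z i then 0 else 'X_i.
Proof. by rewrite /kill_vars mmap_XU. Qed.

Lemma kill_varsE (p : R) : exists g : 'I_d -> R,
  p = kill_vars p + \sum_(i | Z i) 'X_i * g i.
Proof.
elim/mpoly_closed_ind: p => [c|i|p q [g pE] [h qE]|p q [g pE] [h qE]].
- exists (fun _ => 0); rewrite /kill_vars mmapC big1 ?addr0 // => i _.
  by rewrite mulr0.
- rewrite kill_varsX; case: ifP => Zi.
    exists (fun j => (j == i)%:R); rewrite (bigD1 i) //= eqxx mulr1 add0r big1 ?addr0 //.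
    by move=> j /andP[_ /negbTE->]; rewrite mulr0.
  by exists (fun _ => 0); rewrite big1 ?addr0 // => j _; rewrite mulr0.
- exists (fun i => g i + h i); rewrite rmorphD /= {1}pE {1}qE addrACA -big_split.
  by congr (_ + _); apply: eq_bigr => i _; rewrite mulrDr.
- exists (fun i => g i * q + kill_vars p * h i); rewrite rmorphM /=.
  rewrite (_ : \sum_(i | Z i) _ = (\sum_(i | Z i) 'X_i * g i) * q +
                                  kill_vars p * \sum_(i | Z i) 'X_i * h i).
    have -> : \sum_(i | Z i) 'X_i * g i = p - kill_vars p by rewrite {1}pE addrC addKr.
    have -> : \sum_(i | Z i) 'X_i * h i = q - kill_vars q by rewrite {1}qE addrC addKr.
    by ring.
  rewrite mulr_suml mulr_sumr -big_split; apply: eq_bigr => i _ /=.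
  by rewrite mulrDr mulrA mulrCA.
Qed.

Lemma map_kill_varsE (F : S) : exists G : 'I_d -> S,
  F = map_mpoly kill_vars F + \sum_(i | Z i) ('X_i)%:MP * G i.
Proof.
have H mm : exists g : 'I_d -> R,
    F@_mm = kill_vars F@_mm + \sum_(i | Z i) 'X_i * g i by apply: kill_varsE.
have [g gE] := choice H.
exists (fun i => \sum_(mm <- msupp F) g mm i *: 'X_[mm]).
under eq_bigr do rewrite mulr_sumr; rewrite exchange_big /=.
rewrite {1}(mpolyE F) [X in map_mpoly _ X](mpolyE F) rmorph_sum -big_split /=.
apply: eq_bigr => mm _; rewrite map_mpolyZ map_mpolyX {1}gE scalerDl; congr (_ + _).
rewrite scaler_suml; apply: eq_bigr => i _.
by rewrite mul_mpolyC scalerA.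
Qed.

Lemma map_kill_varsX i : map_mpoly kill_vars ('X_i)%:MP = (if Z i then 0 else ('X_i)%:MP) :> S.
Proof. by rewrite map_mpolyC /= kill_varsX; case: ifP; rewrite ?mpolyC0. Qed.

(** The variables in Z are killed by a map to a domain in which the other ones
    remain nonzero. *)
Lemma kill_vars_regular (i : 'I_d) (F : S) (G : 'I_d -> S) : ~~ Z i ->
  ('X_i)%:MP * F = \sum_(j | Z j) ('X_j)%:MP * G j ->
  exists G', F = \sum_(j | Z j) ('X_j)%:MP * G' j.
Proof.
move=> Zi E; have [G' FE] := map_kill_varsE F; exists G'.
suff F0 : map_mpoly kill_vars F = 0 by rewrite F0 add0r in FE.
have xi0 : ('X_i)%:MP != 0 :> S by rewrite mpolyC_eq0 -msize_poly_eq0 msizeX.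
apply: (mulfI xi0); rewrite mulr0.
have := congr1 (map_mpoly kill_vars) E.
rewrite rmorphM rmorph_sum /= map_kill_varsX (negbTE Zi) => ->.
by rewrite big1 // => j Zj; rewrite rmorphM /= map_kill_varsX Zj mul0r.
Qed.

End CoordinateRegular.

Lemma sum_pred1_mul (C : comNzRingType) n (x G : 'I_n -> C) i :
  \sum_(j | pred1 i j) x j * G j = x i * G i.
Proof. exact: big_pred1_eq. Qed.

Lemma sum_pred2_mul (C : comNzRingType) n (x G : 'I_n -> C) i j : i != j ->
  \sum_(l | pred2 i j l) x l * G l = x i * G i + x j * G j.
Proof.
move=> ij; rewrite (bigD1 i) /= ?eqxx // (bigD1 j) /= ?eqxx ?orbT 1?eq_sym //.
rewrite big1 ?addr0 // => l.
by case/andP=> /andP[/orP[/eqP->|/eqP->]]; rewrite ?eqxx.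
Qed.

Section LinearCore.
Variable k : fieldType.
Local Notation R := {mpoly k[3]}.
Local Notation S := {mpoly R[3]}.
Variable f : 'I_3 -> R.
Hypothesis f_coprime : forall b, (forall i, divides b (f i)) -> divides b 1.
Hypothesis f_neq0 : exists i, f i != 0.
Local Notation L := (sym_ideal f).

Let o0 : 'I_3 := Ordinal (isT : 0 < 3)%N.
Let o1 : 'I_3 := Ordinal (isT : 1 < 3)%N.
Let o2 : 'I_3 := Ordinal (isT : 2 < 3)%N.
Let x (i : 'I_3) : S := ('X_i)%:MP.

Lemma coordinate_depth_step (F : S) : (forall i, L (x i * F)) -> L F.
Proof.
move=> xF; have R_factorial := @mpoly_field_factorial k 3.
apply: (@depth_step R R_factorial f f_coprime f_neq0 (x o0) (x o1) (x o2)) => //.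
- by rewrite mpolyC_eq0 -msize_poly_eq0 msizeX.
- move=> r [c cE].
  have [|G' rE] := @kill_vars_regular k 3 3 (pred1 o0) o1 r (fun _ => c) isT.
    by rewrite (sum_pred1_mul x) [LHS]cE; apply: mulrC.
  by exists (G' o0); rewrite rE (sum_pred1_mul x); apply: mulrC.
- move=> r [a [b E]].
  have [|G' rE] := @kill_vars_regular k 3 3 (pred2 o0 o1) o2 r
      (fun j => if j == o0 then a else b) isT.
    by rewrite (sum_pred2_mul x).
  by exists (G' o0), (G' o1); rewrite rE (sum_pred2_mul x).
Qed.

(** The powers of the entries of syzygies that multiply F into L can be replaced by
    powers of the variables, which are then removed one factor at a time by
    coordinate_depth_step. *)
Lemma linear_type_core : syz_primary f -> forall F : S, rees3 f F = 0 -> L F.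
Proof.
move=> prim F F0; have iL := sym_idealP f; have [L0 LD LM] := iL.
have power i : exists M, L (x i ^+ M * F).
  have [l lS] := prim i.
  pose Q : set R := [set r | exists n, L (r%:MP ^+ n * F)].
  have iQ : is_ideal Q.
    exact: (ideal_preimage (@mpolyC 3 R) (radical_colon_ideal F iL)).
  have [|n] := ideal_gen_min iQ _ lS.
    move=> _ [c [j [cf ->]]].
    exact: (syzygy_entry_power (@mpoly_field_factorial k 3) f_neq0 j F0 cf).
  by rewrite rmorphXn -exprM; exists (l * n)%N.
have [M ME] := choice power; pose N := (\sum_i M i)%N.
have xN i e : (N <= e)%N -> L (x i ^+ e * F).
  move=> Ne; have Me : (M i <= e)%N by apply: leq_trans Ne; rewrite /N (bigD1 i) //= leq_addr.
  by rewrite -(subnK Me) exprD -mulrA; apply: LM.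
(* induction on the distance of the exponents e from N, where xN applies *)
have descent n : forall e : 'I_3 -> nat, (\sum_i (N - e i) <= n)%N ->
    L ((\prod_i x i ^+ e i) * F).
  elim: n => [|n IHn] e en; have [[i Ni]|small] := EM (exists i, (N <= e i)%N).
  - by rewrite (bigD1 i) //= mulrAC mulrC; apply: LM; apply: xN.
  - move: en; rewrite leqn0 sum_nat_eq0 => /forallP/(_ o0) /=.
    by rewrite subn_eq0 => N0; case: small; exists o0.
  - by rewrite (bigD1 i) //= mulrAC mulrC; apply: LM; apply: xN.
  - apply: coordinate_depth_step => i; pose e' j := (e j + (j == i))%N.
    have -> : x i * (\prod_j x j ^+ e j * F) = (\prod_j x j ^+ e' j) * F.
      rewrite mulrA; congr (_ * F); rewrite (bigD1 i) //= [in RHS](bigD1 i) //=.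
      rewrite /e' eqxx addn1 exprS mulrA; congr (_ * _).
      by apply: eq_bigr => j /negbTE->; rewrite addn0.
    apply: IHn; rewrite -ltnS; apply: leq_trans en.
    rewrite (bigD1 i) //= [X in (_ < X)%N](bigD1 i) //= /e' eqxx addn1.
    rewrite -addSn leq_add //.
      have : (e i < N)%N by rewrite ltnNge; apply/negP => H; apply: small; exists i.
      by lia.
    by apply: leq_sum => j /negbTE->; rewrite addn0.
have := descent _ (fun _ => 0%N) (leqnn _).
by rewrite big1 ?mul1r // => i _; rewrite expr0.
Qed.

End LinearCore.

(** * The symmetric algebra of an ideal *)

Module SymmetricAlgebra.
Import finmap monalg mpoly.
Local Open Scope fset_scope.
Local Open Scope ring_scope.

Section SymHom.
Variables (A C : comNzRingType) (J : set A).
Variables (iota : {rmorphism A -> C}) (g : symvar J -> C).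

Definition cmon_eval (u : {cmonom (symvar J)}) : C :=
  \prod_(a <- finsupp u) g a ^+ u a.

Lemma cmon_evalE (e : {fset (symvar J)}) (u : {cmonom (symvar J)}) :
  finsupp u `<=` e -> cmon_eval u = \prod_(a <- e) g a ^+ u a.
Proof.
move=> ue; rewrite /cmon_eval (big_fset_incl _ ue) // => a _ au.
by move: au; rewrite memNfinsupp => /eqP->; rewrite expr0.
Qed.

Lemma cmon_eval_mmorphism : monalg.mmorphism cmon_eval.
Proof.
split=> [u v|]; last by rewrite /cmon_eval mdom1 big_seq_fset0.
rewrite (@cmon_evalE _ u (fsubsetUl _ (finsupp v))) (@cmon_evalE _ v (fsubsetUr (finsupp u) _)).
rewrite /cmon_eval mdomD -big_split; apply: eq_bigr => a _.
by rewrite cmM exprD.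
Qed.

HB.instance Definition _ := monalg.isMultiplicative.Build _ C cmon_eval
  cmon_eval_mmorphism.

(** The universal property of the free algebra on the elements of J. *)
Definition sym_hom : symfree J -> C := monalg.mmap iota cmon_eval.
HB.instance Definition _ := GRing.RMorphism.copy sym_hom (monalg.mmap iota cmon_eval).

Definition symC (c : A) : symfree J := monalg.mkmalgU (onecm _) c.

Lemma sym_homC c : sym_hom (symC c) = iota c.
Proof. by rewrite /sym_hom monalg.mmapC. Qed.

Lemma sym_homT a : sym_hom (symT a) = g a.
Proof.
by rewrite /sym_hom monalg.mmapU /= rmorph1 mul1r /cmon_eval mdomU big_seq_fset1 cmUU expr1.
Qed.

Lemma sym_homZ c F : sym_hom (c *: F) = iota c * sym_hom F.
Proof. by rewrite /sym_hom monalg.mmapZ. Qed.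

End SymHom.

Section SymGenerators.
Variables (A : comNzRingType) (J : set A).
Local Notation Sym := (symfree J).
Local Notation symC := (@symC A J).

Lemma symC_zmod : zmod_morphism symC.
Proof. exact: raddfB. Qed.
Lemma symC_monoid : monoid_morphism symC.
Proof. split; [exact: monalg.mpolyC1E | exact: monalg.mpolyCM]. Qed.
HB.instance Definition _ := GRing.isZmodMorphism.Build A Sym symC symC_zmod.
HB.instance Definition _ := GRing.isMonoidMorphism.Build A Sym symC symC_monoid.

Lemma symZ c (F : Sym) : c *: F = symC c * F.
Proof. by rewrite /symC monalg.mul_malgC. Qed.

Lemma sym_closed_ind (P : Sym -> Prop) :
  (forall c, P (symC c)) -> (forall a, P (symT a)) ->
  (forall F G, P F -> P G -> P (F + G)) -> (forall F G, P F -> P G -> P (F * G)) ->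
  forall F, P F.
Proof.
move=> PC PT PD PM F; have P0 : P 0 by rewrite -(rmorph0 symC); apply: PC.
have Pmon (u : {cmonom (symvar J)}) : P (monalg.mkmalgU u 1).
  have [n] := ubnP (monalg.mdeg u); elim: n u => // n IHn u un.
  have [E|[a au]] := fset_0Vmem (finsupp u).
    have -> : u = onecm _.
      by apply/eqP/cmP => a; rewrite onecmE; apply/eqP; rewrite -memNfinsupp E.
    exact: (PC 1).
  have uE : u = mulcm (ucm a) (divcm u (ucm a)).
    apply/eqP/cmP => b; rewrite mulcmE divcmE ucmE; case: eqP => [<-|_].
      by rewrite subnKC // lt0n -memNfinsupp negbK.
    by rewrite subn0.
  have -> : monalg.mkmalgU u 1 = symT a * monalg.mkmalgU (divcm u (ucm a)) 1 :> Sym.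
    by rewrite {1}uE /symT monalg.malgM_def monalg.fgmulUU mulr1.
  apply: PM => //; apply: IHn; rewrite -ltnS; apply: leq_trans un.
  by rewrite {2}uE [monalg.mdeg (mulcm _ _)]monalg.mdegM mdegU.
rewrite (monalg.monalgE F); apply: (big_ind P) => // u _.
have -> : monalg.mkmalgU u (monalg.mcoeff u F) = symC (monalg.mcoeff u F) * monalg.mkmalgU u 1.
  rewrite /symC monalg.malgM_def monalg.fgmulUU mulr1.
  exact: (congr1 (fun v => monalg.mkmalgU v _) (esym (mul0cm u))).
exact: PM.
Qed.

End SymGenerators.

Lemma sub_split (V : comNzRingType) (x p q b s : V) :
  x - (p + q) = (x - b - s) + ((b - p) + (s - q)).
Proof. by ring. Qed.

Lemma sub_mul_split (V : comNzRingType) (x y x' y' : V) :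
  x * y - x' * y' = y * (x - x') + x' * (y - y').
Proof. by ring. Qed.

Lemma sub_add_split (V : comNzRingType) (x y x' y' : V) :
  x + y - (x' + y') = (x - x') + (y - y').
Proof. by rewrite opprD addrACA. Qed.

Section SymRelations.
Variables (A : comNzRingType) (n : nat) (f : 'I_n -> A).
Local Notation J := (family_ideal f).
Local Notation Sym := (symfree J).
Local Notation rel := (ideal_gen (sym_relations J)).
Local Notation symC := (@symC A J).

Definition symgen (a : A) (Ja : J a) : symvar J := exist _ a (introT (asboolP _) Ja).
Definition sym_f (i : 'I_n) : symvar J := symgen (family_ideal_in f i).

Lemma rel_add (a b c : symvar J) : val c = val a + val b ->
  rel (symT c - symT a - symT b).
Proof. by move=> E; apply: ideal_gen_incl; left; exists a, b, c. Qed.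

Lemma rel_scale r (a c : symvar J) : val c = r * val a ->
  rel (symT c - symC r * symT a).
Proof. by move=> E; rewrite -symZ; apply: ideal_gen_incl; right; exists r, a, c. Qed.

Lemma rel_zero (a : symvar J) : val a = 0 -> rel (symT a).
Proof.
move=> a0; rewrite -[symT a]subr0 -[0](mul0r (symT a)) -(rmorph0 symC).
by apply: rel_scale; rewrite mul0r.
Qed.

(** The additivity and scaling relations, applied along the combination. So the
    variables of the generators f suffice. *)
Lemma rel_combination (c : 'I_n -> A) (a : symvar J) :
  val a = \sum_i c i * f i -> rel (symT a - \sum_i symC (c i) * symT (sym_f i)).
Proof.
have irel := ideal_genP (sym_relations J); have [R0 RD RM] := irel.
elim: (index_enum _) a => [|i s IHs] a; rewrite ?big_nil ?big_cons => E.
  by rewrite subr0; apply: rel_zero.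
have Jb : J (c i * f i) by have [_ _ M] := family_idealP f; apply: M; apply: family_ideal_in.
have Js : J (\sum_(j <- s) c j * f j).
  apply: ideal_sum (family_idealP f) _ => j _.
  by have [_ _ M] := family_idealP f; apply: M; apply: family_ideal_in.
rewrite (sub_split _ _ _ (symT (symgen Jb)) (symT (symgen Js))).
by apply: (RD); [apply: rel_add | apply: RD; [apply: rel_scale | apply: IHs]].
Qed.

Lemma sym_hom_rel (C : comNzRingType) (iota : {rmorphism A -> C}) (g : symvar J -> C) F :
  (forall a b c, val c = val a + val b -> g c = g a + g b) ->
  (forall r a c, val c = r * val a -> g c = iota r * g a) ->
  rel F -> sym_hom iota g F = 0.
Proof.
move=> gD gZ; have iK : is_ideal [set G | sym_hom iota g G = 0].
  split=> [|G H /= G0 H0|r G /= G0]; rewrite /= ?rmorph0 //.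
    by rewrite rmorphD /= G0 H0 addr0.
  by rewrite rmorphM /= G0 mulr0.
have homB G H : sym_hom iota g (G - H) = sym_hom iota g G - sym_hom iota g H.
  exact: (rmorphB (sym_hom iota g)).
have T := sym_homT iota g; pose sub (x y : C) := x - y.
apply: (ideal_gen_min iK) => G /= [[a [b [c [E ->]]]]|[r [a [c [E ->]]]]].
  have {}E : g c - g a - g b = 0 by rewrite (gD _ _ _ E) [g a + _]addrC addrK subrr.
  exact: etrans (etrans (homB _ _) (congr2 sub (etrans (homB _ _) (congr2 sub (T c) (T a))) (T b))) E.
have {}E : g c - iota r * g a = 0 by rewrite (gZ _ _ _ E) subrr.
exact: etrans (etrans (homB _ _)
  (congr2 sub (T c) (etrans (sym_homZ iota g r (symT a)) (congr1 _ (T a))))) E.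
Qed.

Local Notation S := {mpoly A[n]}.

(** The presentation of the symmetric algebra of J by the generators f. *)
Definition sym_pres : mpoly n A -> Sym :=
  mpoly.mmap symC (fun i => symT (sym_f i)).
HB.instance Definition _ := GRing.RMorphism.copy sym_pres
  (mpoly.mmap symC (fun i => symT (sym_f i))).

Lemma sym_pres_onto F : exists G, rel (F - sym_pres G).
Proof.
have irel := ideal_genP (sym_relations J); have [R0 RD RM] := irel.
elim/sym_closed_ind: F => [c|a|F F' [G FG] [G' FG']|F F' [G FG] [G' FG']].
- by exists (mpolyC n c); rewrite /sym_pres mpoly.mmapC subrr.
- have [c cE] : J (val a) by have /asboolP := valP a.
  exists (\sum_i mpolyC n (c i) * mpolyX A U_(i)%MM).
  rewrite rmorph_sum; under eq_bigr do rewrite rmorphM /= {1}/sym_pres mpoly.mmapC /sym_pres mmap_XU.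
  exact: rel_combination.
- exists (G + G'); rewrite (rmorphD sym_pres) sub_add_split; exact: RD _ _ FG FG'.
- exists (G * G'); rewrite (rmorphM sym_pres) sub_mul_split.
  exact: RD _ _ (RM _ _ FG) (RM _ _ FG').
Qed.

(** A syzygy with polynomial entries is a combination, with monomials as
    coefficients, of syzygies over A; the latter express the variable of the
    zero element of J, which is a relation. *)
Lemma sym_pres_rel (z : 'I_n -> mpoly n A) : \sum_i z i * mpolyC n (f i) = 0 ->
  rel (sym_pres (\sum_i z i * mpolyX A U_(i)%MM)).
Proof.
move=> zf; have irel := ideal_genP (sym_relations J); have [R0 RD RM] := irel.
pose K := (\max_i msize (z i))%N.
have zE i : z i = \sum_(u : 'X_{1..n < K}) mpolyC n (z i)@_u * mpolyX A u.
  rewrite {1}(mpolywE (k := K) (p := z i)); last exact: (@leq_bigmax _ (fun i => msize (z i))).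
  by apply: eq_bigr => u _; rewrite mpoly.mul_mpolyC.
have -> : \sum_i z i * mpolyX A U_(i)%MM =
    \sum_(u : 'X_{1..n < K}) mpolyX A u * \sum_i mpolyC n (z i)@_u * mpolyX A U_(i)%MM.
  under [RHS]eq_bigr do rewrite mulr_sumr; rewrite exchange_big; apply: eq_bigr => i _ /=.
  by rewrite {1}zE mulr_suml; apply: eq_bigr => u _; ring.
rewrite rmorph_sum; apply: ideal_sum => // u _; rewrite rmorphM; apply: RM.
rewrite rmorph_sum; under eq_bigr do rewrite rmorphM /= {1}/sym_pres mpoly.mmapC /sym_pres mmap_XU.
have J0 : J 0 by case: (family_idealP f).
have H : rel (symT (symgen J0) - \sum_i symC (z i)@_u * symT (sym_f i)).
  apply: rel_combination => /=; have := congr1 (mpoly.mcoeff u) zf.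
  rewrite mpoly.mcoeff0 raddf_sum /= => zu; apply: etrans (esym zu) (eq_bigr _ _) => i _.
  by rewrite mulrC mpoly.mcoeffCM mulrC.
have H0 := rel_zero (erefl (val (symgen J0))).
by have := idealB irel H0 H; rewrite opprB addrC subrK.
Qed.

Lemma rees_map_hom F : rees_map F = sym_hom polyC (fun a : symvar J => val a *: 'X) F.
Proof. by []. Qed.

Lemma rel_rees F : rel F -> rees_map F = 0.
Proof.
rewrite rees_map_hom; apply: sym_hom_rel => [a b c ->|r a c ->].
  by rewrite scalerDl.
by rewrite -scalerA -mul_polyC.
Qed.

Lemma rees_sym_pres G :
  rees_map (sym_pres G) = mpoly.mmap polyC (fun i => (f i)%:P * 'X) G.
Proof.
rewrite rees_map_hom -[LHS]/((sym_hom polyC (fun a : symvar J => val a *: 'X) \o sym_pres) G).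
apply: mpoly_hom_ext => [c|i] /=.
  by rewrite /sym_pres !mpoly.mmapC sym_homC.
by rewrite /sym_pres !mmap_XU sym_homT mul_polyC.
Qed.

End SymRelations.
End SymmetricAlgebra.

(** * Linear type *)
Module LinearType.
Import SymmetricAlgebra.

(** Both algebras are quotients of a polynomial ring in three variables, where the
    comparison is linear_type_core. *)
Lemma syz_primary_linear_type (k : fieldType) (f : 'I_3 -> {mpoly k[3]}) :
  (forall b, (forall i, divides b (f i)) -> divides b 1) ->
  (exists i, f i != 0) -> syz_primary f -> linear_type (family_ideal f).
Proof.
move=> fco f0 fS F; split=> [F0|]; last exact: rel_rees.
have [G FG] := sym_pres_onto F.
have [R0 RD RM] := ideal_genP (sym_relations (family_ideal f)).
have G0 : rees3 f G = 0.
  rewrite /rees3 -rees_sym_pres.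
  have E : rees_map (F - sym_pres f G) = rees_map F - rees_map (sym_pres f G).
    exact: (rmorphB (sym_hom polyC (fun a : symvar _ => val a *: 'X))).
  by apply/eqP; rewrite -oppr_eq0 -sub0r -[X in X - _]F0 -E rel_rees.
have [z [zf GE]] := linear_type_core fco f0 fS G0.
have relG : ideal_gen (sym_relations (family_ideal f)) (sym_pres f G).
  by rewrite GE; apply: sym_pres_rel.
by rewrite -[F](subrK (sym_pres f G)); apply: RD FG relG.
Qed.

Section LinearTypeSyzygies.
Variables (k : fieldType) (d : nat) (f : 'I_d -> {mpoly k[d]}).
Local Notation R := {mpoly k[d]}.
Local Notation J := (family_ideal f).
Local Notation Sym := (symfree J).

Section Fibre.
Variables (K : fieldType) (psi : {rmorphism R -> K}).
Hypothesis psi_syz : forall a, syz_entry f a -> cone psi a = 0.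

Let W := {poly {mpoly K[d]}}.
Definition cone_ext (a : R) : W := map_poly (@mpolyC d K) (cone psi a).

Lemma cone_ext_zmod : zmod_morphism cone_ext.
Proof. by move=> a b; rewrite /cone_ext !rmorphB. Qed.
Lemma cone_ext_monoid : monoid_morphism cone_ext.
Proof. by split=> [|a b]; rewrite /cone_ext ?rmorph1 // !rmorphM. Qed.
HB.instance Definition _ := GRing.isZmodMorphism.Build R W cone_ext cone_ext_zmod.
HB.instance Definition _ := GRing.isMonoidMorphism.Build R W cone_ext cone_ext_monoid.

Lemma cone_ext_syz c c' : \sum_l c l * f l = \sum_l c' l * f l ->
  forall l, cone_ext (c l) = cone_ext (c' l).
Proof.
move=> E l; apply/eqP; rewrite -subr_eq0 -rmorphB; apply/eqP.
apply: etrans (congr1 (map_poly _) (psi_syz _)) (rmorph0 _).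
exists (fun l => c l - c' l), l; split=> //.
by under eq_bigr do rewrite mulrBl; rewrite sumrB E subrr.
Qed.

(** Along the line through psi the entries of all syzygies vanish, so the
    symmetric algebra of J becomes a polynomial ring with one variable for each
    generator. *)
Lemma free_fibre : exists rho : {rmorphism Sym -> W},
  [/\ forall c, rho (symC J c) = cone_ext c,
      forall i, rho (symT (sym_f f i)) = ('X_i)%:P
    & forall F, ideal_gen (sym_relations J) F -> rho F = 0].
Proof.
have H (a : symvar J) : exists c, val a = \sum_l c l * f l.
  by have /asboolP[c cE] := valP a; exists c.
have {H}[r rE] := choice H.
pose g a : W := \sum_l cone_ext (r a l) * ('X_l)%:P.
exists (sym_hom cone_ext g); split=> [c|i|F].
- exact: (sym_homC cone_ext g).
- apply: etrans (sym_homT cone_ext g _) _; rewrite /g (eq_bigr (fun l => cone_ext (l == i)%:R * ('X_l)%:P)).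
    rewrite (bigD1 i) //= eqxx rmorph1 mul1r big1 ?addr0 // => l /negbTE->.
    by rewrite rmorph0 mul0r.
  move=> l _; congr (_ * _); apply: (@cone_ext_syz _ (fun l => (l == i)%:R)).
  rewrite -rE (bigD1 i) //= eqxx mul1r big1 ?addr0 // => j /negbTE->.
  by rewrite mul0r.
- apply: sym_hom_rel => [a b c E|s a c E].
    rewrite /g -big_split; apply: eq_bigr => l _ /=; rewrite -mulrDl -rmorphD.
    congr (_ * _); apply: (@cone_ext_syz _ (fun l => r a l + r b l)).
    under [RHS]eq_bigr do rewrite mulrDl.
    by rewrite big_split /= -!rE.
  rewrite /g mulr_sumr; apply: eq_bigr => l _ /=; rewrite mulrA -rmorphM.
  congr (_ * _); apply: (@cone_ext_syz _ (fun l => s * r a l)).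
  under [RHS]eq_bigr do rewrite -mulrA.
  by rewrite -mulr_sumr -!rE.
Qed.

(** The d variables of the fibre and the coordinate 'X_i, a nonzero multiple of the
    parameter of the line, are independent over k. *)
Lemma fibre_independent (i : 'I_d) (h : 'I_d.+1 -> W) (G : {mpoly k[d.+1]}) :
  psi 'X_i != 0 -> (forall l, h (widen_ord (leqnSn d) l) = ('X_l)%:P) ->
  h ord_max = cone_ext 'X_i -> mmap (cone_ext \o @mpolyC d k) h G = 0 -> G = 0.
Proof.
move=> xi hT hX G0; apply: (can_inj (@muniK _ _)); rewrite rmorph0.
pose iota : {rmorphism k -> K} := psi \o @mpolyC d k.
pose u : W := (psi 'X_i)%:MP%:P * 'X.
have u1 : (1 < size u)%N by rewrite size_Cmul ?size_polyX ?mpolyC_eq0.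
have iota_inj : injective (map_mpoly iota : {mpoly k[d]} -> {mpoly K[d]}).
  move=> p q /mpolyP pq; apply/mpolyP => m; apply: (fmorph_inj iota).
  by have := pq m; rewrite !mcoeff_map_mpoly.
apply: (map_inj_poly iota_inj (rmorph0 _)); rewrite rmorph0.
apply/eqP; rewrite -(comp_poly_eq0 _ u1); apply/eqP; rewrite -[RHS]G0.
rewrite -[LHS]/((comp_poly u \o map_poly (map_mpoly iota) \o @muni d k) G).
apply: mpoly_hom_ext => [c|j] /=.
  rewrite muniC mmapC /= map_polyC /= comp_polyC /cone_ext /= coneC map_polyC /=.
  by rewrite map_mpolyC.
rewrite mmap_XU; case: (unliftP ord_max j) => [l|] ->.
  have -> : lift ord_max l = widen_ord (leqnSn d) l by apply: val_inj; apply: lift_max.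
  by rewrite muni_X_widen hT map_polyC /= comp_polyC map_mpolyX.
rewrite muni_X_max hX map_polyX comp_polyX /cone_ext /= coneX.
by rewrite rmorphM /= map_polyC map_polyX.
Qed.

End Fibre.

Variable D : nat.
Hypothesis f_homog : forall i, f i \is D.-homog.
Hypothesis d2 : (2 <= d)%N.
Hypothesis f_neq0 : exists i, f i != 0.

(** Otherwise the symmetric algebra has over a line through the origin a fibre of
    dimension d + 1, which is the dimension of the Rees algebra, although f j0
    vanishes on the fibre and is a nonzero divisor of the Rees algebra.
    Concretely, the variables of the f l, 'X_i and f j0 are d + 2 elements of a
    polynomial ring in d + 1 variables, and satisfy an algebraic relation. After
    cancelling a power of f j0 it becomes on the fibre a nontrivial relation
    between the others. *)
Lemma linear_type_syz_primary : linear_type J -> syz_primary f.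
Proof.
move=> LT; apply: contrapT => /(syz_point f_homog)[K [psi [i [xi psi_syz]]]].
have [rho [rhoC rhoT rho_rel]] := free_fibre psi_syz.
have [j0 fj0] := f_neq0.
pose el : 'I_d.+2 -> Sym := fun j =>
  if unlift ord_max j is Some j' then
    if unlift ord_max j' is Some l then symT (sym_f f l) else symC J 'X_i
  else symC J (f j0).
have wl n (l : 'I_n) : widen_ord (leqnSn n) l = lift ord_max l.
  by apply: val_inj; rewrite [RHS]lift_max.
pose ev : {rmorphism {mpoly k[d.+2]} -> Sym} := mmap (symC J \o @mpolyC d k) el.
have evX : ev 'X_ord_max = symC J (f j0) by rewrite /ev /= mmap_XU /el unlift_none.
pose rees : {rmorphism Sym -> {poly R}} := sym_hom polyC (fun a : symvar J => val a *: 'X).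
have reesE F : rees_map F = rees F by [].
have [G [G0 GE]] := alg_dependent (fun j => unmuni (rees (el j))).
have reesG : rees (ev G) = 0.
  apply: (can_inj (@unmuniK _ _)); rewrite rmorph0 -[RHS]GE.
  rewrite -[LHS]/((@unmuni d k \o rees \o ev) G).
  apply: mpoly_hom_ext => [c|j] /=; last by rewrite !mmap_XU.
  by rewrite !mmapC /= [sym_hom _ _ _](sym_homC polyC) unmuniC mwidenC.
have [e [G1 [H [G1n0 GE1]]]] := mpoly_peel G0.
pose Q := mwiden G1 + 'X_ord_max * H.
have reesC c : rees (symC J c) = c%:P := sym_homC polyC _ c.
have reesQ : rees (ev Q) = 0.
  have E : (f j0)%:P ^+ e * rees (ev Q) = 0.
    rewrite -reesG GE1 -/Q -reesC -evX (rmorphM ev) (rmorphXn ev).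
    by rewrite (rmorphM rees) (rmorphXn rees).
  by apply/eqP; move/eqP: E; rewrite mulf_eq0 expf_eq0 polyC_eq0 (negbTE fj0) andbF.
have rhoQ : rho (ev Q) = 0 by apply: rho_rel; apply/LT; exact: reesQ.
have rho_f : rho (symC J (f j0)) = 0.
  rewrite rhoC; apply: etrans (congr1 (map_poly _) (psi_syz _ _)) (rmorph0 _).
  have [l lj] := exists_other j0 d2.
  exact: koszul_entry lj.
have rhoG1 : rho (ev (mwiden G1)) = 0.
  rewrite -rhoQ /Q (rmorphD ev) (rmorphD rho) (rmorphM ev) (rmorphM rho) evX rho_f.
  by rewrite mul0r addr0.
move/eqP: G1n0; apply.
apply: (fibre_independent (h := fun l => rho (el (widen_ord (leqnSn _) l))) xi).
- by move=> l; rewrite /el wl liftK wl liftK rhoT.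
- by rewrite /el wl liftK unlift_none rhoC.
rewrite -[RHS]rhoG1 -[RHS]/((rho \o ev \o @mwiden d.+1 k) G1).
apply: mpoly_hom_ext => [c|j] /=; first by rewrite mwidenC !mmapC /= rhoC.
by rewrite mwiden_X !mmap_XU.
Qed.

End LinearTypeSyzygies.

End LinearType.

(** * The theorem *)
Section Truncation.
Variables (k : fieldType) (d p m : nat) (E : (d + p = m.+1)%N).
Local Notation R := {mpoly k[d]}.
Variables (Phi1 : 'M[R]_(d, m)) (Phi2 : 'M[R]_(p, m)).
Local Notation I := (idealI E Phi1 Phi2).
Local Notation J := (idealJ E Phi1 Phi2).
Local Notation f := (fun i => Delta E Phi1 Phi2 (top E i)).

(** The submatrices of these minors all omit one row of degree e1. *)
Lemma top_homog e1 : (forall i j, Phi1 i j \is e1.-homog) ->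
  (forall i j, Phi2 i j \is 1.-homog) -> exists D, forall i, f i \is D.-homog.
Proof.
move=> h1 h2; pose r (j : 'I_m.+1) := if (j < d)%N then e1 else 1%N.
have phi_homog i j : phi E Phi1 Phi2 i j \is (r i).-homog.
  rewrite -[i](cast_ordKV E); case: (split_ordP (cast_ord (esym E) i)) => a ->.
    by rewrite -/(top E a) phi_top /r /= ltn_ord; apply: h1.
  by rewrite -/(bot E a) phi_bot /r /= ltnNge leq_addr; apply: h2.
exists (\sum_j r j - e1)%N => i.
have -> : (\sum_j r j - e1 = \sum_j r (lift (top E i) j))%N.
  by rewrite (bigD1_ord (top E i)) //= {1}/r /= ltn_ord addKn.
rewrite /Delta /signed_minor -signr_odd mulr_sign.
have H : \det (row' (top E i) (phi E Phi1 Phi2)) \is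
    (\sum_j r (lift (top E i) j))%N.-homog.
  by apply: det_homog => a b; rewrite mxE; apply: phi_homog.
by case: ifP => _; rewrite ?dhomogN.
Qed.

Hypothesis hI : ideal_height I 2.
Hypothesis d2 : (2 <= d)%N.
Hypothesis colength : finite_colength Phi2.

Lemma top_neq0 : exists i, f i != 0.
Proof.
have [a Ia a0] := codim2_neq0 hI; apply: contrapT => f0.
have [l lJ] := finite_colength_mulI E Phi1 colength (Ordinal (ltnW d2)).
have [c cE] := lJ _ Ia.
have : 'X_(Ordinal (ltnW d2)) ^+ l * a == 0.
  rewrite cE big1 // => i _; rewrite [f i](_ : _ = 0) ?mulr0 //.
  by apply/eqP/negPn/negP => fi; apply: f0; exists i.
by rewrite mulf_eq0 expf_eq0 -msupp_eq0 msuppX andbF (negbTE a0).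
Qed.

(** A prime that divides J misses some variable, a power of which multiplies I
    into J; so it would divide I. *)
Lemma top_coprime b : (forall i, divides b (f i)) -> divides b 1.
Proof.
move=> bf; apply: contrapT => b1; have R_fact := @mpoly_field_factorial k d.
have b0 : b != 0.
  have [i fi] := top_neq0; apply: contra_neq fi => b0.
  by have [c ->] := bf i; rewrite b0 mulr0.
have [q qp qb] := prime_divisor R_fact b0 b1.
have [i qi] : exists i : 'I_d, ~ divides q ('X_i : R).
  apply: contrapT => /forallNP qX.
  have [h [h1 hq]] := principal_prime_height R_fact qp.
  have := irrelevant_height (prime_ideal qp) (fun i => contrapT (qX i)) hq.
  by rewrite leqNgt (leq_ltn_trans h1 d2).
apply: (codim2_prime_elt R_fact hI qp) => a Ia.
have [l lJ] := finite_colength_mulI E Phi1 colength i; have [_ _ qM] := qp.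
have qX : divides q ('X_i ^+ l * a).
  have [c ->] := lJ _ Ia; apply: divides_sum => j _; apply: divides_mull.
  exact: divides_trans qb (bf j).
have [/(prime_exp (prime_ideal qp))|//] := qM _ _ qX.
by move=> qi'; case: qi.
Qed.

End Truncation.

Theorem corollary4p19 (k : fieldType) (d n e1 : nat)
    (Phi1 : 'M[{mpoly k[d]}]_(d, n.-1))
    (Phi2 : 'M[{mpoly k[d]}]_(n - d, n.-1))
    (I J : set {mpoly k[d]}) :
  infinite_set [set: k] ->
  (3 <= d)%N -> (d + 1 <= n)%N -> (1 <= e1)%N ->
  (forall i j, Phi1 i j \is e1.-homog) ->
  (forall i j, Phi2 i j \is 1.-homog) ->
  I = minors_ideal n.-1 (col_mx Phi1 Phi2) ->
  ideal_height I 2 ->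
  J = fixed_minors_ideal Phi1 Phi2 ->
  (* the three conditions are equivalent; any one of them is assumed *)
  [\/ saturation J = I,
      ideal_height (minors_ideal (n - d) Phi2) d
    | graded_minimal_free_resolution I J (br_diff Phi2)] ->
  [/\ satisfies_Ginf J <-> satisfies_G d I,
      e1 = 1%N -> is_reduction J I
    & d = 3%N -> (linear_type J <-> satisfies_G 3 I)].
Proof.
case: n Phi1 Phi2 => [|m] Phi1 Phi2 _ d3 dn _ h1 h2 IE hI JE; first by rewrite addn1 in dn.
have E : (d + (m.+1 - d) = m.+1)%N by rewrite subnKC // (leq_trans _ dn) ?leq_addr.
move: (m.+1 - d)%N E Phi1 Phi2 h1 h2 IE JE => p E Phi1 Phi2 /= h1 h2 IE JE conditions.
rewrite (minors_ideal_max E) -/(idealI E Phi1 Phi2) in IE.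
rewrite /fixed_minors_ideal (omitted_minors_ideal E) -/(idealJ E Phi1 Phi2) in JE.
subst I J.
have d2 : (2 <= d)%N := ltnW d3.
have colength : finite_colength Phi2.
  case: conditions => [satJ|hP|[_ [_ [[_ _ _ exactBR] _]]]].
  - exact: saturation_finite_colength hI satJ.
  - exact: height_finite_colength h2 hP.
  - by apply: (br_finite_colength E d3 h2) => i x; apply: exactBR.
have JI := @idealJI _ _ _ _ E Phi1 Phi2.
have quotIJ := finite_colength_mulI E Phi1 colength.
split; first exact: G_equivalence JI quotIJ d2.
  move=> e1E; rewrite e1E in h1.
  apply: linear_reduction colength (ltnW d2); first exact: signed_minor_syzygy.
    move=> i j; rewrite -[i](cast_ordKV E); case: (split_ordP (cast_ord (esym E) i)) => a ->.
      by rewrite -/(top E a) phi_top.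
    by rewrite -/(bot E a) phi_bot.
  exact: phi_bot.
move=> d_3; subst d.
have [D fD] := top_homog E h1 h2.
have f0 := top_neq0 hI d2 colength.
split=> [LT|G3].
  have fS := LinearType.linear_type_syz_primary fD d2 f0 LT.
  move=> P h pP IP hP hd; exists 2%N; split; first exact: hI.2 pP IP hP.
  exact: (syz_primary_mu JI quotIJ fS pP hP hd).
apply: LinearType.syz_primary_linear_type f0 _; first exact: top_coprime hI d2 colength.
exact (G_syz_primary fD JI quotIJ d2 G3).
Qed.
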